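(* For complex numbers $\xi,\zeta$ consider the coordinate-representation kernel $$\langle x_1,x_2,x_3|\hat{\mathcal R}_{123}|x_1',x_2',x_3'\rangle=\varrho_x\,\delta(x_2-x_1'-x_3')\,\delta(x_2'-x_1-x_3)\,\varphi\big(x_1-x_1'+\tfrac12(\xi-\zeta)\ell_{23}+i\eta\big)\,e^{\pi i(x_1-x_1'+\xi\ell_{23})(x_2-x_2'+\zeta\ell_{13}-2i\eta)},\qquad \varrho_x=(2K)^{-1},$$ whose case $\xi=1$, $\zeta=-1$ is the integral kernel of the modular double operator $\hat{\mathcal R}_{123}$. In the momentum representation, the integral kernel of $\hat{\mathcal R}_{123}$, namely the Fourier transform $$\langle p_1,p_2,p_3|\hat{\mathcal R}_{123}|p_1',p_2',p_3'\rangle=\int dx_1dx_2dx_3dx_1'dx_2'dx_3'\;e^{\pi i(p_1'x_1'+p_2'x_2'+p_3'x_3'-p_1x_1-p_2x_2-p_3x_3)}\langle x_1,x_2,x_3|\hat{\mathcal R}_{123}|x_1',x_2',x_3'\rangle,$$ is given by $$\varrho_p\,\delta(p_1+p_2-p_1'-p_2')\,\delta(p_2+p_3-p_2'-p_3')\,\varphi\big(p_2-p_3'-\tfrac12(\xi+\zeta)\ell_{23}+i\eta\big)\,e^{\pi i(p_2-p_3'-\xi\ell_{23})(p_3-p_1+\zeta\ell_{13}-2i\eta)},$$ where $\varrho_p=8\varrho_x\,e^{\pi i\xi\ell_{23}(\zeta\ell_{13}-2i\eta)}$.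
   Context: $i=\sqrt{-1}$. $\mathfrak b$ is a parameter with $q=e^{\hbar}$, $\hbar=i\pi\mathfrak b^2$, and $\eta=\frac{\mathfrak b+\mathfrak b^{-1}}2$; $K=e^{-i\pi(4\eta^2+1)/12}$. The spectral parameters $\ell_1,\ell_2,\ell_3$ are related to nonzero complex parameters $\kappa_j=e^{\lambda_j}$ by $\lambda_j=\pi\mathfrak b\ell_j$; $\ell_{jk}=\ell_j-\ell_k$. The modular double operator is $$\hat{\mathcal R}_{123}=\varphi\big(\tfrac12(\hat x_1+\hat p_1+\hat x_3-\hat p_3-\hat x_2+\ell_{13})\big)^{-1}\rho_{23}\,e^{\pi i\hat x_1(\hat p_2-\hat p_3)}e^{\pi i\ell_{23}(\hat p_1-\hat p_3)}$$ with $[\hat x_j,\hat p_k]=\frac i\pi\delta_{jk}$, where $\rho_{23}$ exchanges the second and third components. In the coordinate representation on $L^2(\mathbb R^3)$, $\hat x_k$ is multiplication by $x_k$ and $\hat p_k=-\frac i\pi\frac\partial{\partial x_k}$; in the momentum representation on $L^2(\mathbb R^3)$, $\hat p_k$ is multiplication by $p_k$ and $\hat x_k=\frac i\pi\frac\partial{\partial p_k}$. Noncompact quantum dilogarithm: $$\varphi(z)=\exp\left(\frac14\int\frac{e^{-2izw}}{\sinh(w\mathfrak b)\sinh(w/\mathfrak b)}\frac{dw}{w}\right)=\frac{(e^{2\pi(z+i\eta)\mathfrak b};q^2)_\infty}{(e^{2\pi(z-i\eta)\mathfrak b^{-1}};\bar q^2)_\infty},\qquad q=e^{i\pi\mathfrak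 b^2},\ \bar q=e^{-i\pi\mathfrak b^{-2}},\ (z;q)_\infty=\prod_{k\ge0}(1-zq^k),$$ the infinite product formula being valid in the strong coupling regime $0<\eta<1$. *)

(* Defs.v *)
From HB Require Import structures.
From mathcomp Require Import all_boot all_order all_algebra.
From mathcomp Require Import complex.
From mathcomp Require Import all_classical all_reals all_analysis.
Set Implicit Arguments.
Unset Strict Implicit.
Unset Printing Implicit Defensive.
Import Order.TTheory GRing.Theory Num.Theory.
Import numFieldNormedType.Exports.
Local Open Scope classical_set_scope.
Local Open Scope complex_scope.
Local Open Scope ring_scope.

Definition cexp (R : realType) (z : R[i]) : R[i] :=
  (expR (complex.Re z) * cos (complex.Im z))
    +i* (expR (complex.Re z) * sin (complex.Im z)).

Definition csinh (R : realType) (z : R[i]) : R[i] :=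
  (cexp z - cexp (- z)) / 2.

Definition cpi (R : realType) : R[i] := (pi : R)%:C.

Definition cint (R : realType) (f : R -> R[i]) : R[i] :=
  (\int[@lebesgue_measure R]_(t in [set: R]) complex.Re (f t))
    +i* (\int[@lebesgue_measure R]_(t in [set: R]) complex.Im (f t)).

Definition eta (R : realType) (b : R[i]) : R[i] := (b + b^-1) / 2.

Definition Kcst (R : realType) (b : R[i]) : R[i] :=
  cexp (- ('i * cpi R * (4 * eta b ^+ 2 + 1) / 12)).

(* For 0 < Re b the integrand of log phi has a triple pole at w = 0 and its
   other poles at w = i pi n b^{+-1}, n <> 0.  The contour is R + i0: it passes
   above 0, which is the choice that agrees with the product formula (it makes
   phi z tend to 1 as Re z -> -oo).  Any line Im w = h with
   0 < h < pi * min (Re b) (Re b^-1) represents it; the one below is such. *)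
Definition qdilog_contour (R : realType) (b : R[i]) (t : R) : R[i] :=
  t +i* Num.min (complex.Re b) (complex.Re b^-1).

(* The integral converges exactly on the strip |Im z| < Re (eta b), see
   [qdilog_strip]. *)
Definition qdilog (R : realType) (b z : R[i]) : R[i] :=
  cexp (4^-1 * cint (fun t : R =>
    let w := qdilog_contour b t in
    cexp (- (2 * 'i * z * w)) / (csinh (w * b) * csinh (w / b) * w))).

Definition qdilog_strip (R : realType) (b z : R[i]) : Prop :=
  `|complex.Im z| < complex.Re (eta b).

(* Points of C^6 = C^3 x C^3, in the order (x1, x2, x3, x1', x2', x3'). *)
Definition pt6 (R : realType) (x1 x2 x3 x1' x2' x3' : R[i]) :
    'rV[R[i]^o]_6 :=
  \row_(k < 6) nth 0 [:: x1; x2; x3; x1'; x2'; x3'] k.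

(* The kernels below grow exponentially for complex parameters, so neither they
   nor their Fourier transforms are tempered.  They act on the entire functions
   which decay faster than every exponential in every tube around R^6 (the test
   space of Fourier ultra-hyperfunctions, preserved by the Fourier transform);
   translations by complex vectors act on it as well.  Continuity of the
   derivatives is automatic for complex differentiable functions; it is listed
   as part of the usual definition of a C^1 holomorphic function. *)
Definition test_function (R : realType)
    (psi : 'rV[R[i]^o]_6 -> R[i]^o) : Prop :=
  [/\ forall z, differentiable psi z,
      forall v, continuous (fun z => 'D_v psi z)
    & forall a : R, exists M : R, forall z : 'rV[R[i]^o]_6,
        (forall k, `|complex.Im (z ord0 k)| <= a) ->
        `|psi z| <=
          (M * expR (- (a * \sum_(k < 6) `|complex.Re (z ord0 k)|)))%:C].

(* Generalized kernels T(x, x') are identified with the functionals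
   f |-> \int T(x, x') f(x, x') dx dx'. *)
Definition gkernel (R : realType) : Type :=
  ('rV[R[i]^o]_6 -> R[i]^o) -> R[i].

Definition fourier_test (R : realType) (psi : 'rV[R[i]^o]_6 -> R[i]^o)
    (X : 'rV[R[i]^o]_6) : R[i]^o :=
  let x (k : nat) : R[i] := X ord0 (inord k) in
  cint (fun p1 : R => cint (fun p2 : R => cint (fun p3 : R =>
  cint (fun p1' : R => cint (fun p2' : R => cint (fun p3' : R =>
    cexp (cpi R * 'i *
      (p1'%:C * x 3%N + p2'%:C * x 4%N + p3'%:C * x 5%N
       - p1%:C * x 0%N - p2%:C * x 1%N - p3%:C * x 2%N))
    * psi (pt6 p1%:C p2%:C p3%:C p1'%:C p2'%:C p3'%:C))))))).

(* (F T)(p, p') = \int e^{pi i (p'.x' - p.x)} T(x, x') dx dx', by transposition: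
   pairing F T with psi is pairing T with [fourier_test psi]. *)
Definition fourier_gkernel (R : realType) (T : gkernel R) : gkernel R :=
  fun psi => T (fourier_test psi).

Definition rho_x (R : realType) (b : R[i]) : R[i] := (2 * Kcst b)^-1.

Definition rho_p (R : realType) (b l1 l2 l3 xi zeta : R[i]) : R[i] :=
  8 * rho_x b *
  cexp (cpi R * 'i * xi * (l2 - l3) * (zeta * (l1 - l3) - 2 * 'i * eta b)).

(* Argument of phi in the coordinate kernel, as a function of u = x1 - x1'. *)
Definition coord_arg (R : realType) (b l2 l3 xi zeta u : R[i]) : R[i] :=
  u + 2^-1 * (xi - zeta) * (l2 - l3) + 'i * eta b.

(* Argument of phi in the momentum kernel, as a function of w = p2 - p3'. *)
Definition mom_arg (R : realType) (b l2 l3 xi zeta w : R[i]) : R[i] :=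
  w - 2^-1 * (xi + zeta) * (l2 - l3) + 'i * eta b.

(* rho_x delta(x2 - x1' - x3') delta(x2' - x1 - x3) phi(..) e^{..}
   The delta functions are integrated out in x3' and x3.
   The first pole of phi is at i eta, so for real parameters phi(.. + i eta) is
   singular at a real point and has to be read as phi(.. + i eta - i0), the
   boundary value from the side on which phi is analytic.  Accordingly x1 runs
   over R + i c, with c such that the argument of phi lies in the strip where
   phi is analytic; x3 = x2' - x1 moves along, the other variables are real. *)
Definition coord_kernel (R : realType) (b l1 l2 l3 xi zeta : R[i]) (c : R) :
    gkernel R :=
  fun f => rho_x b *
  cint (fun t1 : R => cint (fun t2 : R =>
  cint (fun t1' : R => cint (fun t2' : R =>
    let x1 := t1 +i* c in let x2 := t2%:C in
    let x1' := t1'%:C in let x2' := t2'%:C in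
    let x3 := x2' - x1 in let x3' := x2 - x1' in
    qdilog b (coord_arg b l2 l3 xi zeta (x1 - x1'))
    * cexp (cpi R * 'i * (x1 - x1' + xi * (l2 - l3))
            * (x2 - x2' + zeta * (l1 - l3) - 2 * 'i * eta b))
    * f (pt6 x1 x2 x3 x1' x2' x3'))))).

(* rho_p delta(p1 + p2 - p1' - p2') delta(p2 + p3 - p2' - p3') phi(..) e^{..}
   The delta functions are integrated out in p1' and p2' (p2' first), and p2
   runs over R + i d for the same reason as above. *)
Definition mom_kernel (R : realType) (b l1 l2 l3 xi zeta : R[i]) (d : R) :
    gkernel R :=
  fun f => rho_p b l1 l2 l3 xi zeta *
  cint (fun t1 : R => cint (fun t2 : R =>
  cint (fun t3 : R => cint (fun t3' : R =>
    let p1 := t1%:C in let p2 := t2 +i* d in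
    let p3 := t3%:C in let p3' := t3'%:C in
    let p2' := p2 + p3 - p3' in let p1' := p1 + p2 - p2' in
    qdilog b (mom_arg b l2 l3 xi zeta (p2 - p3'))
    * cexp (cpi R * 'i * (p2 - p3' - xi * (l2 - l3))
            * (p3 - p1 + zeta * (l1 - l3) - 2 * 'i * eta b))
    * f (pt6 p1 p2 p3 p1' p2' p3'))))).

(* Main.v *)
Require Import Defs.
From mathcomp Require Import all_boot all_order all_algebra.
From mathcomp Require Import complex.
From mathcomp Require Import all_classical all_reals all_analysis.
From mathcomp Require Import measurable_realfun ring lra.
Set Implicit Arguments.
Unset Strict Implicit.
Unset Printing Implicit Defensive.
Import Order.TTheory GRing.Theory Num.Theory.
Import numFieldNormedType.Exports.
Local Open Scope classical_set_scope.
Local Open Scope complex_scope.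
Local Open Scope ring_scope.

Local Notation Re := complex.Re (only parsing).
Local Notation Im := complex.Im (only parsing).

(* With u = x1 - x1', beta = xi l23 and A = zeta l13 - 2 i eta, the total phase of the
   coordinate kernel and of the Fourier kernel is
     x2 (u + beta + p3' - p2) - x2' (u + beta + p3 - p2') + x1 (p1' - p3' + p3 - p1)
       - u (p1' - p3') + (u + beta) A.
   Shifting the contours of p1, p2, p1', p2' by amounts that depend on x1, x2, u, x2' makes
   the integral over all ten variables absolutely convergent, so that the integrations
   may be interchanged.  The integrals over x2, x2' and x1 are then Fourier inversions, each
   of which gives a factor 2 and fixes one momentum.  The result is the momentum kernel
   with p2 on R + i (c + Im beta).  This contour can be moved to R + i d because phi is
   holomorphic and at most exponentially growing in its strip.  For Re z <= 0 the growth
   bound is read off the contour integral; for Re z >= 0 it follows from the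
   reflection formula, in which phi(z) phi(-z) is the exponential of an even quadratic
   polynomial whose leading coefficient is purely imaginary. *)

(** * Complex exponentials and sequences *)

(** For fixed x the momentum integrals inside [fourier_test] converge, and the integrals over x
    converge afterwards, but on unshifted contours the joint integrand has no decay in x: that decay
    comes from cancellation in p, so Fubini does not apply. The shifts turn cancellation into size.
    Moving a momentum that is multiplied by x by M sgn(x), in the right direction, gives a factor
    exp(-pi M |x|); the bounded continuous substitute [damp] for the sign keeps the integrand
    continuous. The shift of p1', which tames u, enters the phase again multiplied by x1, so p1
    needs a shift one unit stronger. All shifts being bounded, the test function pays for them, with
    a decay rate chosen after the growth rate of phi is known. Such decay beats exponential growth
    but no Gaussian, which is why the leading coefficient in the reflection formula must be
    imaginary. Estimates use one majorant, 1/(1+t^2), and holomorphy means complex C^1, for which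
    Cauchy's theorem on rectangles follows from the fundamental theorem of calculus and Fubini. *)

Section Modulus.
Variable R : realType.
Local Notation C := R[i].
Implicit Types (z w : C) (x y : R).

Definition cabs z : R := ComplexField.Normc.normc z.

Lemma cabsE z : cabs z = Num.sqrt (Re z ^+ 2 + Im z ^+ 2).
Proof. by case: z. Qed.

Lemma normC_cabs z : `|z| = (cabs z)%:C.
Proof. by rewrite cabsE normc_def. Qed.

Lemma cReD z w : Re (z + w) = Re z + Re w.
Proof. by case: z; case: w. Qed.
Lemma cImD z w : Im (z + w) = Im z + Im w.
Proof. by case: z; case: w. Qed.
Lemma cReN z : Re (- z) = - Re z.
Proof. by case: z. Qed.
Lemma cImN z : Im (- z) = - Im z.
Proof. by case: z. Qed.
Lemma cReM z w : Re (z * w) =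
  Re z * Re w - Im z * Im w.
Proof. by case: z; case: w. Qed.
Lemma cImM z w : Im (z * w) =
  Re z * Im w + Im z * Re w.
Proof. by case: z => a b; case: w => c d. Qed.
Lemma cReZ x z : Re (x%:C * z) = x * Re z.
Proof. by rewrite cReM /= mul0r subr0. Qed.
Lemma cImZ x z : Im (x%:C * z) = x * Im z.
Proof. by rewrite cImM /= mul0r addr0. Qed.
Lemma complexP z w : Re z = Re w ->
  Im z = Im w -> z = w.
Proof. by case: z; case: w => a b c d /= -> ->. Qed.
Lemma complexRI x y : x +i* y = x%:C + 'i * y%:C.
Proof. by apply: complexP; rewrite ?cReD ?cImD ?cReM ?cImM /=; ring. Qed.
Lemma natcE n : (n%:R : C) = (n%:R : R)%:C.
Proof. by rewrite rmorph_nat. Qed.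

Lemma cabs_ge0 z : 0 <= cabs z.
Proof. by rewrite cabsE sqrtr_ge0. Qed.
Lemma cabs0 : cabs 0 = 0.
Proof. exact: ComplexField.Normc.normc0. Qed.
Lemma cabs_eq0 z : cabs z = 0 -> z = 0.
Proof. exact: ComplexField.Normc.eq0_normc. Qed.
Lemma cabs_gt0 z : z != 0 -> 0 < cabs z.
Proof.
move=> z0; rewrite lt_def cabs_ge0 andbT.
by apply/negP => /eqP /cabs_eq0 zz; rewrite zz eqxx in z0.
Qed.
Lemma cabsM z w : cabs (z * w) = cabs z * cabs w.
Proof. exact: ComplexField.Normc.normcM. Qed.
Lemma cabsV z : cabs z^-1 = (cabs z)^-1.
Proof. exact: ComplexField.Normc.normcV. Qed.
Lemma cabsN z : cabs (- z) = cabs z.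
Proof. by rewrite !cabsE cReN cImN !sqrrN. Qed.
Lemma ler_cabsD z w : cabs (z + w) <= cabs z + cabs w.
Proof. exact: le_normcD. Qed.
Lemma ler_cabsB z w : cabs (z - w) <= cabs z + cabs w.
Proof. by rewrite -[cabs w]cabsN ler_cabsD. Qed.
Lemma cabsBC z w : cabs (z - w) = cabs (w - z).
Proof. by rewrite -cabsN opprB. Qed.
Lemma cabs_real x : cabs x%:C = `|x|.
Proof. by rewrite cabsE /= expr0n addr0 sqrtr_sqr. Qed.
Lemma cabs_i : cabs 'i = 1.
Proof. by rewrite cabsE /= expr0n add0r expr1n sqrtr1. Qed.
Lemma cabs1 : cabs 1 = 1.
Proof. exact: ComplexField.Normc.normc1. Qed.
Lemma cabs_nat n : cabs n%:R = n%:R.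
Proof. by rewrite natcE cabs_real ger0_norm. Qed.
Lemma cabsX z n : cabs (z ^+ n) = cabs z ^+ n.
Proof. by elim: n => [|n ih]; rewrite ?expr0 ?cabs1// !exprS cabsM ih. Qed.

Lemma ler_Re_cabs z : `|Re z| <= cabs z.
Proof. by have := normc_ge_Re z; rewrite normC_cabs lecR. Qed.
Lemma ler_Im_cabs z : `|Im z| <= cabs z.
Proof.
rewrite cabsE -sqrtr_sqr ler_sqrt ?lerDr ?sqr_ge0//.
by rewrite addr_ge0 ?sqr_ge0.
Qed.
Lemma ler_cabs_ReIm z : cabs z <= `|Re z| + `|Im z|.
Proof.
case: z => a b; rewrite complexRI (le_trans (ler_cabsD _ _))//.
by rewrite cabsM cabs_i mul1r !cabs_real !cReD !cImD !cReM !cImM /= ; do ! rewrite ?(mul0r, mul1r, subr0, addr0, add0r).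
Qed.
Lemma ler_cabs_dist z w : `|cabs z - cabs w| <= cabs (z - w).
Proof.
rewrite ler_norml; apply/andP; split.
  rewrite lerNl opprB lerBlDr addrC -[X in cabs X <= _](subrK z w) addrC.
  by rewrite (le_trans (ler_cabsD _ _))// [cabs (w - z)]cabsBC addrC.
by rewrite lerBlDr -{1}[z](subrK w) ler_cabsD.
Qed.

Lemma Re_cexp z : Re (cexp z) = expR (Re z) * cos (Im z).
Proof. by []. Qed.
Lemma Im_cexp z : Im (cexp z) = expR (Re z) * sin (Im z).
Proof. by []. Qed.
Lemma cexpD z w : cexp (z + w) = cexp z * cexp w.
Proof.
apply: complexP; rewrite ?cReM ?cImM ?Re_cexp ?Im_cexp !cReD !cImD expRD ?cosD ?sinD; ring.
Qed.
Lemma cexp0 : cexp (0 : C) = 1.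
Proof.
by apply: complexP; rewrite ?Re_cexp ?Im_cexp /= expR0 ?cos0 ?sin0 ?mulr0 ?mulr1.
Qed.
Lemma cabs_cexp z : cabs (cexp z) = expR (Re z).
Proof.
rewrite cabsE Re_cexp Im_cexp !exprMn -mulrDr cos2Dsin2 mulr1 sqrtr_sqr.
by rewrite gtr0_norm ?expR_gt0.
Qed.
Lemma cexp_neq0 z : cexp z != 0.
Proof.
apply/eqP => z0; have := cabs_cexp z; rewrite z0 cabs0 => /esym/eqP.
by rewrite gt_eqF ?expR_gt0.
Qed.
Lemma cexpN z : cexp (- z) = (cexp z)^-1.
Proof.
by apply/eqP; rewrite -(inj_eq (mulfI (cexp_neq0 z))) -cexpD subrr cexp0 divff ?cexp_neq0.
Qed.
End Modulus.

Section ComplexSequences.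
Variable R : realType.
Local Notation C := R[i].

(** Stated with the real-valued modulus, so that complex limits reduce to limits of real
    sequences. *)
Definition ccvg (u : nat -> C) (l : C) :=
  (fun n => cabs (u n - l)) @ \oo --> (0 : R).

Lemma ccvg_squeeze (u : nat -> C) l (e : nat -> R) :
  (forall n, cabs (u n - l) <= e n) -> e @ \oo --> (0 : R) -> ccvg u l.
Proof.
move=> h e0; apply: (squeeze_cvgr _ (@cvg_cst _ _ _ _ _) e0).
by near=> n; rewrite cabs_ge0 h.
Unshelve. all: by end_near. Qed.

Lemma ccvgP (u : nat -> C) l : ccvg u l <->
  (fun n => Re (u n)) @ \oo --> Re l /\
  (fun n => Im (u n)) @ \oo --> Im l.
Proof.
split=> [h|[h1 h2]].
  split; apply/cvgrPdist_le => e e0; move/cvgrPdist_le: h => /(_ _ e0);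
    apply: filterS => n; rewrite sub0r normrN ger0_norm ?cabs_ge0//; apply: le_trans;
    rewrite distrC.
    by rewrite -cReN -cReD ler_Re_cabs.
  by rewrite -cImN -cImD ler_Im_cabs.
apply: (@ccvg_squeeze _ _ (fun n => `|Re (u n) - Re l| + `|Im (u n) - Im l|)).
  by move=> n; rewrite (le_trans (ler_cabs_ReIm _))// cReD cImD cReN cImN.
rewrite -[0 in X in _ --> X](addr0 0) -{1}(@normr0 _ R) -{1}(subrr (Re l)).
rewrite -{1}(@normr0 _ R) -{1}(subrr (Im l)).
by apply: cvgD; apply: cvg_norm; apply: cvgB => //; exact: cvg_cst.
Qed.

Lemma ccvg_cst (l : C) : ccvg (fun=> l) l.
Proof. by apply/ccvgP; split; exact: cvg_cst. Qed.
Lemma ccvg_real (u : nat -> R) (l : R) : u @ \oo --> l -> ccvg (fun n => (u n)%:C) l%:C.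
Proof. by move=> h; apply/ccvgP; split => //=; exact: cvg_cst. Qed.
Lemma ccvgD u v (l k : C) : ccvg u l -> ccvg v k -> ccvg (fun n => u n + v n) (l + k).
Proof.
move=> /ccvgP[a b] /ccvgP[c d]; apply/ccvgP; rewrite cReD cImD; split.
  by under eq_fun do rewrite cReD; exact: cvgD.
by under eq_fun do rewrite cImD; exact: cvgD.
Qed.
Lemma ccvgN u (l : C) : ccvg u l -> ccvg (fun n => - u n) (- l).
Proof.
move=> /ccvgP[a b]; apply/ccvgP; rewrite cReN cImN; split.
  by under eq_fun do rewrite cReN; exact: cvgN.
by under eq_fun do rewrite cImN; exact: cvgN.
Qed.
Lemma ccvgM u v (l k : C) : ccvg u l -> ccvg v k -> ccvg (fun n => u n * v n) (l * k).
Proof.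
move=> /ccvgP[a b] /ccvgP[c d]; apply/ccvgP; rewrite cReM cImM; split.
  by under eq_fun do rewrite cReM; apply: cvgB; exact: cvgM.
by under eq_fun do rewrite cImM; apply: cvgD; exact: cvgM.
Qed.
Lemma ccvgB u v (l k : C) : ccvg u l -> ccvg v k -> ccvg (fun n => u n - v n) (l - k).
Proof. by move=> hu /ccvgN; exact: ccvgD. Qed.
Lemma ccvg_cexp u (l : C) : ccvg u l -> ccvg (fun n => cexp (u n)) (cexp l).
Proof.
move=> /ccvgP[a b]; apply/ccvgP; split.
  apply: cvgM; first by apply: continuous_cvg => //; exact: continuous_expR.
  by apply: continuous_cvg => //; exact: continuous_cos.
apply: cvgM; first by apply: continuous_cvg => //; exact: continuous_expR.
by apply: continuous_cvg => //; exact: continuous_sin.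
Qed.
Lemma ccvg_cabs u (l : C) : ccvg u l -> (fun n => cabs (u n)) @ \oo --> cabs l.
Proof.
move=> h; apply/cvgrPdist_le => e e0; move/cvgrPdist_le: h => /(_ _ e0).
apply: filterS => n; rewrite sub0r normrN ger0_norm ?cabs_ge0//; apply: le_trans.
by rewrite distrC ler_cabs_dist.
Qed.
Lemma ccvgV u (l : C) : l != 0 -> ccvg u l -> ccvg (fun n => (u n)^-1) l^-1.
Proof.
move=> l0 h; have ha := ccvg_cabs h.
have l0' : cabs l != 0 by rewrite gt_eqF ?cabs_gt0.
have : (fun n => cabs (u n - l) / (cabs (u n) * cabs l)) @ \oo --> (0 : R).
  rewrite -[0](mul0r (cabs l * cabs l)^-1); apply: cvgM => //.
  apply: cvgV; first by rewrite mulf_neq0.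
  by apply: cvgM => //; exact: cvg_cst.
apply: cvg_trans; apply: near_eq_cvg.
(* Early terms may vanish, where the inverse is the default 0; only a tail can be put over a common
   denominator. *)
have : \forall n \near \oo, cabs (u n) != 0.
  have /cvgrPdist_lt/(_ (cabs l)) := ha; rewrite cabs_gt0// => /(_ isT).
  apply: filterS => n; apply: contraTneq => ->.
  by rewrite subr0 ger0_norm ?cabs_ge0// ltxx.
apply: filterS => n un0.
have un : u n != 0 by apply: contra_neq un0 => ->; rewrite cabs0.
rewrite -cabsM -cabsV -cabsM.
rewrite -cabsN; congr cabs; field.
by rewrite un l0.
Qed.
Lemma ccvg_unique u (l k : C) : ccvg u l -> ccvg u k -> l = k.
Proof.
move=> /ccvgP[a b] /ccvgP[c d]; apply: complexP.
  exact: (cvg_unique _ a c).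
exact: (cvg_unique _ b d).
Qed.
End ComplexSequences.

(** * Integrals of rapidly decaying functions *)

Section RealNice.
Variable R : realType.
Let mu := @lebesgue_measure R.

(** The common majorant: continuous, even, at most 1 and integrable. One constant in front of it, or
    of a product of copies in several variables, serves dominated convergence, Fubini and contour
    shifts alike. *)
Definition pk (t : R) : R := (oneDsqr t)^-1.

Lemma pk_gt0 t : 0 < pk t.
Proof. by rewrite invr_gt0. Qed.
Lemma pk_ge0 t : 0 <= pk t.
Proof. exact/ltW/pk_gt0. Qed.
Lemma pk_le1 t : pk t <= 1.
Proof. by rewrite invf_le1. Qed.
Lemma pkN t : pk (- t) = pk t.
Proof. by rewrite /pk /oneDsqr sqrrN. Qed.
Lemma continuous_pk : continuous pk.
Proof. exact: continuous_oneDsqrV. Qed.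

Lemma integral_pk : (\int[mu]_t (pk t)%:E = pi%:E)%E.
Proof.
rewrite ge0_symfun_integralT//.
- rewrite -set_itvcy integral0y_oneDsqr -EFinM; congr EFin.
  by rewrite mulrC divfK.
- exact: pk_ge0.
- exact: continuous_pk.
- by move=> x /=; rewrite pkN.
Qed.

Lemma integrable_pk (M : R) : mu.-integrable [set: R] (fun t => (M * pk t)%:E).
Proof.
under eq_fun do rewrite EFinM.
apply: integrableZl => //; apply/integrableP; split.
  by apply/measurable_EFinP; apply: continuous_measurable_fun; exact: continuous_pk.
under eq_integral do rewrite gee0_abs ?lee_fin ?pk_ge0//.
by rewrite integral_pk ltry.
Qed.

Lemma integrable_le_pk (f : R -> R) (M : R) : measurable_fun [set: R] f ->
  (forall t, `|f t| <= M * pk t) -> mu.-integrable [set: R] (EFin \o f).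
Proof.
move=> mf h; apply: (le_integrable _ _ _ (integrable_pk M)) => //.
  exact/measurable_EFinP.
move=> t _ /=; rewrite lee_fin (le_trans (h t))// ler_norm//.
Qed.

Lemma Rintegral_pk (M : R) : \int[mu]_(t in [set: R]) (M * pk t) = M * pi.
Proof.
rewrite RintegralZl//; last by have := integrable_pk 1; under eq_fun do rewrite mul1r.
by rewrite /Rintegral integral_pk.
Qed.

Lemma ler_Rintegral_pk (f : R -> R) (M : R) : measurable_fun [set: R] f ->
  (forall t, `|f t| <= M * pk t) -> `|\int[mu]_(t in [set: R]) f t| <= M * pi.
Proof.
move=> mf h; have intf := integrable_le_pk mf h.
rewrite (le_trans (le_normr_Rintegral _ _))//.
rewrite -Rintegral_pk le_Rintegral//; last exact: integrable_pk.
exact: integrable_norm.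
Qed.

End RealNice.

(** * Affine changes of variable *)

Section Affine.
Variable R : realType.
Let mu := @lebesgue_measure R.

Definition affine (a b : R) (t : R) : measurableTypeR R := a * t + b.

Lemma measurable_affine (a b : R) : measurable_fun [set: R] (affine a b).
Proof.
apply: continuous_measurable_fun => x.
apply: cvgD; last exact: cvg_cst.
by apply: cvgM; [exact: cvg_cst|exact: cvg_id].
Qed.

Definition affine_measure (a b : R) : {measure set (measurableTypeR R) -> \bar R} :=
  mscale (NngNum (normr_ge0 a))
    (measure_function_pushforward__canonical__measure_function_Measure mu
      (measurable_affine a b)).

(** By uniqueness of Lebesgue measure only half-open intervals have to be checked. A negative slope
    exchanges the open and the closed end of the preimage, which leaves its length unchanged. *)
Lemma lebesgue_measure_affine (a b : R) (A : set R) : a != 0 -> measurable A ->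
  affine_measure a b A = mu A.
Proof.
move=> a0 mA; apply/esym/lebesgue_measure_unique => //= _ [[x y]] _ <-.
rewrite [RHS]/mscale /= /pushforward.
have [ap|an|] := ltgtP a 0; last by move/eqP; rewrite (negbTE a0).
- rewrite (_ : _ @^-1` _ = `[(y - b) / a, (x - b) / a[%classic); last first.
    apply/seteqP; split => t /=; rewrite /affine !in_itv /= ?ler_ndivrMr// ?ltr_ndivlMr// ?lerBlDr ?ltrBlDr ?ltrBrDr ?lerBrDr mulrC => /andP[-> ->] //.
  rewrite !lebesgue_measure_itv/= !lte_fin ltr_nM2r ?invr_lt0// ltrD2r.
  case: ifPn => xy; rewrite ?mule0// -!EFinB -EFinM ltr0_norm//; congr EFin.
  by field.
- rewrite (_ : _ @^-1` _ = `](x - b) / a, (y - b) / a]%classic); last first.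
    apply/seteqP; split => t /=; rewrite /affine !in_itv /= ?ler_pdivlMr// ?ltr_pdivrMr// ?lerBlDr ?ltrBlDr ?ltrBrDr ?lerBrDr mulrC => /andP[-> ->] //.
  rewrite !lebesgue_measure_itv/= !lte_fin ltr_pM2r ?invr_gt0// ltrD2r.
  case: ifPn => xy; rewrite ?mule0// -!EFinB -EFinM gtr0_norm//; congr EFin.
  by field.
Qed.

Lemma ge0_integral_affine (a b : R) (g : R -> \bar R) : a != 0 ->
  measurable_fun [set: R] g -> (forall t, 0 <= g t)%E ->
  (`|a|%:E * \int[mu]_t g (affine a b t) = \int[mu]_t g t)%E.
Proof.
move=> a0 mg g0.
transitivity (\int[affine_measure a b]_t g t)%E; last first.
  by apply: eq_measure_integral => A mA _; exact: lebesgue_measure_affine.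
rewrite /affine_measure ge0_integral_mscale//= ge0_integral_pushforward//.
exact: measurable_affine.
Qed.

Lemma Rintegral_affine (a b : R) (f : R -> R) : a != 0 ->
  mu.-integrable [set: R] (EFin \o f) ->
  `|a| * \int[mu]_(t in [set: R]) f (a * t + b) = \int[mu]_(t in [set: R]) f t.
Proof.
(* Both parts must have finite transformed integrals before [fine] may be distributed over their
   difference. *)
move=> a0 intf; have H (g : R -> \bar R) : measurable_fun [set: R] g -> (forall t, 0 <= g t)%E ->
    (\int[mu]_t g t < +oo -> \int[mu]_t g (affine a b t) \is a fin_num)%E.
  move=> mg g0; rewrite -(ge0_integral_affine b a0 mg g0) => h.
  rewrite ge0_fin_numE ?integral_ge0//; apply: contraTT h; rewrite -!leNgt !leye_eq => /eqP ->.
  by rewrite gt0_muley ?lte_fin ?normr_gt0.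
have /integrableP[mf _] := intf.
have mf1 := measurable_funepos mf; have mf2 := measurable_funeneg mf.
have h1 := integrable_pos_fin_num measurableT intf.
have h2 := integrable_neg_fin_num measurableT intf.
have h1' : (\int[mu]_t (EFin \o f)^\+%E (affine a b t) \is a fin_num)%E.
  by apply: H => //; rewrite -ge0_fin_numE// integral_ge0.
have h2' : (\int[mu]_t (EFin \o f)^\-%E (affine a b t) \is a fin_num)%E.
  by apply: H => //; rewrite -ge0_fin_numE// integral_ge0.
rewrite /Rintegral.
have -> : (\int[mu]_t (f (a * t + b)%R)%:E = \int[mu]_t (EFin \o f)^\+%E (affine a b t) -
    \int[mu]_t (EFin \o f)^\-%E (affine a b t))%E by rewrite [LHS]integralE; congr (_ - _)%E; apply: eq_integral => t _; rewrite ?funeposE ?funenegE.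
have -> : (\int[mu]_t (f t)%:E = \int[mu]_t (EFin \o f)^\+%E t -
    \int[mu]_t (EFin \o f)^\-%E t)%E by rewrite [LHS]integralE.
rewrite (fineB h1' h2') (fineB h1 h2) mulrBr; congr (_ - _).
  by rewrite -(ge0_integral_affine b a0 mf1)// fineM.
by rewrite -(ge0_integral_affine b a0 mf2)// fineM.
Qed.
End Affine.

(** * Complex-valued integrals over the line *)

Section ComplexIntegral.
Variable R : realType.
Local Notation C := R[i].
Let mu := @lebesgue_measure R.
Implicit Types f g : R -> C.

(** Sequential continuity is equivalent to continuity on the line, and it is checked with the limit
    rules for [ccvg]. *)
Definition scont f := forall u (l : R), u @ \oo --> l -> ccvg (f \o u) (f l).

Lemma continuous_seq (f : R -> R) : (forall (u : nat -> R) (l : R), u @ \oo --> l ->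
  (f \o u) @ \oo --> f l) -> continuous f.
Proof. by move=> h x; apply/(@cvg_nbhsP _ R^o) => u; exact: h. Qed.

Lemma scont_Re f : scont f -> continuous (fun t => Re (f t)).
Proof. by move=> h; apply: continuous_seq => u l /h/ccvgP[]. Qed.
Lemma scont_Im f : scont f -> continuous (fun t => Im (f t)).
Proof. by move=> h; apply: continuous_seq => u l /h/ccvgP[]. Qed.

Definition cmeas f := measurable_fun [set: R] (fun t => Re (f t)) /\
  measurable_fun [set: R] (fun t => Im (f t)).
Lemma scont_cmeas f : scont f -> cmeas f.
Proof.
move=> h; split; apply: continuous_measurable_fun.
  exact: scont_Re.
exact: scont_Im.
Qed.

Definition pk_bounded f (M : R) := forall t, cabs (f t) <= M * pk t.

Lemma pk_bounded_Re f M : pk_bounded f M -> forall t, `|Re (f t)| <= M * pk t.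
Proof. by move=> h t; rewrite (le_trans (ler_Re_cabs _)). Qed.
Lemma pk_bounded_Im f M : pk_bounded f M -> forall t, `|Im (f t)| <= M * pk t.
Proof. by move=> h t; rewrite (le_trans (ler_Im_cabs _)). Qed.

(** Measurability instead of continuity admits functions cut off by an indicator. *)
Definition nice f := cmeas f /\ exists M, pk_bounded f M.

Lemma niceI f M : scont f -> pk_bounded f M -> nice f.
Proof. by move=> h1 h2; split; [exact: scont_cmeas|exists M]. Qed.

Lemma nice_Re f : nice f -> mu.-integrable [set: R] (fun t => (Re (f t))%:E).
Proof. by move=> [[m1 m2] [M /pk_bounded_Re]]; exact: integrable_le_pk. Qed.
Lemma nice_Im f : nice f -> mu.-integrable [set: R] (fun t => (Im (f t))%:E).
Proof. by move=> [[m1 m2] [M /pk_bounded_Im]]; exact: integrable_le_pk. Qed.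

Lemma niceD f g : nice f -> nice g -> nice (fun t => f t + g t).
Proof.
move=> [[m1 m2] [M h]] [[m1' m2'] [N k]]; split; first split.
- by under eq_fun do rewrite cReD; exact: measurable_funD.
- by under eq_fun do rewrite cImD; exact: measurable_funD.
- by exists (M + N) => t; rewrite (le_trans (ler_cabsD _ _))// mulrDl lerD.
Qed.
Lemma niceZ (a : C) f : nice f -> nice (fun t => a * f t).
Proof.
move=> [[m1 m2] [M h]]; split; first split.
- by under eq_fun do rewrite cReM; apply: measurable_funB; exact: measurable_funM.
- by under eq_fun do rewrite cImM; apply: measurable_funD; exact: measurable_funM.
- by exists (cabs a * M) => t; rewrite cabsM -mulrA ler_wpM2l ?cabs_ge0.
Qed.

Lemma cintD f g : nice f -> nice g -> cint (fun t => f t + g t) = cint f + cint g.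
Proof.
move=> hf hg; apply: complexP; rewrite ?cReD ?cImD /=.
  by under eq_Rintegral do rewrite cReD; rewrite RintegralD//; exact: nice_Re.
by under eq_Rintegral do rewrite cImD; rewrite RintegralD//; exact: nice_Im.
Qed.
Lemma cintZ (a : C) f : nice f -> cint (fun t => a * f t) = a * cint f.
Proof.
move=> hf; have h1 := nice_Re hf; have h2 := nice_Im hf.
have h (c : R) (k : R -> R) : mu.-integrable [set: R] (fun t => (k t)%:E) ->
    mu.-integrable [set: R] (fun t => (c * k t)%:E).
  by move=> hk; under eq_fun do rewrite EFinM; exact: integrableZl.
apply: complexP; rewrite ?cReM ?cImM /=.
  under eq_Rintegral do rewrite cReM.
  by rewrite RintegralB//; [rewrite !RintegralZl|exact: h|exact: h].
under eq_Rintegral do rewrite cImM.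
by rewrite RintegralD//; [rewrite !RintegralZl|exact: h|exact: h].
Qed.
Lemma cintN f : nice f -> cint (fun t => - f t) = - cint f.
Proof. by move=> h; under eq_fun do rewrite -mulN1r; rewrite cintZ// mulN1r. Qed.
Lemma cintB f g : nice f -> nice g -> cint (fun t => f t - g t) = cint f - cint g.
Proof.
move=> hf hg; rewrite -cintN// -cintD//.
by have := niceZ (-1) hg; under eq_fun do rewrite mulN1r.
Qed.

Lemma eq_cint f g : f =1 g -> cint f = cint g.
Proof. by move=> /funext ->. Qed.

Lemma cint_affine (a b : R) f : a != 0 -> nice f ->
  (`|a|%:C * cint (fun t => f (a * t + b)) = cint f)%R.
Proof.
move=> a0 hf; apply: complexP; rewrite ?cReZ ?cImZ /=.
  by rewrite (@Rintegral_affine _ a b (fun t => Re (f t)))//; exact: nice_Re.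
by rewrite (@Rintegral_affine _ a b (fun t => Im (f t)))//; exact: nice_Im.
Qed.
Lemma cint_shift (b : R) f : nice f -> cint (fun t => f (t + b)) = cint f.
Proof.
move=> hf; rewrite -(@cint_affine 1 b f)// ?oner_neq0// normr1 mul1r.
by apply: eq_cint => t; rewrite mul1r.
Qed.
Lemma cint_refl (b : R) f : nice f -> cint (fun t => f (b - t)) = cint f.
Proof.
move=> hf; rewrite -(@cint_affine (-1) b f)// ?oppr_eq0 ?oner_neq0// normrN1 mul1r.
by apply: eq_cint => t; rewrite mulN1r addrC.
Qed.

(** The mass of [pk] is pi; the factor 2 is the price of treating real and imaginary parts
    separately. *)
Lemma cabs_cint f M : cmeas f -> pk_bounded f M -> cabs (cint f) <= 2 * pi * M.
Proof.
move=> [m1 m2] h; rewrite (le_trans (ler_cabs_ReIm _))//= -mulrA mulr_natl mulr2n mulrC.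
by rewrite lerD// ler_Rintegral_pk//; [exact: pk_bounded_Re|exact: pk_bounded_Im].
Qed.

(** Dominated convergence with the null set {0} exempted: below, two half-line truncations overlap
    at 0, and contours are lowered onto a singularity at 0. *)
Lemma cint_cvg (F : nat -> R -> C) f M : (forall n, cmeas (F n)) -> cmeas f ->
  (forall n, pk_bounded (F n) M) -> (forall t, t != 0 -> ccvg (F^~ t) (f t)) ->
  ccvg (fun n => cint (F n)) (cint f).
Proof.
move=> mF mf hF cF.
have gen (G : nat -> R -> R) (g : R -> R) : (forall n, measurable_fun [set: R] (G n)) ->
    measurable_fun [set: R] g -> (forall n t, `|G n t| <= M * pk t) ->
    (forall t, t != 0 -> G^~ t @ \oo --> g t) ->
    (fun n => \int[mu]_(t in [set: R]) G n t) @ \oo --> \int[mu]_(t in [set: R]) g t.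
  move=> mG mg hG cG.
  have [||||ig _] := @dominated_convergence _ _ R mu [set: R] measurableT
    (fun n t => (G n t)%:E) (fun t => (g t)%:E) (fun t => (M * pk t)%:E) _ _ _ (integrable_pk M) _.
  - by move=> n; apply/measurable_EFinP; exact: mG.
  - by apply/measurable_EFinP; exact: mg.
  - exists [set 0]; split => //; first exact: lebesgue_measure_set1.
    move=> t /=; apply: contra_notP => /eqP t0 _; apply/fine_cvgP; split; first exact: nearW.
    exact: cG.
  - by apply: aeW => t n _; rewrite /= lee_fin.
  move=> H; apply/fine_cvg; rewrite /= fineK//; exact: integrable_fin_num.
apply/ccvgP; split => /=; apply: gen => //.
- by move=> n; have [] := mF n.
- by have [] := mf.
- by move=> n; exact: pk_bounded_Re.
- by move=> t /cF/ccvgP[].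
- by move=> n; have [] := mF n.
- by have [] := mf.
- by move=> n; exact: pk_bounded_Im.
- by move=> t /cF/ccvgP[].
Qed.
End ComplexIntegral.

(** * Joint measurability and interchange of integrals *)

Section Fubini.
Variable R : realType.
Local Notation C := R[i].
Let mu := @lebesgue_measure R.

Definition jcont (G : R -> R -> C) := forall u v (s t : R),
  u @ \oo --> s -> v @ \oo --> t -> ccvg (fun n => G (u n) (v n)) (G s t).

Lemma jcontC G : jcont G -> jcont (fun s t => G t s).
Proof. by move=> h u v s t us vt; exact: h. Qed.
Lemma jcont_scont G s : jcont G -> scont (G s).
Proof. by move=> h v t vt; apply: h => //; exact: cvg_cst. Qed.

Lemma floor_grid_cvg (s : R) :
  (fun n => (Num.floor (n.+1%:R * s))%:~R / n.+1%:R) @ \oo --> s.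
Proof.
apply/cvgrPdist_le => e e0; near=> n.
have n0 : 0 < n.+1%:R :> R by [].
have /andP[h1 h2] := floor_itv (n.+1%:R * s).
set k : R := (Num.floor (n.+1%:R * s))%:~R in h1 *; rewrite intrD1 -/k in h2.
have -> : s - k / n.+1%:R = (n.+1%:R * s - k) / n.+1%:R by rewrite mulrBl mulrAC divff ?mul1r ?gt_eqF.
rewrite ger0_norm ?divr_ge0 ?subr_ge0//.
apply: (@le_trans _ _ (n.+1%:R^-1)).
  by rewrite -[leRHS]mul1r ler_wpM2r ?invr_ge0// lerBlDl addrC addrC ltW.
by apply/ltW; near: n; exact: (near_infty_natSinv_lt (PosNum e0)).
Unshelve. all: by end_near. Qed.

(** Rounding the first variable down to the grid of mesh 1/(n+1) makes preimages countable unions of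
    measurable rectangles; [g] is the pointwise limit of these roundings. *)
Lemma measurable_seq_continuous2 (g : R -> R -> R) :
  (forall u v (s t : R), u @ \oo --> s -> v @ \oo --> t -> (fun n => g (u n) (v n)) @ \oo --> g s t) ->
  measurable_fun [set: R * R] (fun z => g z.1 z.2).
Proof.
move=> hg.
apply: (@measurable_fun_cvg _ _ R setT (fun n (z : R * R) => g ((Num.floor (n.+1%:R * z.1))%:~R / n.+1%:R) z.2)).
  move=> n _ Y mY; rewrite setTI.
  rewrite (_ : _ @^-1` Y = \bigcup_(k in [set: int])
    ([set s | Num.floor (n.+1%:R * s) = k] `*` (g (k%:~R / n.+1%:R) @^-1` Y))); last first.
    apply/seteqP; split => [[s t] /= h|[s t] /= [k _ [/= <-]]]//.
    by exists (Num.floor (n.+1%:R * s)).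
  apply: countable_bigcupT_measurable => // k; apply: measurableX.
    rewrite (_ : [set _ | _] = `[k%:~R / n.+1%:R, (k + 1)%:~R / n.+1%:R[%classic); last first.
      apply/seteqP; split => s /=; rewrite in_itv/= ler_pdivrMr// ltr_pdivlMr// [s * _]mulrC.
        by move=> <-; exact: floor_itv.
      by move=> h; apply: floor_def.
    exact: measurable_itv.
  rewrite -[X in measurable X]setTI; apply: continuous_measurable_fun => //.
  by apply: continuous_seq => v t vt; apply: hg => //; exact: cvg_cst.
move=> [s t] _ /=; apply: hg; [exact: floor_grid_cvg|exact: cvg_cst].
Qed.

Definition jmeas (G : R -> R -> C) :=
  measurable_fun [set: R * R] (fun z => Re (G z.1 z.2)) /\
  measurable_fun [set: R * R] (fun z => Im (G z.1 z.2)).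

Lemma jcont_jmeas G : jcont G -> jmeas G.
Proof.
move=> h; split.
  by apply: (@measurable_seq_continuous2 (fun s t => Re (G s t))) => u v s t us vt; have /ccvgP[] := h _ _ _ _ us vt.
by apply: (@measurable_seq_continuous2 (fun s t => Im (G s t))) => u v s t us vt; have /ccvgP[] := h _ _ _ _ us vt.
Qed.

Lemma Rintegral_swap (g : R -> R -> R) M :
  measurable_fun [set: R * R] (fun z => g z.1 z.2) ->
  (forall s t, `|g s t| <= M * pk s * pk t) ->
  \int[mu]_(s in [set: R]) \int[mu]_(t in [set: R]) g s t =
  \int[mu]_(t in [set: R]) \int[mu]_(s in [set: R]) g s t.
Proof.
move=> mg hg.
have mg1 s : measurable_fun [set: R] (g s) by exact: (measurableT_comp mg (pair1_measurable s)).
have mg2 t : measurable_fun [set: R] (fun s => g s t) by exact: (measurableT_comp mg (pair2_measurable t)).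
have i1 s : mu.-integrable [set: R] (EFin \o g s) by exact: integrable_le_pk (hg s).
have i2 t : mu.-integrable [set: R] (EFin \o g^~ t).
  by apply: (@integrable_le_pk _ _ (M * pk t)) => // s; rewrite mulrAC.
rewrite /Rintegral; congr fine.
transitivity (\int[mu]_s \int[mu]_t (g s t)%:E)%E.
  by apply: eq_integral => s _; rewrite fineK//; exact: integrable_fin_num (i1 s).
transitivity (\int[mu]_t \int[mu]_s (g s t)%:E)%E; last first.
  by apply: eq_integral => t _; rewrite fineK//; exact: integrable_fin_num (i2 t).
apply: (@Fubini _ _ _ _ _ mu mu (fun z => (g z.1 z.2)%:E)).
apply/integrable12ltyP; first exact/measurable_EFinP.
apply: (@le_lt_trans _ _ (\int[mu]_s (M * pi * pk s)%:E)%E); last first.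
  by have := integrable_lty _ (integrable_pk (M * pi)); apply.
apply: ge0_le_integral => //.
- by move=> s _; exact: integral_ge0.
- have mh : measurable_fun [set: R * R] (fun z => `|(g z.1 z.2)%:E|%E).
    by apply: measurableT_comp => //; exact/measurable_EFinP.
  exact: (@measurable_fun_fubini_tonelli_F _ _ _ _ _ mu (fun z => `|(g z.1 z.2)%:E|%E)).
- by apply/measurable_EFinP; apply: measurable_funM => //; apply: continuous_measurable_fun; exact: continuous_pk.
- move=> s _.
  have ia := integrable_norm (i1 s).
  rewrite (_ : \int[mu]_y _ = (\int[mu]_(t in [set: R]) `|g s t|)%:E)%E; last first.
    by rewrite fineK// ; exact: integrable_fin_num ia.
  rewrite lee_fin (mulrAC M) -Rintegral_pk.
  by apply: le_Rintegral => //; exact: integrable_pk.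
Qed.

Lemma cint_swap_meas (G : R -> R -> C) M : jmeas G ->
  (forall s t, cabs (G s t) <= M * pk s * pk t) ->
  cint (fun s => cint (G s)) = cint (fun t => cint (fun s => G s t)).
Proof.
move=> [h1 h2] hG; apply: complexP => /=.
  apply: (@Rintegral_swap (fun s t => Re (G s t)) M) => // s t.
  by rewrite (le_trans (ler_Re_cabs _)).
apply: (@Rintegral_swap (fun s t => Im (G s t)) M) => // s t.
by rewrite (le_trans (ler_Im_cabs _)).
Qed.

Lemma cint_swap (G : R -> R -> C) M : jcont G ->
  (forall s t, cabs (G s t) <= M * pk s * pk t) ->
  cint (fun s => cint (G s)) = cint (fun t => cint (fun s => G s t)).
Proof. by move=> /jcont_jmeas; exact: cint_swap_meas. Qed.
End Fubini.

(** * Holomorphic functions and contour shifts *)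

Section ComplexDerivative.
Variable R : realType.
Local Notation C := R[i].
Implicit Types (f g : C -> C) (S T : C -> Prop).

Lemma is_derive_epsP (f : R -> R) (x df : R) : is_derive x 1 f df <->
  (forall e, 0 < e -> exists2 d : R, 0 < d &
     forall h, `|h| < d -> `|f (x + h) - f x - h * df| <= e * `|h|).
Proof.
split=> [[dfx <-] e e0|H].
  have := dfx; rewrite /derivable => /cvgrPdist_le /(_ _ e0).
  rewrite /= => /nbhs_ballP[d /= d0 hd]; exists d => // h hh.
  have [->|h0] := eqVneq h 0.
    by rewrite addr0 subrr mul0r subr0 normr0 mulr0.
  have := hd h; rewrite /ball /= sub0r normrN => /(_ hh h0).
  rewrite /GRing.scale /= mulr1 => hle.
  rewrite -ler_pdivrMr ?normr_gt0// -normfV -normrM mulrBl.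
  by rewrite distrC mulrAC divff// mul1r [_ / h]mulrC [x + h]addrC.
have cv : (fun h => h^-1 *: (f (h *: (1 : R) + x) - f x)) @ 0^' --> df.
  apply/cvgrPdist_le => e /H[d d0 hd]; apply/nbhs_ballP; exists d => // h.
  rewrite /ball /= sub0r normrN => /hd hle h0.
  rewrite /GRing.scale /= mulr1 distrC [h + x]addrC.
  rewrite -(ler_pM2r (_ : 0 < `|h|)) ?normr_gt0// -normrM mulrBl mulrC mulrA divff// mul1r.
  by rewrite [df * h]mulrC.
by apply: DeriveDef; [apply/cvg_ex; exists df|exact/cvg_lim].
Qed.

Definition cderiv f z (df : C) := forall e : R, 0 < e -> exists2 d : R, 0 < d &
  forall k, cabs k < d -> cabs (f (z + k) - f z - k * df) <= e * cabs k.

Definition cont_in S f := forall u z, (forall n : nat, S (u n)) -> S z ->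
  ccvg u z -> ccvg (f \o u) (f z).

(** The derivative is taken in full neighbourhoods, also at boundary points of [S]; only its
    continuity is relative to [S]. That continuity is what the proof of Cauchy's theorem by double
    integration consumes. *)
Definition C1on S f := exists df,
  (forall z, S z -> cderiv f z (df z)) /\ cont_in S df.

Lemma cderiv_bound f z df : cderiv f z df -> exists2 d : R, 0 < d &
  forall k, cabs k < d -> cabs (f (z + k) - f z) <= (cabs df + 1) * cabs k.
Proof.
move=> /(_ 1 ltr01)[d d0 h]; exists d => // k /h hk.
rewrite -[X in cabs X](subrK (k * df)) (le_trans (ler_cabsD _ _))//.
by rewrite mulrDl addrC lerD// cabsM mulrC.
Qed.

Lemma cderiv_cvg f z df u : cderiv f z df -> ccvg u z -> ccvg (f \o u) (f z).
Proof.
move=> /cderiv_bound[d d0 h] uz.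
have cs : (fun n => (cabs df + 1) * cabs (u n - z)) @ \oo --> (0 : R).
  by rewrite -[0](mulr0 (cabs df + 1)); apply: cvgM => //; exact: cvg_cst.
apply: (squeeze_cvgr _ (@cvg_cst _ _ _ _ _) cs).
have /cvgrPdist_lt/(_ d d0) := uz; apply: filterS => n.
rewrite sub0r normrN ger0_norm ?cabs_ge0// => /h.
by rewrite [z + _]addrC subrK /= => ->.
Qed.

Lemma C1on_cont S f : C1on S f -> cont_in S f.
Proof. by move=> [df [h _]] u z _ /h hz; exact: cderiv_cvg hz. Qed.

Lemma cont_inS S T f : (forall z, S z -> T z) -> cont_in T f -> cont_in S f.
Proof. by move=> ST h u z Su Sz; apply: h; [move=> n; exact: ST|exact: ST]. Qed.
Lemma C1onS S T f : (forall z, S z -> T z) -> C1on T f -> C1on S f.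
Proof.
by move=> ST [df [h k]]; exists df; split; [move=> z /ST; exact: h|exact: cont_inS k].
Qed.

Lemma cderiv_affine (a b z : C) : cderiv (fun z => a * z + b) z a.
Proof.
move=> e e0; exists 1 => // k _.
rewrite (_ : _ - _ = 0) ?cabs0 ?mulr_ge0 ?cabs_ge0 ?ltW//; ring.
Qed.
Lemma cderiv_cst (b z : C) : cderiv (fun=> b) z 0.
Proof.
move=> e e0; exists 1 => // k _.
rewrite (_ : _ - _ = 0) ?cabs0 ?mulr_ge0 ?cabs_ge0 ?ltW//; ring.
Qed.
Lemma cderivD f g z df dg : cderiv f z df -> cderiv g z dg ->
  cderiv (fun z => f z + g z) z (df + dg).
Proof.
move=> hf hg e e0; have e2 : 0 < e / 2 by rewrite divr_gt0.
have [d1 d10 h1] := hf _ e2; have [d2 d20 h2] := hg _ e2.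
exists (Num.min d1 d2) => [|k]; first by rewrite lt_min d10.
rewrite lt_min => /andP[/h1 k1 /h2 k2].
rewrite (_ : _ - _ = (f (z + k) - f z - k * df) + (g (z + k) - g z - k * dg)); last by ring.
by rewrite (le_trans (ler_cabsD _ _))// [e]splitr mulrDl lerD.
Qed.

Lemma cderiv_comp f g z df dg : cderiv f z df -> cderiv g (f z) dg ->
  cderiv (fun z => g (f z)) z (df * dg).
Proof.
move=> hf hg e e0.
have [d1 d10 h1] := cderiv_bound hf.
have c0 : 0 < cabs df + 1 by rewrite ltr_wpDl ?cabs_ge0.
have c1 : 0 < cabs dg + 1 by rewrite ltr_wpDl ?cabs_ge0.
have e1 : 0 < e / 2 / (cabs df + 1) by rewrite !divr_gt0.
have e2 : 0 < e / 2 / (cabs dg + 1) by rewrite !divr_gt0.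
have [d2 d20 h2] := hg _ e1; have [d3 d30 h3] := hf _ e2.
exists (Num.min (Num.min d1 d3) (d2 / (cabs df + 1))) => [|k].
  by rewrite !lt_min d10 d30 divr_gt0.
rewrite !lt_min => /andP[/andP[/h1 k1 /h3 k3] k2].
set w := f (z + k) - f z in k1 *.
have wd : cabs w < d2 by rewrite (le_lt_trans k1)// mulrC -ltr_pdivlMr.
have := h2 _ wd; rewrite [f z + w]addrC subrK => k4.
rewrite (_ : _ - _ = (g (f (z + k)) - g (f z) - w * dg) + (w - k * df) * dg); last by ring.
rewrite (le_trans (ler_cabsD _ _))// [e]splitr [leRHS]mulrDl lerD//.
  rewrite (le_trans k4)// (le_trans (ler_wpM2l (ltW e1) k1))//.
  by rewrite mulrA divfK// gt_eqF.
rewrite cabsM (le_trans (ler_wpM2r (cabs_ge0 _) k3))// mulrAC ler_wpM2r ?cabs_ge0//.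
by rewrite mulrAC ler_pdivrMr// ler_wpM2l ?lerDl// divr_ge0 // ltW.
Qed.

(* Polarization reduces products to squares. *)
Lemma cderiv_sqr z : cderiv (fun z => z * z) z (2 * z).
Proof.
move=> e e0; exists e => // k ke.
rewrite (_ : _ - _ = k * k); last by ring.
by rewrite cabsM ler_wpM2r ?cabs_ge0// ltW.
Qed.

Lemma cderivZ (a : C) f z df : cderiv f z df -> cderiv (fun z => a * f z) z (a * df).
Proof.
move=> h; have := cderiv_comp h (cderiv_affine a 0 (f z)).
by rewrite mulrC (_ : (fun _ => _) = (fun z => a * f z))//; apply/funext => w; rewrite addr0.
Qed.

Lemma cderivM f g z df dg : cderiv f z df -> cderiv g z dg ->
  cderiv (fun z => f z * g z) z (df * g z + f z * dg).
Proof.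
move=> hf hg; have hm := cderivD hf (cderivZ (-1) hg); have hp := cderivD hf hg.
have := cderivD (cderivZ 4^-1 (cderiv_comp hp (cderiv_sqr _)))
  (cderivZ (- 4^-1) (cderiv_comp hm (cderiv_sqr _))).
rewrite (_ : (fun _ => _) = (fun z => f z * g z)); last by apply/funext => w; field.
by rewrite (_ : _ + _ = df * g z + f z * dg)//; field.
Qed.

Lemma cderivV (z : C) : z != 0 -> cderiv (fun z => z^-1) z (- (z ^+ 2)^-1).
Proof.
move=> z0 e e0; have c0 := cabs_gt0 z0.
exists (Num.min (cabs z / 2) (e * (cabs z ^+ 3 / 2))) => [|k].
  by rewrite lt_min divr_gt0//= mulr_gt0// divr_gt0// exprn_gt0.
rewrite lt_min => /andP[k1 k2].
have h : cabs z / 2 <= cabs (z + k).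
  have := ler_cabsB (z + k) k; rewrite addrK => h.
  have : cabs z - cabs k <= cabs (z + k) by rewrite lerBlDr.
  by apply: le_trans; rewrite lerBrDr -lerBrDl (le_trans (ltW k1))// lerBrDl -splitr.
have zk : z + k != 0.
  by apply/eqP => zk; move: h; rewrite zk cabs0 leNgt divr_gt0.
rewrite (_ : _ - _ = k * k / (z ^+ 2 * (z + k))); last by field; rewrite z0 zk.
rewrite cabsM cabsV cabsM cabsM cabsX mulrC mulrA; apply: ler_wpM2r; first exact: cabs_ge0.
rewrite mulrC ler_pdivrMr ?mulr_gt0 ?exprn_gt0 ?(lt_le_trans _ h) ?divr_gt0//.
rewrite (le_trans (ltW k2))// ler_wpM2l ?(ltW e0)// exprSr -mulrA.
by rewrite ler_wpM2l// exprn_ge0 ?cabs_ge0.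
Qed.

(** The addition formula reduces the claim to z = 0, where the real derivatives of exp, cos and sin
    at 0 suffice. *)
Lemma cderiv_cexp (z : C) : cderiv (@cexp R) z (cexp z).
Proof.
have H : cderiv (@cexp R) 0 1.
  (* The four error terms [n1] to [n4] weigh 1, 2, 2 and 1, hence the 6; the cap at 1 yields
     [expR a <= 2]. *)
  move=> e e0; pose e1 := Num.min (e / 6) 1.
  have e10 : 0 < e1 by rewrite lt_min divr_gt0 //=.
  have [d1 d10 h1] := (is_derive_epsP _ _ _).1 (is_derive_expR 0) _ e10.
  have [d2 d20 h2] := (is_derive_epsP _ _ _).1 (is_derive_cos 0) _ e10.
  have [d3 d30 h3] := (is_derive_epsP _ _ _).1 (is_derive_sin 0) _ e10.
  exists (Num.min (Num.min d1 (Num.min d2 d3)) (e1 / 2)) => [|[a b]].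
    by rewrite !lt_min d10 d20 d30 divr_gt0.
  set k := a +i* b; rewrite !lt_min => /andP[/andP[k1 /andP[k2 k3]] k4].
  have ka : `|a| <= cabs k := ler_Re_cabs k.
  have kb : `|b| <= cabs k := ler_Im_cabs k.
  have {}h1 := h1 a (le_lt_trans ka k1).
  have {}h2 := h2 b (le_lt_trans kb k2).
  have {}h3 := h3 b (le_lt_trans kb k3).
  rewrite !add0r expR0 mulr1 in h1.
  rewrite !add0r cos0 sin0 oppr0 mulr0 subr0 in h2.
  rewrite !add0r sin0 cos0 subr0 mulr1 in h3.
  have e11 : e1 <= 1 by rewrite ge_min lexx orbT.
  have e14 : e1 <= e / 6 by rewrite ge_min lexx.
  have ea : `|expR a - 1| <= 2 * cabs k.
    rewrite -(subrK a (expR a - 1)) (le_trans (ler_normD _ _))// mulr_natl mulr2n lerD//.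
    by rewrite (le_trans h1)// (le_trans _ ka)// ler_piMl.
  have ea1 : expR a <= 2.
    have := ler_norm (expR a - 1); move/le_trans => /(_ _ ea).
    rewrite lerBlDr => /le_trans; apply; rewrite -lerBrDr.
    have -> : 2 - 1 = 2 * 2^-1 :> R by field.
    by rewrite ler_wpM2l// (le_trans (ltW k4))// ler_pdivrMr// mulVf.
  rewrite (le_trans (ler_cabs_ReIm _))//.
  rewrite add0r cexp0 mulr1 !(cReD, cImD, cReN, cImN) Re_cexp Im_cexp /= oppr0 addr0.
  have -> : expR a * cos b - 1 - a = (expR a - 1 - a) + expR a * (cos b - 1) by ring.
  have -> : expR a * sin b - b = expR a * (sin b - b) + (expR a - 1) * b by ring.
  have k0 := cabs_ge0 k.
  have n1 : `|expR a - 1 - a| <= e1 * cabs k.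
    by rewrite (le_trans h1)// ler_wpM2l// ltW.
  have n2 : `|expR a * (cos b - 1)| <= 2 * (e1 * cabs k).
    rewrite normrM ler_pM// ?(ger0_norm (expR_ge0 a))//.
    by rewrite (le_trans h2)// ler_wpM2l// ltW.
  have n3 : `|expR a * (sin b - b)| <= 2 * (e1 * cabs k).
    rewrite normrM ler_pM// ?(ger0_norm (expR_ge0 a))//.
    by rewrite (le_trans h3)// ler_wpM2l// ltW.
  have n4 : `|(expR a - 1) * b| <= e1 * cabs k.
    rewrite normrM (le_trans (ler_pM _ _ ea kb))// mulrAC ler_wpM2r// mulrC.
    by rewrite -ler_pdivlMr// ltW.
  rewrite -[leRHS]/(e * cabs k).
  have := ler_normD (expR a - 1 - a) (expR a * (cos b - 1)).
  have := ler_normD (expR a * (sin b - b)) ((expR a - 1) * b).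
  have : 6 * (e1 * cabs k) <= e * cabs k by rewrite mulrA ler_wpM2r// mulrC -ler_pdivlMr.
  lra.
move=> e e0; have c0 := cabs_gt0 (cexp_neq0 z).
have [d d0 h] := H (e / cabs (cexp z)) (divr_gt0 e0 c0); exists d => // k /h.
rewrite add0r cexp0 mulr1 mulrAC ler_pdivlMr// -cabsM cexpD.
by rewrite (_ : _ * cexp z = cexp z * cexp k - cexp z - k * cexp z)//; ring.
Qed.

Lemma cderiv_re_line f z v df (t0 : R) : cderiv f (z + t0%:C * v) df ->
  is_derive t0 1 (fun t : R => Re (f (z + t%:C * v))) (Re (v * df)).
Proof.
move=> H; apply/is_derive_epsP => e e0.
have c0 : 0 < cabs v + 1 by rewrite ltr_wpDl ?cabs_ge0.
have [d d0 h] := H _ (divr_gt0 e0 c0); exists (d / (cabs v + 1)) => [|k kd]; first exact: divr_gt0.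
have kv : cabs (k%:C * v) < d.
  rewrite cabsM cabs_real; rewrite ltr_pdivlMr// in kd.
  by rewrite (le_lt_trans _ kd)// ler_wpM2l// lerDl.
have E : z + t0%:C * v + k%:C * v = z + (t0 + k)%:C * v by rewrite rmorphD mulrDl addrA.
have := h _ kv; rewrite E => h1.
rewrite -cReZ -cReN -cReD -cReN -cReD mulrA (le_trans (ler_Re_cabs _))// (le_trans h1)//.
rewrite cabsM cabs_real mulrAC ler_pdivrMr// -[leRHS]mulrA ler_wpM2l ?(ltW e0)//.
by rewrite ler_wpM2l// lerDl.
Qed.

Lemma cderiv_im_line f z v df (t0 : R) : cderiv f (z + t0%:C * v) df ->
  is_derive t0 1 (fun t : R => Im (f (z + t%:C * v))) (Im (v * df)).
Proof.
move=> H; have := @cderiv_re_line (fun z => - 'i * f z) z v (- 'i * df) t0 (cderivZ _ H).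
rewrite (_ : (fun _ => _) = (fun t : R => Im (f (z + t%:C * v)))); last first.
  by apply/funext => t; rewrite cReM /=; ring.
by rewrite mulrCA [X in is_derive _ _ _ X]cReM /= (_ : _ - _ = Im (v * df)); [|ring].
Qed.

(** The mean value theorem fails for complex values, so it is applied to the real and imaginary
    parts; this costs the factor 2. *)
Lemma cabs_mvt f df z v (M : R) :
  (forall t : R, 0 <= t <= 1 -> cderiv f (z + t%:C * v) (df t)) ->
  (forall t : R, 0 <= t <= 1 -> cabs (df t) <= M) ->
  cabs (f (z + v) - f z) <= 2 * cabs v * M.
Proof.
move=> hd hM.
have gen (g dg : R -> R) : (forall t : R, 0 <= t <= 1 -> is_derive t 1 g (dg t)) ->
   (forall t, 0 <= t <= 1 -> `|dg t| <= cabs v * M) -> `|g 1 - g 0| <= cabs v * M.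
  move=> h1 h2.
  have [||c] := @MVT _ g dg 0 1 ltr01.
  - by move=> t; rewrite in_itv /= => /andP[t0 t1]; apply: h1; rewrite !ltW.
  - apply: derivable_within_continuous => t; rewrite in_itv /= => /h1 h.
    exact: ex_derive.
  rewrite in_itv /= => /andP[c0 c1]; rewrite subr0 mulr1 => ->.
  by apply: h2; rewrite !ltW.
rewrite (le_trans (ler_cabs_ReIm _))// -mulrA mulr_natl mulr2n lerD//.
  have := gen _ _ (fun t h => cderiv_re_line (hd t h)).
  rewrite mul1r mul0r addr0 cReD cReN; apply => t ht.
  by rewrite (le_trans (ler_Re_cabs _))// cabsM ler_wpM2l ?cabs_ge0// hM.
have := gen _ _ (fun t h => cderiv_im_line (hd t h)).
rewrite mul1r mul0r addr0 cImD cImN; apply => t ht.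
by rewrite (le_trans (ler_Im_cabs _))// cabsM ler_wpM2l ?cabs_ge0// hM.
Qed.

Lemma C1on_comp S T f g : C1on S f -> C1on T g -> (forall z, S z -> T (f z)) ->
  C1on S (fun z => g (f z)).
Proof.
move=> hf [dg [h2 c2]] ST; have cf := C1on_cont hf; case: hf => df [h1 c1].
exists (fun z => df z * dg (f z)); split=> [z Sz|u z Su Sz uz].
  by apply: cderiv_comp; [exact: h1|apply: h2; exact: ST].
apply: ccvgM; first exact: c1.
by apply: (c2 (f \o u)); [move=> n; exact: ST|exact: ST|exact: cf].
Qed.
Lemma C1on_affine S (a b : C) : C1on S (fun z => a * z + b).
Proof.
by exists (fun=> a); split=> [z _|u z _ _ _]; [exact: cderiv_affine|exact: ccvg_cst].
Qed.
Lemma C1on_cst S (b : C) : C1on S (fun=> b).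
Proof.
by exists (fun=> 0); split=> [z _|u z _ _ _]; [exact: cderiv_cst|exact: ccvg_cst].
Qed.
Lemma C1onD S f g : C1on S f -> C1on S g -> C1on S (fun z => f z + g z).
Proof.
move=> [df [h1 c1]] [dg [h2 c2]]; exists (fun z => df z + dg z).
split=> [z Sz|u z Su Sz uz]; first by apply: cderivD; [exact: h1|exact: h2].
by apply: ccvgD; [exact: c1|exact: c2].
Qed.
Lemma C1onM S f g : C1on S f -> C1on S g -> C1on S (fun z => f z * g z).
Proof.
move=> hf hg; have cf := C1on_cont hf; have cg := C1on_cont hg.
move: hf hg => [df [h1 c1]] [dg [h2 c2]]; exists (fun z => df z * g z + f z * dg z).
split=> [z Sz|u z Su Sz uz]; first by apply: cderivM; [exact: h1|exact: h2].
by apply: ccvgD; apply: ccvgM; [exact: c1|exact: cg|exact: cf|exact: c2].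
Qed.
Lemma C1onN S f : C1on S f -> C1on S (fun z => - f z).
Proof.
move=> h; rewrite (_ : (fun _ => _) = fun z => -1 * f z).
  by apply: C1onM => //; exact: C1on_cst.
by apply/funext => z; rewrite mulN1r.
Qed.
Lemma C1on_cexp S f : C1on S f -> C1on S (fun z => cexp (f z)).
Proof.
move=> hf; apply: (@C1on_comp S (fun=> True)) => //; exists (@cexp R).
by split=> [z _|u z _ _]; [exact: cderiv_cexp|exact: ccvg_cexp].
Qed.
Lemma C1onV S f : C1on S f -> (forall z, S z -> f z != 0) -> C1on S (fun z => (f z)^-1).
Proof.
move=> hf h; apply: (@C1on_comp S (fun z => z != 0)) => //.
exists (fun z => - (z ^+ 2)^-1); split=> [z|u z _ z0 uz]; first exact: cderivV.
apply: ccvgN; apply: ccvgV; first by rewrite expf_eq0 negb_and z0 orbT.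
by rewrite expr2; under eq_fun do rewrite /= expr2; exact: ccvgM.
Qed.
End ComplexDerivative.

(** * Cauchy's theorem on rectangles and in strips *)

Section Rectangle.
Variable R : realType.
Local Notation C := R[i].
Let mu := @lebesgue_measure R.

(** The retraction of the line onto [a, b], written with absolute values so that it is visibly
    continuous. It extends functions known on a rectangle continuously to the plane. *)
Definition clamp (a b x : R) : R := (`|x - a| - `|x - b| + a + b) / 2.

Lemma clamp_id (a b x : R) : a <= x <= b -> clamp a b x = x.
Proof.
by move=> /andP[ax xb]; rewrite /clamp ger0_norm ?subr_ge0// ler0_norm ?subr_le0//; field.
Qed.
Lemma clamp_itv (a b x : R) : a <= b -> a <= clamp a b x <= b.
Proof.
move=> ab; rewrite /clamp; case: (ler0P (x - a)); case: (ler0P (x - b)) => h1 h2.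
- by rewrite (_ : _ / 2 = a) ?lexx//; field.
- lra.
- by rewrite (_ : _ / 2 = x); [lra|field].
- by rewrite (_ : _ / 2 = b) ?ab ?lexx//; field.
Qed.
Lemma clamp_cvg (a b : R) u (l : R) : u @ \oo --> l ->
  (fun n => clamp a b (u n)) @ \oo --> clamp a b l.
Proof.
move=> ul; apply: cvgM; last exact: cvg_cst.
apply: cvgD; last exact: cvg_cst.
apply: cvgD; last exact: cvg_cst.
by apply: cvgB; apply: cvg_norm; apply: cvgB => //; exact: cvg_cst.
Qed.

Lemma seq_continuous2 (h : R -> R -> R) :
  (forall u v (s t : R), u @ \oo --> s -> v @ \oo --> t -> (fun n => h (u n) (v n)) @ \oo --> h s t) ->
  continuous (fun z : R * R => h z.1 z.2).
Proof.
move=> hc [x y]; apply/cvgrPdist_le => e e0; apply: contrapT => H.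
have E n : exists z : R * R, [/\ `|x - z.1| < n.+1%:R^-1, `|y - z.2| < n.+1%:R^-1 & ~ (`|h x y - h z.1 z.2| <= e)].
  apply: contrapT => /forallNP H2; apply: H.
  have n0 : 0 < n.+1%:R^-1 :> R by rewrite invr_gt0.
  exists (ball x n.+1%:R^-1, ball y n.+1%:R^-1).
    by split; apply: nbhsx_ballx.
  by move=> z [/= z1 z2]; apply: contrapT => zz; apply: (H2 z); split.
have [z hz] := choice E.
have c0 (w : nat -> R) (p : R) : (forall n, `|p - w n| < n.+1%:R^-1) -> w @ \oo --> p.
  move=> hw; apply/cvgrPdist_lt => d d0; near=> n; apply: (lt_trans (hw n)).
  by near: n; exact: (near_infty_natSinv_lt (PosNum d0)).
have h1 n : `|x - (z n).1| < n.+1%:R^-1 by have [] := hz n.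
have h2 n : `|y - (z n).2| < n.+1%:R^-1 by have [] := hz n.
have /cvgrPdist_le/(_ e e0) [N _ /(_ N (leqnn N)) hN] := hc _ _ _ _ (c0 (fst \o z) x h1) (c0 (snd \o z) y h2).
by have [_ _] := hz N; apply.
Unshelve. all: by end_near. Qed.

Lemma jcont_bounded (G : R -> R -> C) (a b c d : R) : jcont G -> a <= b -> c <= d ->
  exists B, forall x y, cabs (G (clamp a b x) (clamp c d y)) <= B.
Proof.
move=> jG ab cd.
have cont : continuous (fun z : R * R => cabs (G z.1 z.2)).
  by apply: (@seq_continuous2 (fun s t => cabs (G s t))) => u v s t us vt; apply: ccvg_cabs; exact: jG.
have [||| z _ hz] := @compact_EVT_max _ _ (fun z : R * R => cabs (G z.1 z.2)) (`[a, b] `*` `[c, d]).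
- by exists (a, c); split; rewrite /= in_itv /= lexx ?ab ?cd.
- by apply: compact_setX; exact: segment_compact.
- exact: continuous_subspaceT.
exists (cabs (G z.1 z.2)) => x y; apply: (hz (clamp a b x, clamp c d y)).
by rewrite inE; split; rewrite /= in_itv /= clamp_itv.
Qed.

(** The indicator replaces integration bounds, because [cint] always runs over the whole line; for
    the same reason [df] is a continuous function on all of it. *)
Lemma cint_line (f : C -> C) (df : R -> C) (z v : C) (a b : R) : a < b ->
  scont df -> (forall t, a <= t <= b -> cderiv f (z + t%:C * v) (df t)) ->
  cint (fun t => (\1_(`[a, b]) t)%:C * (v * df t)) = f (z + b%:C * v) - f (z + a%:C * v).
Proof.
move=> ab cdf hd.
have gen (g dg : R -> R) : (forall t : R, a <= t <= b -> is_derive t 1 g (dg t)) ->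
    continuous dg -> \int[mu]_(t in [set: R]) (\1_(`[a, b]) t * dg t) = g b - g a.
  move=> h cg.
  have cg' : {within `[a, b], continuous g}.
    by apply: derivable_within_continuous => t; rewrite in_itv /= => /h h1; exact: ex_derive.
  have := @continuous_FTC2 _ dg g a b ab _ _ _.
  move=> H; transitivity (fine ((g b)%:E - (g a)%:E)%E); last by [].
  rewrite -H; last 3 first.
  - exact: continuous_subspaceT.
  - split.
    + by move=> t; rewrite in_itv /= => /andP[t1 t2]; have h1 := h t; apply: (@ex_derive _ _ _ _ _ _ _ (h1 _)); rewrite !ltW.
    + by have /(continuous_within_itvP _ ab)[] := cg'.
    + by have /(continuous_within_itvP _ ab)[] := cg'.
  - move=> t; rewrite in_itv /= => /andP[t1 t2]; rewrite derive1E.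
    by apply: (@derive_val _ _ _ _ _ _ _ (h t _)); rewrite !ltW.
  rewrite [in RHS]integral_mkcond /Rintegral; congr fine; apply: eq_integral => t _.
  by rewrite patchE indicE; case: ifPn => _; rewrite ?mul1r ?mul0r.
have cRe (w : C) : continuous (fun t => Re (w * df t)).
  by apply: scont_Re => u l ul; apply: ccvgM; [exact: ccvg_cst|exact: cdf].
have cIm (w : C) : continuous (fun t => Im (w * df t)).
  by apply: scont_Im => u l ul; apply: ccvgM; [exact: ccvg_cst|exact: cdf].
apply: complexP; rewrite ?cReD ?cReN ?cImD ?cImN /=.
  under eq_Rintegral do rewrite cReZ.
  by apply: (gen (fun t => Re (f (z + t%:C * v)))) => // t /hd; exact: cderiv_re_line.
under eq_Rintegral do rewrite cImZ.
by apply: (gen (fun t => Im (f (z + t%:C * v)))) => // t /hd; exact: cderiv_im_line.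
Qed.

(** On [c, d] the square of x is at most the larger of c^2 and d^2, hence at most their sum. *)
Lemma indic_le_pk (c d x : R) : \1_(`[c, d]) x <= (1 + c ^+ 2 + d ^+ 2) * pk x.
Proof.
rewrite indicE; have [|_] := boolP (x \in `[c, d]%classic); last first.
  by rewrite mulr_ge0 ?pk_ge0// addr_ge0 ?sqr_ge0// addr_ge0 ?sqr_ge0.
rewrite inE /= in_itv /= => /andP[cx xd]; rewrite /pk /oneDsqr ler_pdivlMr ?mul1r; last first.
  by rewrite ltr_pwDl// sqr_ge0.
have hc := sqr_ge0 c; have hd' := sqr_ge0 d; have [x0|x0] := leP 0 x.
  have : x ^+ 2 <= d ^+ 2 by rewrite ler_sqr ?nnegrE// (le_trans x0).
  lra.
have : x ^+ 2 <= c ^+ 2 by rewrite -[x ^+ 2]sqrrN -[c ^+ 2]sqrrN ler_sqr ?nnegrE; lra.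
lra.
Qed.

Lemma indic_itv_ge0 (c d x : R) : 0 <= \1_(`[c, d]) x :> R.
Proof. by rewrite indicE. Qed.

Lemma cint0 : cint (fun=> 0 : C) = 0.
Proof. by apply: complexP => /=; rewrite /Rintegral /= integral0. Qed.

(** Both sides are the double integral of i f' over the rectangle: integrating vertically first
    gives the left side, horizontally first the right side. *)
Lemma rectangle_cauchy (f : C -> C) (p q a b : R) : p < q -> a < b ->
  C1on (fun z => p <= Re z <= q /\ a <= Im z <= b) f ->
  cint (fun x => (\1_(`[p, q]) x)%:C * (f (x +i* b) - f (x +i* a))) =
  cint (fun y => (\1_(`[a, b]) y)%:C * ('i * (f (q +i* y) - f (p +i* y)))).
Proof.
move=> pq ab [df [hd cd]].
have Sin (x y : R) : p <= Re (clamp p q x +i* clamp a b y) <= q /\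
    a <= Im (clamp p q x +i* clamp a b y) <= b.
  by rewrite /= !clamp_itv// ltW.
pose D x y : C := df (clamp p q x +i* clamp a b y).
have jD : jcont D.
  move=> u v s t us vt; apply: (cd (fun n => clamp p q (u n) +i* clamp a b (v n))).
  - by move=> n; exact: Sin.
  - exact: Sin.
  - by apply/ccvgP; split => /=; exact: clamp_cvg.
have [B hB] := jcont_bounded jD (ltW pq) (ltW ab).
have clampK (c d x : R) : c < d -> clamp c d (clamp c d x) = clamp c d x.
  by move=> cd'; rewrite clamp_id// clamp_itv// ltW.
have {}hB x y : cabs (D x y) <= B.
  by have := hB x y; rewrite /D !clampK.
pose G x y : C := (\1_(`[p, q]) x * \1_(`[a, b]) y)%:C * ('i * D x y).
have ge0 := indic_itv_ge0.
transitivity (cint (fun x => cint (G x))).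
  apply: eq_cint => x; have [xpq|xpq] := boolP (x \in `[p, q]%classic); last first.
    rewrite indicE (negbTE xpq) mul0r -[LHS]cint0; apply: eq_cint => y.
    by rewrite /G indicE (negbTE xpq) !mul0r.
  have xin := xpq; rewrite indicE xpq mul1r; rewrite inE /= in_itv /= in xpq.
  have := @cint_line f (D x) x%:C 'i a b ab.
  rewrite !complexRI ![_%:C * 'i]mulrC => <-.
  - by apply: eq_cint => y; rewrite /G [\1_`[p, q] x]indicE xin mul1r.
  - exact: jcont_scont.
  - move=> t tab; rewrite [_%:C * 'i]mulrC -complexRI /D !clamp_id//.
    by apply: hd => /=.
rewrite (@cint_swap_meas _ G (B * (1 + p ^+ 2 + q ^+ 2) * (1 + a ^+ 2 + b ^+ 2))).
- apply: eq_cint => y; have [xpq|xpq] := boolP (y \in `[a, b]%classic); last first.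
    rewrite indicE (negbTE xpq) mul0r -[RHS]cint0; apply: eq_cint => x.
    by rewrite /G [\1_`[a, b] y]indicE (negbTE xpq) mulr0 !mul0r.
  have xin := xpq; rewrite indicE xpq mul1r; rewrite inE /= in_itv /= in xpq.
  have := @cint_line (fun z => 'i * f z) (fun x => 'i * D x y) ('i * y%:C) 1 p q pq.
  rewrite !complexRI mulrBr !mulr1 ![_ + 'i * _]addrC => <-.
  - by apply: eq_cint => x; rewrite /G [\1_`[a, b] y]indicE xin mulr1 mul1r.
  - by move=> u l ul; apply: ccvgM; [exact: ccvg_cst|exact: (jcont_scont y (jcontC jD))].
  - move=> t tab; rewrite mulr1 [_ + _%:C]addrC -complexRI /D !clamp_id//.
    by apply: cderivZ; apply: hd.
- have [m1 m2] : jmeas (fun x y => 'i * D x y).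
    apply: jcont_jmeas => u v s t us vt; apply: ccvgM; [exact: ccvg_cst|exact: jD].
  have mi : measurable_fun [set: R * R] (fun z => \1_(`[p, q]) z.1 * \1_(`[a, b]) z.2 : R).
    by apply: measurable_funM; apply: measurableT_comp => //; apply: measurable_indic; exact: measurable_itv.
  by split; [under eq_fun do rewrite cReZ|under eq_fun do rewrite cImZ]; exact: measurable_funM.
- move=> s t.
  have B0 : 0 <= B := le_trans (cabs_ge0 _) (hB s t).
  rewrite !cabsM cabs_i mul1r cabs_real ger0_norm ?mulr_ge0//.
  rewrite mulrC (le_trans (ler_pM _ _ (hB s t) (ler_pM _ _ (indic_le_pk p q s) (indic_le_pk a b t))))// ?cabs_ge0// ?mulr_ge0//.
  by rewrite le_eqVlt; apply/orP; left; apply/eqP; ring.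
Qed.

(** Cauchy's theorem is applied for real parts in [-N, N]. The vertical sides are bounded by a
    multiple of [pk N], hence of 1/N, and vanish in the limit. *)
Lemma cint_strip_shift (f : C -> C) (a b M : R) : a <= b ->
  C1on (fun z => a <= Im z <= b) f ->
  (forall x y : R, a <= y <= b -> cabs (f (x +i* y)) <= M * pk x) ->
  cint (fun x => f (x +i* a)) = cint (fun x => f (x +i* b)).
Proof.
rewrite le_eqVlt => /predU1P[->//|ab] hf hM.
have cf := C1on_cont hf.
have sc (y : R) : a <= y <= b -> scont (fun x => f (x +i* y)).
  move=> hy u l ul; apply: (cf (fun n => u n +i* y)) => //.
  by apply/ccvgP; split => //=; exact: cvg_cst.
have aa : a <= a <= b by rewrite lexx ltW.
have bb : a <= b <= b by rewrite lexx ltW.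
have na := niceI (sc a aa) (fun x => hM x a aa).
have nb := niceI (sc b bb) (fun x => hM x b bb).
have M0 : 0 <= M.
  by have := le_trans (cabs_ge0 _) (hM 0 a aa); rewrite pmulr_lge0// pk_gt0.
pose g x := f (x +i* b) - f (x +i* a).
have gM : pk_bounded g (M + M) by move=> x; rewrite (le_trans (ler_cabsB _ _))// mulrDl lerD// hM.
have mg : cmeas g.
  by apply: scont_cmeas => u l ul; apply: ccvgB; [exact: (sc b bb)|exact: (sc a aa)].
pose N n : R := n.+1%:R.
have N0 n : 0 < N n by [].
pose F n x := (\1_(`[- N n, N n]) x)%:C * g x.
have lim : ccvg (fun n => cint (F n)) (cint g).
  apply: (@cint_cvg _ _ _ (M + M)) => //.
  - move=> n; case: mg => m1 m2.
    have mi : measurable_fun [set: R] (\1_(`[- N n, N n]) : R -> R) by apply: measurable_indic; exact: measurable_itv.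
    by split; [under eq_fun do rewrite cReZ|under eq_fun do rewrite cImZ]; exact: measurable_funM.
  - move=> n x; rewrite cabsM cabs_real ger0_norm ?indic_itv_ge0//.
    rewrite (le_trans _ (gM x))// ler_piMl ?cabs_ge0// indicE.
  - move=> x _; apply/ccvgP.
    have nE : \forall n \near \oo, F n x = g x.
      near=> n; rewrite /F indicE mem_set ?mul1r//= in_itv /= -ler_norml.
      rewrite (@le_trans _ _ n%:R)//; last by rewrite ler_nat.
      by near: n; exact: nbhs_infty_ger.
    by split; apply: cvg_near_cst; apply: filterS nE => n ->.
have lim0 : ccvg (fun n => cint (F n)) 0.
  pose K := 2 * pi * ((M + M) * (1 + a ^+ 2 + b ^+ 2)).
  apply: (@ccvg_squeeze _ _ _ (fun n => K * n.+1%:R^-1)); last first.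
    rewrite -[0](mulr0 K); apply: cvgM; first exact: cvg_cst.
    exact: cvg_harmonic.
  move=> n; rewrite subr0 /F rectangle_cauchy//; last 2 first.
  - by rewrite gtrN.
  - by apply: C1onS hf => z [].
  have pkn : pk (N n) <= n.+1%:R^-1.
    rewrite /pk /oneDsqr lef_pV2 ?posrE//; last by rewrite ltr_pwDl// sqr_ge0.
    by rewrite (@le_trans _ _ (N n ^+ 2)) ?lerDr// expr2 ler_peMl// /N ler1n.
  rewrite /K -mulrA; apply: cabs_cint.
  (* Outside the strip nothing is known about [f]. Clamping y changes nothing where the indicator is
     1 and makes the integrand measurable. *)
  - have ci : scont (fun y : R => f (N n +i* clamp a b y) - f (- N n +i* clamp a b y)).
      have cc (p : R) : scont (fun y : R => f (p +i* clamp a b y)).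
        move=> u l ul; apply: (cf (fun n => p +i* clamp a b (u n))).
        - by move=> k; rewrite /= clamp_itv// ltW.
        - by rewrite /= clamp_itv// ltW.
        - by apply/ccvgP; split => /=; [exact: cvg_cst|exact: clamp_cvg].
      by move=> u l ul; apply: ccvgB; exact: cc.
    rewrite (_ : (fun _ => _) = (fun y => (\1_(`[a, b]) y)%:C * ('i * (f (N n +i* clamp a b y) - f (- N n +i* clamp a b y))))); last first.
      apply/funext => y; rewrite indicE; have [|_] := boolP (y \in `[a, b]%classic); last by rewrite !mul0r.
      by rewrite inE /= in_itv /= => yab; rewrite clamp_id.
    have [m1 m2] : cmeas (fun y : R => 'i * (f (N n +i* clamp a b y) - f (- N n +i* clamp a b y))).
      by apply: scont_cmeas => u l ul; apply: ccvgM; [exact: ccvg_cst|exact: ci].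
    have mi : measurable_fun [set: R] (\1_(`[a, b]) : R -> R) by apply: measurable_indic; exact: measurable_itv.
    by split; [under eq_fun do rewrite cReZ|under eq_fun do rewrite cImZ]; exact: measurable_funM.
  - move=> y; rewrite cabsM cabs_real ger0_norm ?indic_itv_ge0// cabsM cabs_i mul1r.
    have [yab|yab] := boolP (y \in `[a, b]%classic); last first.
      rewrite indicE (negbTE yab) mul0r !mulr_ge0 ?pk_ge0 ?invr_ge0// ?addr_ge0// ?sqr_ge0//.
    rewrite inE /= in_itv /= in yab.
    rewrite mulrC; apply: (@le_trans _ _ ((M + M) * n.+1%:R^-1 * ((1 + a ^+ 2 + b ^+ 2) * pk y))); last first.
      by rewrite le_eqVlt; apply/orP; left; apply/eqP; ring.
    rewrite ler_pM ?cabs_ge0 ?indic_itv_ge0 ?indic_le_pk//.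
    rewrite (le_trans (ler_cabsB _ _))// mulrDl lerD// (le_trans (hM _ _ yab))// ?pkN ler_wpM2l//.
have := ccvg_unique lim lim0; rewrite /g cintB// => /eqP; rewrite subr_eq0 => /eqP ->//.
Unshelve. all: by end_near. Qed.
End Rectangle.

(** * Fourier inversion *)

Section FourierInversion.
Variable R : realType.
Local Notation C := R[i].

(** Squaring e^(|t|/2) >= 1 + |t|/2 gives e^|t| >= 1 + t^2/4 >= (1 + t^2)/4. *)
Lemma expRN_le_pk (t : R) : expR (- `|t|) <= 4 * pk t.
Proof.
rewrite expRN /pk /oneDsqr -[4]invrK -invfM lef_pV2 ?posrE ?expR_gt0//; last first.
  by rewrite mulr_gt0// ltr_pwDl// sqr_ge0.
have -> : `|t| = `|t| / 2 + `|t| / 2 by rewrite -splitr.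
rewrite expRD; have h := expR_ge1Dx (`|t| / 2); have t0 := normr_ge0 t.
have h0 : 0 <= 1 + `|t| / 2 by rewrite addr_ge0// divr_ge0.
rewrite (le_trans _ (ler_pM h0 h0 h h))// -[t ^+ 2]real_normK ?num_real//; nra.
Qed.

Lemma expR_scale_le_pk (e : R) : 0 < e -> exists K, forall t, expR (- (e * `|t|)) <= K * pk t.
Proof.
move=> e0; exists (4 * (1 + e^-1 ^+ 2)) => t.
have := expRN_le_pk (e * t); rewrite normrM gtr0_norm// => /le_trans; apply.
rewrite -mulrA ler_wpM2l// /pk /oneDsqr ler_pdivlMr; last by rewrite ltr_pwDl// sqr_ge0.
rewrite mulrC ler_pdivrMr; last by rewrite ltr_pwDl// sqr_ge0.
rewrite (_ : (_ + _) * _ = 1 + t ^+ 2 + (e^-1 ^+ 2 + (e * t) ^+ 2)); last first.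
  by field; rewrite gt_eqF.
by rewrite lerDl addr_ge0 ?sqr_ge0.
Qed.

Lemma cint_exp_itv (c : C) (a b : R) : c != 0 -> a < b ->
  cint (fun t => (\1_(`[a, b]) t)%:C * cexp (c * t%:C)) = (cexp (c * b%:C) - cexp (c * a%:C)) / c.
Proof.
move=> c0 ab; have H := @cint_line _ (fun z => c^-1 * cexp (c * z)) (fun t => cexp (c * t%:C)) 0 1 a b ab.
rewrite !mulr1 !add0r in H; rewrite [RHS]mulrC mulrBr -H.
- by apply: eq_cint => t; rewrite mul1r.
- by move=> u l ul; apply: ccvg_cexp; apply: ccvgM; [exact: ccvg_cst|exact: ccvg_real].
- move=> t _; rewrite mulr1 add0r -[cexp (c * t%:C)]mul1r -(mulVf c0) -mulrA.
  apply: cderivZ; apply: (@cderiv_comp _ (fun z => c * z) (@cexp R)); last exact: cderiv_cexp.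
  by have := cderiv_affine c 0 t%:C; rewrite (_ : (fun z => _) = (fun z => c * z))//; apply/funext => z; rewrite addr0.
Qed.

Lemma indic_bounded (a b B : R) (w : R -> C) : (forall t, a <= t <= b -> cabs (w t) <= B) ->
  pk_bounded (fun t => (\1_(`[a, b]) t)%:C * w t) ((1 + a ^+ 2 + b ^+ 2) * `|B|).
Proof.
move=> h t; rewrite cabsM cabs_real ger0_norm ?indic_itv_ge0//.
rewrite mulrAC (le_trans _ (ler_wpM2r _ (indic_le_pk a b t)))//.
rewrite indicE; have [|_] := boolP (t \in `[a, b]%classic); last by rewrite !mul0r.
by rewrite inE /= in_itv /= !mul1r => /h /le_trans; apply; exact: ler_norm.
Qed.

Lemma nice_indic (a b B : R) (w : R -> C) : scont w ->
  (forall t, a <= t <= b -> cabs (w t) <= B) -> nice (fun t => (\1_(`[a, b]) t)%:C * w t).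
Proof.
move=> /scont_cmeas[m1 m2] h; split; last first.
  by exists ((1 + a ^+ 2 + b ^+ 2) * `|B|); exact: indic_bounded.
have mi : measurable_fun [set: R] (\1_(`[a, b]) : R -> R) by apply: measurable_indic; exact: measurable_itv.
by split; [under eq_fun do rewrite cReZ|under eq_fun do rewrite cImZ]; exact: measurable_funM.
Qed.

Lemma cint_two_sided_exp (e p : R) : 0 < e ->
  cint (fun t : R => cexp (- (e * `|t|)%:C - 'i * (p * t)%:C)) = (2 * e / (e ^+ 2 + p ^+ 2))%:C.
Proof.
move=> e0; set h := (fun t : R => _).
have [K hK] := expR_scale_le_pk e0.
have hh : pk_bounded h K.
  by move=> t; rewrite /h cabs_cexp cReD !cReN [Re (_ * _)]cReM /= mulr0 mul0r subrr subr0.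
have sh : scont h.
  move=> u l ul; apply: ccvg_cexp; apply: ccvgB.
    by apply: ccvgN; apply: ccvg_real; apply: cvgM; [exact: cvg_cst|exact: cvg_norm].
  by apply: ccvgM; [exact: ccvg_cst|apply: ccvg_real; apply: cvgM => //; exact: cvg_cst].
pose N n : R := n.+1%:R.
pose c1 : C := (- e)  +i* - p; pose c2 : C := e +i* - p.
have c10 : c1 != 0 by apply/eqP => /(congr1 (@complex.Re R)) /= /eqP; rewrite oppr_eq0 gt_eqF.
have c20 : c2 != 0 by apply/eqP => /(congr1 (@complex.Re R)) /= /eqP; rewrite gt_eqF.
(* Both indicators contain 0, so [F n 0] is 2 and not 1; [cint_cvg] disregards this point. *)
pose F n t := (\1_(`[0, N n]) t)%:C * cexp (c1 * t%:C) + (\1_(`[- N n, 0]) t)%:C * cexp (c2 * t%:C).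
have se c : scont (fun t : R => cexp (c * t%:C)).
  by move=> u l ul; apply: ccvg_cexp; apply: ccvgM; [exact: ccvg_cst|exact: ccvg_real].
have a1 t : cabs (cexp (c1 * t%:C)) = expR (- (e * t)).
  by rewrite cabs_cexp cReM /= mulr0 subr0 mulNr.
have a2 t : cabs (cexp (c2 * t%:C)) = expR (e * t).
  by rewrite cabs_cexp cReM /= mulr0 subr0.
have m1 n : nice (fun t => (\1_(`[0, N n]) t)%:C * cexp (c1 * t%:C)).
  apply: (@nice_indic _ _ 1) => // t /andP[t0 _].
  by rewrite a1 -expR0 ler_expR oppr_le0 mulr_ge0// ltW.
have m2 n : nice (fun t => (\1_(`[- N n, 0]) t)%:C * cexp (c2 * t%:C)).
  apply: (@nice_indic _ _ 1) => // t /andP[_ t0].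
  by rewrite a2 -expR0 ler_expR pmulr_rle0.
have l1 : ccvg (fun n => cint (F n)) (cint h).
  apply: (@cint_cvg _ _ _ (K + K)) => //.
  - by move=> n; have [] := niceD (m1 n) (m2 n).
  - exact: scont_cmeas.
  - move=> n t; rewrite (le_trans (ler_cabsD _ _))// mulrDl lerD// cabsM cabs_real ger0_norm ?indic_itv_ge0//.
      rewrite a1 (le_trans _ (hK t))// indicE; have [|_] := boolP (t \in `[0, N n]%classic); last by rewrite mul0r expR_ge0.
      by rewrite inE /= in_itv /= => /andP[t0 _]; rewrite mul1r ger0_norm.
    rewrite a2 (le_trans _ (hK t))// indicE; have [|_] := boolP (t \in `[- N n, 0]%classic); last by rewrite mul0r expR_ge0.
    by rewrite inE /= in_itv /= => /andP[_ t0]; rewrite mul1r ler0_norm// mulrN opprK.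
  - move=> t t0; suff nE : \forall n \near \oo, F n t = h t.
      by apply/ccvgP; split; apply: cvg_near_cst; apply: filterS nE => n ->.
    near=> n; have tN : `|t| <= N n.
      rewrite (@le_trans _ _ n%:R)//; last by rewrite ler_nat.
      by near: n; exact: nbhs_infty_ger.
    have /andP[t1 t2] : - N n <= t <= N n by rewrite -ler_norml.
    have i1 : (t \in `[0, N n]%classic) = (0 <= t).
      by apply/idP/idP; rewrite inE /= in_itv /= t2 andbT.
    have i2 : (t \in `[- N n, 0]%classic) = (t <= 0).
      by apply/idP/idP; rewrite inE /= in_itv /= t1.
    rewrite /F /h !indicE i1 i2; have [tp|tn|tz] := ltgtP 0 t; last by rewrite -tz eqxx in t0.
      rewrite mul1r mul0r addr0 gtr0_norm//; congr cexp.
      by apply: complexP; rewrite ?cReD ?cImD ?cReN ?cImN ?cReM ?cImM /=; ring.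
    rewrite mul1r mul0r add0r ltr0_norm//; congr cexp.
    by apply: complexP; rewrite ?cReD ?cImD ?cReN ?cImN ?cReM ?cImM /=; ring.
have l2 : ccvg (fun n => cint (F n)) ((0 - 1) / c1 + (1 - 0) / c2).
  have z0 (w : nat -> C) : (forall n, cabs (w n) = expR (- (e * N n))) -> ccvg w 0.
    move=> hw; apply: (@ccvg_squeeze _ _ _ (fun n => K * n.+1%:R^-1)); last first.
      rewrite -[0](mulr0 K); apply: cvgM; [exact: cvg_cst|exact: cvg_harmonic].
    move=> n; rewrite subr0 hw; have := hK (N n); rewrite ger0_norm ?ler0n// => /le_trans; apply.
    have K0 : 0 <= K by have := le_trans (expR_ge0 _) (hK 0); rewrite pmulr_lge0// pk_gt0.
    rewrite ler_wpM2l// /pk /oneDsqr lef_pV2 ?posrE//; last by rewrite ltr_pwDl// sqr_ge0.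
    by rewrite (@le_trans _ _ (N n ^+ 2)) ?lerDr// expr2 ler_peMl// /N ?ler1n.
  have -> : (fun n => cint (F n)) = (fun n => (cexp (c1 * (N n)%:C) - 1) / c1 + (1 - cexp (c2 * (- N n)%:C)) / c2).
    apply/funext => n; rewrite cintD// !cint_exp_itv ?oppr_lt0//.
    by rewrite !mulr0 cexp0.
  apply: ccvgD; (apply: ccvgM; last exact: ccvg_cst); apply: ccvgB; try exact: ccvg_cst.
    by apply: z0 => n; rewrite a1.
  by apply: z0 => n; rewrite a2 mulrN.
rewrite (ccvg_unique l1 l2) sub0r subr0 mulN1r mul1r.
have E1 : c1 - c2 = (- (2 * e))%:C by apply: complexP; rewrite ?cReD ?cImD ?cReN ?cImN /=; ring.
have E2 : c1 * c2 = (- (e ^+ 2 + p ^+ 2))%:C by apply: complexP; rewrite ?cReM ?cImM /=; ring.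
have -> : - c1^-1 + c2^-1 = (c1 - c2) / (c1 * c2) by field; rewrite c10 c20.
by rewrite E1 E2 -fmorphV -rmorphM /= invrN mulrNN.
Unshelve. all: by end_near. Qed.

Lemma scont_line (f : C -> C) (S : C -> Prop) (y : R) : cont_in S f ->
  (forall x, S (x +i* y)) -> scont (fun x => f (x +i* y)).
Proof.
move=> cf hS u l ul; apply: (cf (fun n => u n +i* y)) => //.
by apply/ccvgP; split => //=; exact: cvg_cst.
Qed.

Lemma cint_pk (a : C) : cint (fun t : R => a * (pk t)%:C) = a * pi%:C.
Proof.
rewrite cintZ.
  congr (_ * _); apply: complexP => /=.
    by have := Rintegral_pk (1 : R); under eq_Rintegral do rewrite mul1r; rewrite mul1r.
  by rewrite /Rintegral integral0.
apply: (@niceI _ _ 1).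
  by move=> u l ul; apply: ccvg_real; apply: continuous_cvg => //; exact: continuous_pk.
by move=> t; rewrite cabs_real ger0_norm ?pk_ge0// mul1r.
Qed.

Lemma pi_ge1 : 1 <= pi :> R.
Proof. by rewrite (@le_trans _ _ 2)// ?pi_ge2//; lra. Qed.

Lemma poisson_scale (a e t : R) : 0 < a -> 0 < e ->
  2 * (a * e) / ((a * e) ^+ 2 + (a * (e * t)) ^+ 2) = e^-1 * (2 / a * pk t).
Proof.
move=> a0 e0; have t0 : 1 + t ^+ 2 != 0 by rewrite gt_eqF// ltr_pwDl// sqr_ge0.
rewrite (_ : (a * e) ^+ 2 + _ = (a * e) ^+ 2 * (1 + t ^+ 2)); last by ring.
by rewrite /pk /oneDsqr; field; rewrite t0 !gt_eqF.
Qed.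

(* The Fourier transform is regularized by the kernel exp(-pi e |t|), whose
   Fourier transform is the Poisson kernel. *)
Lemma fourier_inversion0 (g : C -> C) (M : R) :
  C1on (fun z => -1 <= Im z <= 1) g ->
  (forall x y : R, -1 <= y <= 1 -> cabs (g (x +i* y)) <= M * pk x) ->
  cint (fun t : R => cint (fun p : R => cexp (- (cpi R * 'i * (t * p)%:C)) * g p%:C)) = 2 * g 0.
Proof.
move=> hg hM.
have cg : scont (fun x => g x%:C).
  by apply: (scont_line (C1on_cont hg)) => x /=; apply/andP; split; [exact: lerN10|exact: ler01].
have h0 : -1 <= (0 : R) <= 1 by apply/andP; split; [exact: lerN10|exact: ler01].
have g0 x : cabs (g x%:C) <= M * pk x by exact: hM.
have M0 : 0 <= M.
  by have := le_trans (cabs_ge0 _) (g0 0); rewrite pmulr_lge0// pk_gt0.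
have kr (t p : R) : Re (- (cpi R * 'i * (t * p)%:C)) = 0.
  by rewrite cReN !cReM cImM /=; ring.
have kj u v (t p : R) : u @ \oo --> t -> v @ \oo --> p ->
    ccvg (fun n => cexp (- (cpi R * 'i * (u n * v n)%:C))) (cexp (- (cpi R * 'i * (t * p)%:C))).
  move=> ut vp; apply: ccvg_cexp; apply: ccvgN; apply: ccvgM; first exact: ccvg_cst.
  by apply: ccvg_real; exact: cvgM.
pose H t p := cexp (- (cpi R * 'i * (t * p)%:C)) * g p%:C.
have jH : jcont H.
  by move=> u v t p ut vp; apply: ccvgM; [exact: kj|exact: cg].
have HM t : pk_bounded (H t) M.
  by move=> p; rewrite cabsM cabs_cexp kr expR0 mul1r.
pose h t := cint (H t).
have sh : scont h.
  move=> u l ul; apply: (@cint_cvg _ _ _ M) => //.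
  - by move=> n; apply: scont_cmeas; exact: jcont_scont.
  - by apply: scont_cmeas; exact: jcont_scont.
  - by move=> p _; apply: jH => //; exact: cvg_cst.
(* Moving the p contour to height -1 for t >= 0 and to height 1 for t < 0 turns the phase into a
   factor e^(-pi |t|). This makes [h] integrable. *)
have hb t : cabs (h t) <= 2 * pi * (M * expR (- `|t|)).
  pose s : R := if 0 <= t then -1 else 1.
  have s1 : -1 <= s <= 1 by rewrite /s; case: ifP; lra.
  have st : t * s = - `|t|.
    rewrite /s; case: ifPn => ht; first by rewrite mulrN1 ger0_norm.
    by rewrite mulr1 ltr0_norm ?opprK// ltNge.
  pose G z := cexp (- (cpi R * 'i * t%:C) * z + 0) * g z.
  have GE (x y : R) : cabs (G (x +i* y)) = expR (pi * t * y) * cabs (g (x +i* y)).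
    rewrite cabsM cabs_cexp; congr (expR _ * _).
    by rewrite addr0 cReM cReN cImN !cReM !cImM !cReM /=; ring.
  have GC : C1on (fun z => -1 <= Im z <= 1) G.
    by apply: C1onM => //; apply: C1on_cexp; exact: C1on_affine.
  have GM (x y : R) : -1 <= y <= 1 -> cabs (G (x +i* y)) <= expR (pi * `|t|) * M * pk x.
    move=> hy; rewrite GE -[leRHS]mulrA ler_pM ?expR_ge0 ?cabs_ge0 ?hM// ler_expR -mulrA ler_wpM2l ?pi_ge0//.
    rewrite (le_trans (ler_norm _))// normrM ler_piMr// ler_norml; lra.
  have -> : h t = cint (fun x => G (x +i* s)).
    transitivity (cint (fun x => G (x +i* 0))).
      apply: eq_cint => p; rewrite /H /G; congr (cexp _ * _).
      by rewrite addr0 rmorphM /=; rewrite -[p +i* 0]/(p%:C); ring.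
    have sh1 a b : -1 <= a -> a <= b -> b <= 1 -> cint (fun x => G (x +i* a)) = cint (fun x => G (x +i* b)).
      move=> ha hab hb; apply: (cint_strip_shift hab); first by apply: C1onS GC => z; lra.
      by move=> x y hy; apply: GM; lra.
    by rewrite /s; case: ifP => _; [rewrite -(sh1 (-1) 0)//; lra|rewrite -(sh1 0 1)//; lra].
  apply: cabs_cint.
    apply: scont_cmeas; apply: (scont_line (C1on_cont GC)) => x /=; lra.
  move=> x; rewrite GE [leLHS]mulrC [leRHS]mulrAC ler_pM ?expR_ge0 ?cabs_ge0 ?hM//.
  rewrite ler_expR -mulrA st mulrN lerN2 ler_peMl// pi_ge1//.
have hb2 : pk_bounded h (8 * pi * M).
  move=> t; rewrite (le_trans (hb t))// mulrA (le_trans (ler_wpM2l _ (expRN_le_pk t)))//.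
    by rewrite !mulr_ge0 ?pi_ge0.
  by rewrite le_eqVlt; apply/orP; left; apply/eqP; ring.
pose e n : R := n.+1%:R^-1.
have e0 n : 0 < e n by rewrite invr_gt0.
have ce : e @ \oo --> (0 : R) by exact: cvg_harmonic.
pose A n t := cexp (- (pi * e n * `|t|)%:C) * h t.
have expn n (t : R) : cabs (cexp (- (pi * e n * `|t|)%:C)) = expR (- (pi * e n * `|t|)).
  by rewrite cabs_cexp cReN.
have sce n : scont (fun t : R => cexp (- (pi * e n * `|t|)%:C)).
  move=> u l ul; apply: ccvg_cexp; apply: ccvgN; apply: ccvg_real.
  by apply: cvgM; [exact: cvg_cst|exact: cvg_norm].
have pe0 n : 0 < pi * e n by rewrite mulr_gt0// pi_gt0.
have l1 : ccvg (fun n => cint (A n)) (cint h).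
  apply: (@cint_cvg _ _ _ (8 * pi * M)).
  - move=> n; apply: scont_cmeas => u l ul; apply: ccvgM; [exact: sce|exact: sh].
  - exact: scont_cmeas.
  - move=> n t; rewrite (le_trans _ (hb2 t))// cabsM ler_piMl ?cabs_ge0// expn.
    by rewrite -expR0 ler_expR oppr_le0 mulr_ge0// ltW.
  - move=> t _; rewrite -[h t]mul1r -(cexp0 R) /A; apply: ccvgM; last exact: ccvg_cst.
    apply: ccvg_cexp; rewrite -[0](oppr0); apply: ccvgN; rewrite -[0]/((0 : R)%:C).
    apply: ccvg_real; rewrite (_ : 0 = pi * 0 * `|t|); last by rewrite mulr0 mul0r.
    by apply: cvgM; [apply: cvgM => //; exact: cvg_cst|exact: cvg_cst].
(* The Poisson kernel after the substitution p = e s. Its total mass is 2, the factor in the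
   conclusion. *)
pose k n s := (2 / pi * pk s)%:C * g (e n * s)%:C.
have sk n : scont (k n).
  move=> u l ul; apply: ccvgM.
    apply: ccvg_real; apply: cvgM; first exact: cvg_cst.
    by apply: continuous_cvg => //; exact: continuous_pk.
  by apply: (cg (fun m => e n * u m)); apply: cvgM => //; exact: cvg_cst.
have kb n : pk_bounded (k n) (2 / pi * M).
  move=> s; rewrite cabsM cabs_real ger0_norm; last by rewrite !mulr_ge0 ?invr_ge0 ?pi_ge0 ?pk_ge0.
  rewrite mulrAC ler_wpM2r ?pk_ge0// ler_wpM2l ?divr_ge0 ?pi_ge0//.
  by rewrite (le_trans (g0 _))// ler_piMr// pk_le1.
have AE n : cint (A n) = cint (k n).
  have [K hK] := expR_scale_le_pk (pe0 n).
  pose f p := (2 * (pi * e n) / ((pi * e n) ^+ 2 + (pi * p) ^+ 2))%:C * g p%:C.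
  have pe2 p : 0 < (pi * e n) ^+ 2 + (pi * p) ^+ 2 by rewrite ltr_pwDl ?sqr_ge0// exprn_gt0.
  have nf : nice f.
    apply: (@niceI _ _ (2 / (pi * e n) * M)).
      move=> u l ul; apply: ccvgM; last exact: cg.
      apply: ccvg_real; apply: cvgM; first exact: cvg_cst.
      apply: cvgV; first by rewrite gt_eqF.
      apply: cvgD; first exact: cvg_cst.
      by rewrite !expr2; apply: cvgM; (apply: cvgM; [exact: cvg_cst|exact: ul]).
    move=> p; rewrite cabsM cabs_real -[leRHS]mulrA ler_pM ?cabs_ge0//.
    rewrite ger0_norm; last by rewrite divr_ge0 ?(ltW (pe2 p))// mulr_ge0// ltW.
    rewrite ler_pdivrMr// -mulrA ler_wpM2l// ler_pdivlMl// -expr2.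
    by rewrite lerDl sqr_ge0.
  transitivity (cint (fun t => cint (fun p => cexp (- (pi * e n * `|t|)%:C) * H t p))).
    by apply: eq_cint => t; rewrite cintZ//; exact: niceI (jcont_scont t jH) (HM t).
  rewrite (@cint_swap _ _ (K * M)); last 2 first.
  - move=> u v t p ut vp; apply: ccvgM; [exact: sce|exact: jH].
  - move=> t p; rewrite cabsM expn (_ : K * M * pk t * pk p = (K * pk t) * (M * pk p)); last by ring.
    by rewrite ler_pM ?expR_ge0 ?cabs_ge0// HM.
  transitivity (cint f).
    apply: eq_cint => p; rewrite /f -cint_two_sided_exp// [RHS]mulrC -cintZ.
      apply: eq_cint => t; rewrite /H mulrA mulrC -cexpD; congr (_ * cexp _); congr (- _ + _).
      by apply: complexP; rewrite ?cReD ?cImD ?cReN ?cImN ?cReM ?cImM /= ?cReM ?cImM /=; ring.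
    apply: (@niceI _ _ K).
      move=> u l ul; apply: ccvg_cexp; apply: ccvgB.
        apply: ccvgN; apply: ccvg_real; apply: cvgM; [exact: cvg_cst|exact: cvg_norm].
      apply: ccvgM; first exact: ccvg_cst.
      by apply: ccvg_real; apply: cvgM; [exact: cvg_cst|exact: ul].
    move=> t; rewrite cabs_cexp cReD !cReN [Re (_ * _)]cReM /= mulr0 mul0r subrr subr0.
    exact: hK.
  rewrite -(@cint_affine _ (e n) 0 f) ?gt_eqF// gtr0_norm//.
  rewrite (_ : (fun t => _) = (fun t => (e n)^-1%:C * k n t)); last first.
    apply/funext => t; rewrite addr0 /f /k [RHS]mulrA -rmorphM /=; congr (_%:C * _).
    by apply: poisson_scale => //; exact: pi_gt0.
  rewrite cintZ; last exact: niceI (sk n) (kb n).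
  by rewrite mulrA -rmorphM /= divff ?mul1r// gt_eqF.
have l2 : ccvg (fun n => cint (A n)) (2 * g 0).
  have -> : 2 * g 0 = cint (fun s => ((2 / pi)%:C * g 0) * (pk s)%:C).
    rewrite cint_pk mulrAC -rmorphM /= divfK ?gt_eqF ?pi_gt0//.
    by rewrite natcE.
  rewrite (_ : (fun n => cint (A n)) = (fun n => cint (k n))); last exact/funext.
  have sc0 : scont (fun s => (2 / pi)%:C * g 0 * (pk s)%:C).
    move=> u l ul; apply: ccvgM; first exact: ccvg_cst.
    by apply: ccvg_real; apply: continuous_cvg => //; exact: continuous_pk.
  apply: (@cint_cvg _ _ _ (2 / pi * M)) => //.
  - by move=> n; exact: scont_cmeas.
  - exact: scont_cmeas.
  - move=> s _; rewrite (_ : _ * _ = (2 / pi * pk s)%:C * g 0); last by rewrite mulrAC -rmorphM.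
    apply: ccvgM; first exact: ccvg_cst.
    apply: (cg (fun n => e n * s)); rewrite (_ : 0 = 0 * s); last by rewrite mul0r.
    by apply: cvgM => //; exact: cvg_cst.
exact: ccvg_unique l1 l2.
Qed.

(** Peetre's inequality: x = (x + r) - r gives x^2 <= 2 (x + r)^2 + 2 r^2. *)
Lemma pk_shift_le (r x : R) : pk (x + r) <= 2 * (1 + r ^+ 2) * pk x.
Proof.
rewrite /pk /oneDsqr ler_pdivlMr; last by rewrite ltr_pwDl// sqr_ge0.
rewrite mulrC ler_pdivrMr; last by rewrite ltr_pwDl// sqr_ge0.
have := sqr_ge0 (x + 2 * r); have := sqr_ge0 r; have := sqr_ge0 (x + r).
have := sqr_ge0 (r * (x + r)); nra.
Qed.

(** Inversion at 0 is applied to the translate z |-> g(z + a). For each fixed t the p contour is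
    moved to height Im a; the bound for this move may grow with t, since t is held fixed meanwhile.
    The extra 1 is the half-width that [fourier_inversion0] requires. *)
Lemma fourier_inversion (g : C -> C) (a : C) (M : R) : C1on (fun=> True) g ->
  (forall x y : R, `|y| <= `|Im a| + 1 -> cabs (g (x +i* y)) <= M * pk x) ->
  cint (fun t : R => cint (fun p : R => cexp (cpi R * 'i * (t%:C * (a - p%:C))) * g p%:C)) = 2 * g a.
Proof.
move=> hg hM; set r := Re a; set s := Im a.
have hshift : C1on (fun z => -1 <= Im z <= 1) (fun z => g (1 * z + a)).
  by apply: (C1on_comp _ hg) => //; exact: C1on_affine.
have M0 : 0 <= M.
  by have := le_trans (cabs_ge0 _) (hM 0 s _); rewrite lerDl => /(_ ler01); rewrite pmulr_lge0// pk_gt0.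
have := @fourier_inversion0 (fun z => g (1 * z + a)) (M * (2 * (1 + r ^+ 2))) hshift.
rewrite mulr0 add0r => <-; last first.
  move=> x y hy; rewrite (_ : _ + a = (x + r) +i* (y + s)); last first.
    by apply: complexP; rewrite ?cReD ?cImD ?cReM ?cImM /=; ring.
  rewrite (le_trans (hM _ _ _))//; last by rewrite -mulrA ler_wpM2l// pk_shift_le.
  by rewrite (le_trans (ler_normD _ _))// addrC lerD2l ler_norml.
apply: eq_cint => t.
pose G z := cexp (- (cpi R * 'i * t%:C) * z + cpi R * 'i * t%:C * a) * g z.
have GC : C1on (fun=> True) G by apply: C1onM => //; apply: C1on_cexp; exact: C1on_affine.
have GM (x y : R) : `|y| <= `|s| -> cabs (G (x +i* y)) <= expR (pi * (`|t| * (2 * `|s|))) * M * pk x.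
  move=> hy; rewrite cabsM -[leRHS]mulrA ler_pM ?cabs_ge0//; last by rewrite hM// (le_trans hy)// lerDl.
  rewrite cabs_cexp ler_expR (_ : Re _ = pi * (t * (y - s))); last first.
    by rewrite !(cReD, cReN, cImN, cReM, cImM) /= -/r -/s; ring.
  rewrite ler_wpM2l ?pi_ge0// (le_trans (ler_norm _))// normrM ler_wpM2l//.
  by rewrite (le_trans (ler_normB _ _))// mulr_natl mulr2n lerD2r.
have sG (y : R) : scont (fun x => G (x +i* y)) by apply: (scont_line (C1on_cont GC)).
transitivity (cint (fun x => G (x +i* 0))).
  by apply: eq_cint => p; rewrite /G -[p +i* 0]/(p%:C); congr (cexp _ * _); ring.
transitivity (cint (fun x => G (x +i* s))).
  have [s0|s0] := leP 0 s.
    apply: (cint_strip_shift s0); first by apply: C1onS GC.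
    move=> x y /andP[y0 ys]; apply: GM; rewrite !ger0_norm//.
  symmetry; apply: (cint_strip_shift (ltW s0)); first by apply: C1onS GC.
  move=> x y /andP[y0 ys]; apply: GM; rewrite !ler0_norm ?lerN2// ltW//.
rewrite -(cint_shift r); last by apply: niceI => // x; apply: GM.
apply: eq_cint => p; rewrite /G; congr (cexp _ * g _).
  by apply: complexP; rewrite ?cReD ?cImD ?cReN ?cImN ?cReM ?cImM /= ?cReM ?cImM ?cReN ?cImN ?cReM ?cImM /=; ring.
by apply: complexP; rewrite ?cReD ?cImD ?cReM ?cImM /=; ring.
Qed.

Lemma fourier_inversionN (g : C -> C) (a : C) (M : R) : C1on (fun=> True) g ->
  (forall x y : R, `|y| <= `|Im a| + 1 -> cabs (g (x +i* y)) <= M * pk x) ->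
  cint (fun t : R => cint (fun p : R => cexp (cpi R * 'i * (t%:C * (p%:C - a))) * g p%:C)) = 2 * g a.
Proof.
move=> hg hM; have := @fourier_inversion (fun z => g (-1 * z + 0)) (- a) M.
rewrite mulN1r opprK addr0 => <-.
- apply: eq_cint => t; rewrite -(cint_refl 0); last first.
    apply: (@niceI _ _ (expR (pi * (t * Im a)) * M)).
      move=> u l ul; apply: ccvgM.
        apply: ccvg_cexp; apply: ccvgM; first exact: ccvg_cst.
        apply: ccvgM; first exact: ccvg_cst.
        by apply: ccvgB; [exact: ccvg_real|exact: ccvg_cst].
      by apply: (scont_line (y := 0) (C1on_cont hg)).
    move=> x; rewrite cabsM -[leRHS]mulrA ler_pM ?cabs_ge0//; last first.
      by apply: (hM x 0); rewrite normr0 addr_ge0.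
    rewrite cabs_cexp ler_expR le_eqVlt; apply/orP; left; apply/eqP.
    by rewrite !(cReD, cImD, cReN, cImN, cReM, cImM) /=; ring.
  apply: eq_cint => p; congr (cexp _ * g _).
    by rewrite sub0r rmorphN /=; ring.
  by rewrite sub0r rmorphN /=; ring.
- by apply: (C1on_comp _ hg) => //; exact: C1on_affine.
- move=> x y hy; rewrite (_ : _ + 0 = (- x) +i* (- y)); last first.
    by apply: complexP; rewrite ?cReD ?cImD ?cReM ?cImM ?cReN ?cImN /=; ring.
  by rewrite -(pkN x) hM// normrN (le_trans hy)// cImN normrN.
Qed.
End FourierInversion.

(** * Growth of the quantum dilogarithm *)

Section ExpBounds.
Variable R : realType.
Local Notation C := R[i].

Lemma cabs_scale_le (t : R) (z : C) : 0 <= t <= 1 -> cabs (t%:C * z) <= cabs z.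
Proof. by move=> /andP[t0 t1]; rewrite cabsM cabs_real ger0_norm// ler_piMl// cabs_ge0. Qed.

Lemma cabs_cexp_le (z : C) : cabs (cexp z) <= expR (cabs z).
Proof. by rewrite cabs_cexp ler_expR (le_trans (ler_norm _))// ler_Re_cabs. Qed.

(** The three Taylor bounds follow in turn from [cabs_mvt], each remainder having the previous one
    as derivative. Every step brings a factor 2 |z|, whence the constants 2, 4, 8. *)
Lemma cexp_taylor1 (z : C) : cabs (cexp z - 1) <= 2 * cabs z * expR (cabs z).
Proof.
have := @cabs_mvt _ (@cexp R) (fun t => cexp (0 + t%:C * z)) 0 z (expR (cabs z)).
rewrite add0r cexp0; apply=> [t _|t t01]; first exact: cderiv_cexp.
by rewrite add0r (le_trans (cabs_cexp_le _))// ler_expR cabs_scale_le.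
Qed.

Lemma cexp_taylor2 (z : C) : cabs (cexp z - 1 - z) <= 4 * cabs z ^+ 2 * expR (cabs z).
Proof.
have := @cabs_mvt _ (fun z => cexp z + (-1 * z + 0)) (fun t => cexp (0 + t%:C * z) + -1) 0 z
  (2 * cabs z * expR (cabs z)).
rewrite add0r cexp0 mulr0 !addr0 !mulN1r (_ : cexp z - z - 1 = cexp z - 1 - z); last by ring.
rewrite (_ : 2 * cabs z * (2 * cabs z * expR (cabs z)) = 4 * cabs z ^+ 2 * expR (cabs z)); last by ring.
apply=> [t _|t t01].
  by apply: cderivD; [exact: cderiv_cexp|exact: cderiv_affine].
rewrite add0r (le_trans (cexp_taylor1 _))// ler_pM ?expR_ge0 ?mulr_ge0 ?cabs_ge0//.
  by rewrite ler_wpM2l// cabs_scale_le.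
by rewrite ler_expR cabs_scale_le.
Qed.

Lemma cexp_taylor3 (z : C) :
  cabs (cexp z - 1 - z - z ^+ 2 / 2) <= 8 * cabs z ^+ 3 * expR (cabs z).
Proof.
have := @cabs_mvt _ (fun z => cexp z + (-1 * z + (- 2^-1) * (z * z)))
  (fun t => cexp (0 + t%:C * z) + (-1 + (- 2^-1) * (2 * (0 + t%:C * z)))) 0 z
  (4 * cabs z ^+ 2 * expR (cabs z)).
rewrite add0r cexp0 !mulr0 !addr0 (_ : _ + _ - 1 = cexp z - 1 - z - z ^+ 2 / 2); last by field.
rewrite (_ : 2 * cabs z * (4 * cabs z ^+ 2 * expR (cabs z)) = 8 * cabs z ^+ 3 * expR (cabs z)); last by ring.
apply=> [t _|t t01].
  apply: cderivD; first exact: cderiv_cexp.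
  apply: cderivD; last by apply: cderivZ; exact: cderiv_sqr.
  by have := cderiv_affine (-1) 0 (0 + t%:C * z); under eq_fun do rewrite addr0.
rewrite add0r (_ : _ + _ = cexp (t%:C * z) - 1 - t%:C * z); last by field.
rewrite (le_trans (cexp_taylor2 _))// ler_pM ?expR_ge0 ?mulr_ge0 ?exprn_ge0 ?cabs_ge0//.
  by rewrite ler_wpM2l// lerXn2r ?nnegrE ?cabs_ge0// cabs_scale_le.
by rewrite ler_expR cabs_scale_le.
Qed.

Lemma csinh_taylor2 (z : C) : cabs (csinh z - z) <= 4 * cabs z ^+ 2 * expR (cabs z).
Proof.
have h1 := cexp_taylor2 z; have := cexp_taylor2 (- z); rewrite cabsN => h2.
rewrite (_ : _ - _ = 2^-1 * ((cexp z - 1 - z) - (cexp (- z) - 1 - - z))); last by rewrite /csinh; field.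
rewrite cabsM cabsV cabs_nat ler_pdivrMl// (le_trans (ler_cabsB _ _))//.
by rewrite [leRHS]mulr_natl mulr2n lerD.
Qed.

Lemma ler_norm_sin (x : R) : `|sin x| <= `|x|.
Proof.
have h (y : R) : 0 < y -> `|sin y| <= y.
  move=> y0; have [|c _] := @MVT _ sin cos 0 y y0.
    by apply: continuous_subspaceT => t; exact: continuous_sin.
  rewrite sin0 !subr0 => ->; rewrite normrM (gtr0_norm y0) ler_piMl ?(ltW y0)//.
  by rewrite ler_norml cos_geN1 cos_le1.
have [x0|x0|->] := ltgtP x 0; last by rewrite sin0 normr0.
  by rewrite -normrN -sinN (ltr0_norm x0) h// oppr_gt0.
by rewrite (gtr0_norm x0) h.
Qed.

Lemma cos_ge_quadratic (x : R) : 1 - x ^+ 2 / 2 <= cos x.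
Proof.
have -> : cos x = 1 - 2 * sin (x / 2) ^+ 2.
  rewrite {1}(splitr x) cosD; have := cos2Dsin2 (x / 2) => h; rewrite -!expr2.
  have -> : cos (x / 2) ^+ 2 = 1 - sin (x / 2) ^+ 2 by apply/eqP; rewrite eq_sym subr_eq addrC; apply/eqP; rewrite addrC h.
  by ring.
have := ler_norm_sin (x / 2); rewrite -(@ler_sqr _ `|_|) ?nnegrE// !real_normK ?num_real// => h.
have -> : x ^+ 2 / 2 = 2 * (x / 2) ^+ 2 by field.
by rewrite lerD2l lerN2 ler_wpM2l.
Qed.

(** On this range cos is at least 1 - (5/4)^2/2 = 7/32 > 1/5. The range must exceed 1 to leave room
    in [cabs_csinh_lower]. *)
Lemma sin_lower (x : R) : `|x| <= 5 / 4 -> `|x| / 5 <= `|sin x|.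
Proof.
have h (y : R) : 0 < y -> y <= 5 / 4 -> y / 5 <= `|sin y|.
  move=> y0 y1; have [|c] := @MVT _ sin cos 0 y y0.
    by apply: continuous_subspaceT => t; exact: continuous_sin.
  rewrite in_itv /= => /andP[c0 cy]; rewrite sin0 !subr0 => ->; rewrite (le_trans _ (ler_norm _))//.
  rewrite mulrC ler_wpM2r ?(ltW y0)//; have := cos_ge_quadratic c; nra.
have [x0|x0|->] := ltgtP x 0; last by rewrite normr0 mul0r.
  by rewrite -normrN -(normrN (sin x)) -sinN (@gtr0_norm _ (- x)) ?oppr_gt0// => xx; apply: h; rewrite ?oppr_gt0.
by rewrite (gtr0_norm x0); exact: h.
Qed.

Lemma cabs_csinh_sqr (z : C) : cabs (csinh z) ^+ 2 =
  ((expR (Re z) - expR (- Re z)) / 2) ^+ 2 + sin (Im z) ^+ 2.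
Proof.
rewrite cabsE sqr_sqrtr ?addr_ge0 ?sqr_ge0//.
have -> : csinh z = (2^-1)%:C * (cexp z - cexp (- z)).
  by rewrite /csinh mulrC natcE -fmorphV.
rewrite cReZ cImZ cReD cImD cReN cImN !Re_cexp !Im_cexp cReN cImN cosN sinN.
set E := expR _; set F := expR (- _).
have EF : E * F = 1 by rewrite /E /F expRxMexpNx_1.
have h : cos (Im z) ^+ 2 = 1 - sin (Im z) ^+ 2 by rewrite -(cos2Dsin2 (Im z)) addrK.
rewrite (_ : _ + _ = 2^-1 ^+ 2 * ((E - F) ^+ 2 * cos (Im z) ^+ 2 + (E + F) ^+ 2 * sin (Im z) ^+ 2)); last by ring.
rewrite h (_ : (E + F) ^+ 2 = (E - F) ^+ 2 + 4 * (E * F)); last by ring.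
by rewrite EF; field.
Qed.

Lemma cabs_csinh_ge (z : C) : expR `|Re z| <= 2 * cabs (csinh z) + 1.
Proof.
set X := Re z; have c0 := cabs_ge0 (csinh z).
have h : `|(expR X - expR (- X)) / 2| <= cabs (csinh z).
  rewrite -[leRHS]ger0_norm// -ler_sqr ?nnegrE// !real_normK ?num_real//.
  by rewrite cabs_csinh_sqr lerDl sqr_ge0.
have g (x : R) : 0 <= x -> expR x - 1 <= expR x - expR (- x).
  by move=> x0; rewrite lerD2l lerN2 -expR0 ler_expR oppr_le0.
have := ler_norm ((expR X - expR (- X)) / 2); have := ler_norm (- ((expR X - expR (- X)) / 2)).
rewrite normrN; have [X0|X0] := leP 0 X.
  have := g X X0; rewrite (ger0_norm X0); lra.
have := g (- X); rewrite oppr_ge0 opprK => /(_ (ltW X0)); rewrite (ltr0_norm X0); lra.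
Qed.

(* X = Re z satisfies Im z = k X + v with |v| <= 1, so z stays away from the
   zeros i pi n, n <> 0, of sinh. *)
Lemma cabs_csinh_lower (k : R) : exists2 c : R, 0 < c & forall z : C,
  `|Im z - k * Re z| <= 1 -> cabs z <= c * cabs (csinh z).
Proof.
exists (2 * (1 + 5 * `|k|) + 5) => [|z]; first by have := normr_ge0 k; lra.
set X := Re z; set Y := Im z => hk.
have c0 := cabs_ge0 (csinh z); have k0 := normr_ge0 k.
have X2 : `|X| <= 2 * cabs (csinh z).
  have := cabs_csinh_ge z; have := expR_ge1Dx `|X|; rewrite -/X; lra.
have zz : cabs z <= `|X| + `|Y| by exact: ler_cabs_ReIm.
have [Y1|Y1] := leP `|Y| (5 / 4).
  have : `|Y| / 5 <= cabs (csinh z).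
    rewrite (le_trans (sin_lower Y1))// -[leRHS]ger0_norm// -ler_sqr ?nnegrE// !real_normK ?num_real//.
    by rewrite cabs_csinh_sqr lerDr sqr_ge0.
  nra.
(* For |Y| > 5/4 one has |Y| - 1 >= |Y|/5, so |Y| <= 5 |k| |X|, and |X| is already controlled. *)
have : `|Y| <= `|k| * `|X| + 1.
  by rewrite -normrM -lerBlDl (le_trans _ hk)// lerB_dist.
nra.
Qed.
End ExpBounds.

(** * Lower bounds for the denominator in log phi *)

Section DilogKernel.
Variable R : realType.
Local Notation C := R[i].

Lemma Re_inv (b : C) : Re b^-1 = Re b / (Re b ^+ 2 + Im b ^+ 2).
Proof. by case: b => b1 b2. Qed.

Lemma Re_inv_gt0 (b : C) : 0 < Re b -> 0 < Re b^-1.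
Proof. by move=> h; rewrite Re_inv divr_gt0// ltr_pwDl ?sqr_ge0// exprn_gt0. Qed.

Lemma Re_gt0_neq0 (b : C) : 0 < Re b -> b != 0.
Proof. by move=> h; apply/eqP => b0; rewrite b0 ltxx in h. Qed.

(** For w = t + iy the quantity Im (wb) - (Im b / Re b) Re (wb) equals y / Re b^-1. Hence the strip
    |y| <= Re b^-1 is exactly where [cabs_csinh_lower] applies. The factor 1 + |t| lets a single
    inequality cover both the simple zero at 0 and the exponential growth at infinity. *)
Lemma csinh_strip_lower (b : C) : 0 < Re b -> exists2 c : R, 0 < c &
  forall t y : R, `|y| <= Re b^-1 ->
    cabs (t +i* y) * expR (Re b * `|t|) <= c * (1 + `|t|) * cabs (csinh ((t +i* y) * b)).
Proof.
move=> b0; set r := Re b^-1; have r0 : 0 < r := Re_inv_gt0 b0.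
set b1 := Re b in b0 *; set b2 := Im b.
have [c1 c10 hc1] := @cabs_csinh_lower R (b2 / b1).
have bb : 0 < cabs b by exact/cabs_gt0/Re_gt0_neq0.
have E0 : 0 < expR (r * `|b2|) :> R := expR_gt0 _.
exists (expR (r * `|b2|) * (2 * (1 + r) + c1 / cabs b)).
  by rewrite mulr_gt0// addr_gt0 ?divr_gt0// mulr_gt0// addr_gt0.
move=> t y hy; set w := t +i* y; set s := cabs (csinh _).
have s0 : 0 <= s := cabs_ge0 _.
have X : Re (w * b) = t * b1 - y * b2 by rewrite cReM.
have Y : Im (w * b) = t * b2 + y * b1 by rewrite cImM.
have w1 : cabs w <= c1 / cabs b * s.
  rewrite mulrAC ler_pdivlMr// -cabsM; apply: hc1; rewrite X Y.
  rewrite (_ : _ - _ = y / r); last first.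
    rewrite /r Re_inv -/b1 -/b2; field; rewrite !gt_eqF//.
    by rewrite ltr_pwDl ?sqr_ge0// exprn_gt0.
  by rewrite normrM normfV (gtr0_norm r0) ler_pdivrMr// mul1r.
have w2 : cabs w <= `|t| + r.
  by rewrite (le_trans (ler_cabs_ReIm _))// lerD2l.
have e1 : expR (b1 * `|t|) <= expR (r * `|b2|) * (2 * s + 1).
  apply: (@le_trans _ _ (expR (r * `|b2|) * expR `|t * b1 - y * b2|)).
    rewrite -expRD ler_expR.
    have : `|t * b1| <= `|t * b1 - y * b2| + `|y * b2|.
      by rewrite -{1}(subrK (y * b2) (t * b1)) ler_normD.
    rewrite !normrM (gtr0_norm b0) => h.
    have : `|y| * `|b2| <= r * `|b2| by rewrite ler_wpM2r.
    by rewrite mulrC; lra.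
  by rewrite ler_wpM2l ?(ltW E0)// -X; exact: cabs_csinh_ge.
rewrite (le_trans (ler_wpM2l (cabs_ge0 _) e1))// mulrCA -!mulrA ler_wpM2l ?(ltW E0)//.
have t0 := normr_ge0 t; have cb : 0 < c1 / cabs b by rewrite divr_gt0.
have h1 : cabs w * (2 * s) <= (`|t| + r) * (2 * s) by rewrite ler_wpM2r// mulr_ge0.
rewrite mulrDr mulr1; set u := c1 / cabs b in w1 cb *.
have uu := ltW cb; have rr := ltW r0.
have h2 : 0 <= s * (u * `|t|) := mulr_ge0 s0 (mulr_ge0 uu t0).
have h3 : 0 <= s * r * `|t| := mulr_ge0 (mulr_ge0 s0 rr) t0.
nra.
Qed.

Lemma poly_exp_le (n : nat) (d : R) : 0 < d -> exists2 K : R, 0 < K &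
  forall t, 0 <= t -> (1 + t) ^+ n <= K * expR (d * t).
Proof.
(* Dividing by n + 1 instead of n includes n = 0. *)
move=> d0; pose e := d / n.+1%:R; have e0 : 0 < e by rewrite divr_gt0.
have K0 : 0 < 1 + e^-1 by rewrite addr_gt0// invr_gt0.
exists ((1 + e^-1) ^+ n); first by rewrite exprn_gt0.
move=> t t0; have h1 : 1 + t <= (1 + e^-1) * expR (e * t).
  rewrite (@le_trans _ _ ((1 + e^-1) * (1 + e * t)))//; last by rewrite ler_wpM2l ?expR_ge1Dx// (ltW K0).
  rewrite mulrDl mul1r mulrDr mulr1 mulrA mulVf ?gt_eqF// mul1r.
  have : 0 <= e * t by rewrite mulr_ge0// (ltW e0).
  have : 0 < e^-1 by rewrite invr_gt0.
  lra.
rewrite (@le_trans _ _ ((1 + e^-1) ^+ n * expR (e * t) ^+ n))//.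
  by rewrite -exprMn lerXn2r ?nnegrE ?mulr_ge0 ?expR_ge0 ?addr_ge0 ?invr_ge0 ?(ltW e0).
rewrite -expRM_natl ler_wpM2l ?exprn_ge0 ?(ltW K0)// ler_expR mulrA ler_wpM2r//.
by rewrite /e mulrCA ler_piMr ?(ltW d0)// ler_pdivrMr// mul1r ler_nat.
Qed.

Definition dilog_den (b w : C) := csinh (w * b) * csinh (w / b) * w.

Definition dilog_height (b : C) := Num.min (Re b) (Re b^-1).

Lemma Re_eta (b : C) : Re (eta b) = (Re b + Re b^-1) / 2.
Proof.
have h2 : (2 : C)^-1 = (2^-1 : R)%:C by rewrite natcE -fmorphV.
have -> : eta b = (2^-1)%:C * (b + b^-1) by rewrite -h2 [RHS]mulrC.
by rewrite cReZ cReD mulrC.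
Qed.

(** The product of the bounds for b and b^-1, whose rates add up to 2 Re eta. The cube records the
    triple zero at 0, and the loss d in the rate absorbs the polynomial factor (1 + |t|)^2. *)
Lemma dilog_den_lower (b : C) (d : R) : 0 < Re b -> 0 < d -> exists2 c : R, 0 < c &
  forall t y : R, `|y| <= dilog_height b ->
    cabs (t +i* y) ^+ 3 * expR ((2 * Re (eta b) - d) * `|t|) <= c * cabs (dilog_den b (t +i* y)).
Proof.
move=> b0 d0; have r0 := Re_inv_gt0 b0.
have [c1 c10 h1] := csinh_strip_lower b0.
have [c2 c20] := csinh_strip_lower r0; rewrite invrK => h2.
have [K K0 hK] := poly_exp_le 2 d0.
exists (c1 * c2 * K) => [|t y]; first by rewrite !mulr_gt0.
rewrite le_min => /andP[/h2 {}h2 /h1 {}h1].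
set w := t +i* y in h1 h2 *.
have := ler_pM _ _ (h1 t) (h2 t).
rewrite ?mulr_ge0 ?cabs_ge0 ?expR_ge0// => /(_ isT isT) h.
have {}hK := hK `|t| (normr_ge0 t).
rewrite Re_eta (_ : (_ - d) * `|t| = Re b * `|t| + Re b^-1 * `|t| - d * `|t|); last first.
  by field.
rewrite !expRD expRN mulrA ler_pdivrMr ?expR_gt0//.
have -> : cabs (dilog_den b w) = cabs (csinh (w * b)) * cabs (csinh (w / b)) * cabs w.
  by rewrite /dilog_den cabsM; congr (_ * _); exact: cabsM.
move: h hK; rewrite -/w; set W := cabs w; set E1 := expR _; set E2 := expR _; set D := expR _.
set S1 := cabs _; set S2 := cabs _; set P := 1 + `|t|.
move=> h hK.
have W0 : 0 <= W := cabs_ge0 _.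
apply: (@le_trans _ _ (c1 * c2 * S1 * S2 * W * P ^+ 2)).
  rewrite (_ : _ ^+ 3 * _ = W * (W * E1 * (W * E2))); last by ring.
  rewrite (_ : _ * P ^+ 2 = W * (c1 * P * S1 * (c2 * P * S2))); last by ring.
  by rewrite ler_wpM2l.
rewrite (_ : c1 * c2 * K * _ * D = c1 * c2 * S1 * S2 * W * (K * D)); last by ring.
by rewrite ler_wpM2l// !mulr_ge0 ?cabs_ge0// ltW.
Qed.

Lemma dilog_height_gt0 (b : C) : 0 < Re b -> 0 < dilog_height b.
Proof. by move=> b0; rewrite lt_min b0 Re_inv_gt0. Qed.

Lemma dilog_den_neq0 (b w : C) : 0 < Re b -> w != 0 ->
  `|Im w| <= dilog_height b -> dilog_den b w != 0.
Proof.
move=> b0 w0 hw; have [c c0 h] := dilog_den_lower b0 ltr01.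
have := h (Re w) (Im w) hw.
rewrite (_ : _ +i* _ = w); last by case: (w).
by apply: contraTneq => ->; rewrite cabs0 mulr0 -ltNge mulr_gt0 ?expR_gt0// exprn_gt0// cabs_gt0.
Qed.

Lemma C1on_id (S : C -> Prop) : C1on S (fun z => z).
Proof.
have := @C1on_affine R S 1 0; rewrite (_ : (fun z => _) = fun z => z)//.
by apply/funext => z; rewrite mul1r addr0.
Qed.

Lemma C1on_csinh (S : C -> Prop) (f : C -> C) : C1on S f -> C1on S (fun z => csinh (f z)).
Proof.
move=> hf; apply: C1onM; last exact: C1on_cst.
apply: C1onD; first exact: C1on_cexp.
by apply: C1onN; apply: C1on_cexp; exact: C1onN.
Qed.

Lemma C1on_dilog_den (S : C -> Prop) (b : C) : C1on S (dilog_den b).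
Proof.
apply: C1onM; last exact: C1on_id.
by apply: C1onM; apply: C1on_csinh; apply: C1onM; [exact: C1on_id|exact: C1on_cst|exact: C1on_id|exact: C1on_cst].
Qed.

Lemma dilog_denN (b w : C) : dilog_den b (- w) = - dilog_den b w.
Proof.
have sN (z : C) : csinh (- z) = - csinh z by rewrite /csinh opprK -mulNr opprB.
by rewrite /dilog_den !mulNr !sN; ring.
Qed.
End DilogKernel.

(** * Holomorphy of log phi in its strip *)

Section DilogIntegral.
Variable R : realType.
Local Notation C := R[i].

Definition dilog_integrand (b z w : C) := cexp (- (2 * 'i * z * w)) / dilog_den b w.

Definition dilog_int (b z : C) :=
  cint (fun t : R => dilog_integrand b z (t +i* dilog_height b)).

Lemma qdilogE (b z : C) : qdilog b z = cexp (4^-1 * dilog_int b z).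
Proof. by []. Qed.

Lemma poly_exp_le_pk (n : nat) (d : R) : 0 < d -> exists2 K : R, 0 < K &
  forall t, (1 + `|t|) ^+ n * expR (- (d * `|t|)) <= K * pk t.
Proof.
move=> d0; have d2 : 0 < d / 2 by rewrite divr_gt0.
have [K1 K10 h1] := poly_exp_le n d2; have [K2 h2] := expR_scale_le_pk d2.
have K20 : 0 < K2 by have := lt_le_trans (expR_gt0 _) (h2 0); rewrite pmulr_lgt0// pk_gt0.
exists (K1 * K2) => [|t]; first exact: mulr_gt0.
rewrite (_ : - (d * `|t|) = - (d / 2 * `|t|) + - (d / 2 * `|t|)); last by field.
rewrite expRD mulrA -[leRHS]mulrA ler_pM ?mulr_ge0 ?expR_ge0 ?exprn_ge0 ?addr_ge0//.
have := h1 `|t| (normr_ge0 t); rewrite -ler_pdivrMr ?expR_gt0// expRN.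
by [].
Qed.

Section Strip.
Variables (b : C) (b0 : 0 < Re b).
Let h := dilog_height b.
Let h0 : 0 < h := dilog_height_gt0 b0.

Lemma C1on_dilog_integrand (z : C) :
  C1on (fun w => w != 0 /\ `|Im w| <= h) (dilog_integrand b z).
Proof.
apply: C1onM.
  apply: C1on_cexp; apply: C1onN; have := @C1on_affine R (fun w => w != 0 /\ `|Im w| <= h) (2 * 'i * z) 0.
  by rewrite (_ : (fun w => _) = (fun w => 2 * 'i * z * w))//; apply/funext => w; rewrite addr0.
apply: C1onV; first exact: C1on_dilog_den.
by move=> w [w0 hw]; exact: dilog_den_neq0.
Qed.

Lemma contour_neq0 (t y : R) : 0 < y -> t +i* y != 0.
Proof. by move=> y0; apply/eqP => /(congr1 (@complex.Im R)) /= /eqP; rewrite gt_eqF. Qed.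

Lemma scont_contour (f : C -> C) : C1on (fun w => w != 0 /\ `|Im w| <= h) f ->
  scont (fun t => f (t +i* h)).
Proof.
move=> hf; apply: (scont_line (C1on_cont hf)) => x; split; first exact: contour_neq0.
by rewrite /= gtr0_norm.
Qed.

Lemma cabs_cexp_phase (x v t y : R) :
  cabs (cexp (- (2 * 'i * (x +i* v) * (t +i* y)))) = expR (2 * (x * y + v * t)).
Proof.
rewrite cabs_cexp natcE; congr expR.
by rewrite !(cReN, cReM, cImM) /=; ring.
Qed.

(** The phase grows at most at rate 2 v0 while the denominator grows at rate 2 Re eta; half of the
    margin 2 (Re eta - v0) is given to the polynomial loss. The separate factor e^(2xh) is what
    bounds phi for x <= 0. *)
Lemma dilog_integrand_bound (v0 : R) : v0 < Re (eta b) ->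
  exists2 K : R, 0 < K & forall x v t : R, `|v| <= v0 ->
    cabs (dilog_integrand b (x +i* v) (t +i* h)) <=
      expR (2 * (x * h)) * (K * expR (- ((Re (eta b) - v0) * `|t|))).
Proof.
move=> hv; set e1 := Re (eta b) in hv *.
have d0 : 0 < e1 - v0 by rewrite subr_gt0.
have [c c0 hc] := dilog_den_lower b0 d0.
exists (c / h ^+ 3) => [|x v t vv]; first by rewrite divr_gt0// exprn_gt0.
have hh : `|h| <= dilog_height b by rewrite gtr0_norm.
have := hc t h hh; rewrite -/e1; set w := t +i* h => hw.
have wh : h <= cabs w by rewrite (le_trans _ (ler_Im_cabs _))//= ler_norm.
have D0 : 0 < cabs (dilog_den b w).
  by apply: cabs_gt0; apply: dilog_den_neq0 => //; exact: contour_neq0.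
rewrite cabsM cabsV cabs_cexp_phase ler_pdivrMr// mulrDr expRD -!mulrA ler_wpM2l ?expR_ge0//.
have h3 : h ^+ 3 * expR ((2 * e1 - (e1 - v0)) * `|t|) <= c * cabs (dilog_den b w).
  rewrite (le_trans _ hw)// ler_wpM2r ?expR_ge0// lerXn2r// nnegrE ?cabs_ge0//.
  exact: ltW.
rewrite (_ : c * _ = (c * cabs (dilog_den b w)) / h ^+ 3 * expR (- ((e1 - v0) * `|t|))); last by ring.
rewrite expRN ler_pdivlMr ?expR_gt0// ler_pdivlMr ?exprn_gt0//.
rewrite (le_trans _ h3)// mulrC ler_wpM2l ?exprn_ge0 ?(ltW h0)// -expRD ler_expR.
have : v * t <= v0 * `|t| by rewrite (le_trans (ler_norm _))// normrM ler_wpM2r.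
by lra.
Qed.

(** Differentiation under the integral: the second-order Taylor bound for the exponential makes the
    remainder quadratic in k, with an integrable majorant that does not depend on k. *)
Lemma C1on_dilog_int (v0 : R) : v0 < Re (eta b) ->
  C1on (fun z => `|Im z| <= v0) (dilog_int b).
Proof.
move=> hv; have [K K0 hK] := dilog_integrand_bound hv.
set d := _ - v0 in hK; have d0 : 0 < d by rewrite subr_gt0.
pose D z w := - (2 * 'i * w) * dilog_integrand b z w.
pose A := 1 + h; have A0 : 0 < A by rewrite addr_gt0.
have wA (t : R) : cabs (t +i* h) <= A * (1 + `|t|).
  rewrite (le_trans (ler_cabs_ReIm _))//= (gtr0_norm h0) /A mulrDl mul1r mulrDr mulr1.
  have : 0 <= h * `|t| by rewrite mulr_ge0// ltW.
  lra.
have [K1 K10 hK1] := poly_exp_le_pk 1 d0.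
have GC z := C1on_dilog_integrand z.
have DC z : C1on (fun w => w != 0 /\ `|Im w| <= h) (D z).
  apply: C1onM => //; apply: C1onN; have := @C1on_affine R (fun w => w != 0 /\ `|Im w| <= h) (2 * 'i) 0.
  by rewrite (_ : (fun w => _) = (fun w => 2 * 'i * w))//; apply/funext => w; rewrite addr0.
have DB (x v t : R) : `|v| <= v0 -> cabs (D (x +i* v) (t +i* h)) <= expR (2 * (x * h)) * (2 * A * K * K1) * pk t.
  move=> vv; rewrite [cabs _]cabsM; set G := cabs (dilog_integrand _ _ _).
  rewrite cabsN !cabsM cabs_nat cabs_i mulr1.
  have hG : G <= _ := hK x v t vv.
  have h2w : 2 * cabs (t +i* h) <= 2 * (A * (1 + `|t|)) by rewrite ler_wpM2l.
  rewrite (le_trans (ler_pM _ _ h2w hG))// ?mulr_ge0 ?cabs_ge0//.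
  set E := expR (- (d * `|t|)); set F := expR (2 * (x * h)).
  rewrite [leLHS](_ : _ = F * (2 * A * K) * ((1 + `|t|) * E)); last by ring.
  rewrite [leRHS](_ : _ = F * (2 * A * K) * (K1 * pk t)); last by ring.
  have := hK1 t; rewrite expr1 => hK1t.
  by rewrite ler_wpM2l// mulr_ge0 ?expR_ge0// ?mulr_ge0// ltW.
have GB (x v t : R) : `|v| <= v0 -> cabs (dilog_integrand b (x +i* v) (t +i* h)) <= expR (2 * (x * h)) * (K * K1) * pk t.
  move=> vv; rewrite (le_trans (hK _ _ _ vv))// -[leRHS]mulrA ler_wpM2l ?expR_ge0//.
  rewrite -[leRHS]mulrA ler_wpM2l ?(ltW K0)// (le_trans _ (hK1 t))// ler_peMl ?expR_ge0//.
  by rewrite expr1 lerDl.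
have eB (B : R) (x : R) : x <= B -> expR (2 * (x * h)) <= expR (2 * (B * h)).
  by move=> xB; rewrite ler_expR ler_wpM2l// ler_wpM2r// ltW.
exists (fun z => cint (fun t : R => D z (t +i* h))); split=> [[x v] /= vv|u z Su Sz uz]; last first.
  (* The majorant contains e^(2xh), so it is uniform along [u] only because the real parts of a
     convergent sequence are bounded. *)
  have [B hB] : exists B, forall n, Re (u n) <= B.
    have /ccvgP[/cvgP/cvg_seq_bounded[B [_ hB]] _] := uz.
    exists (B + 1) => n; have := hB (B + 1); rewrite ltrDl ltr01 => /(_ isT n I) /=.
    by apply: le_trans; exact: ler_norm.
  apply: (@cint_cvg _ _ _ (expR (2 * (B * h)) * (2 * A * K * K1))).
  - by move=> n; apply: scont_cmeas; exact: scont_contour.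
  - by apply: scont_cmeas; exact: scont_contour.
  - move=> n t; have := DB (Re (u n)) (Im (u n)) t (Su n).
    rewrite (_ : _ +i* _ = u n); last by case: (u n).
    move/le_trans; apply; rewrite ler_wpM2r ?pk_ge0// ler_wpM2r ?eB//.
    by rewrite !mulr_ge0 ?ltW.
  - move=> t _; apply: ccvgM; first exact: ccvg_cst.
    apply: ccvgM; last exact: ccvg_cst.
    apply: ccvg_cexp; apply: ccvgN; apply: ccvgM; last exact: ccvg_cst.
    by apply: ccvgM; [exact: ccvg_cst|exact: uz].
set z := x +i* v.
have d2 : 0 < d / 2 by rewrite divr_gt0.
have [K2 K20 hK2] := poly_exp_le_pk 2 d2.
pose L := expR (2 * (x * h)) * (16 * A ^+ 2 * K * expR (d / 2) * K2).
have L0 : 0 < L by rewrite !mulr_gt0 ?expR_gt0// exprn_gt0.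
pose Df k t := dilog_integrand b (z + k) (t +i* h) - dilog_integrand b z (t +i* h) - k * D z (t +i* h).
(* Below this radius the exponential factor of the Taylor bound, e^(2 |k| |w|), costs at most half
   of the decay rate d. *)
have diff (k : C) : cabs k < d / (4 * A) -> pk_bounded (Df k) (cabs k ^+ 2 * L).
  move=> kd t; set w := t +i* h; set zeta := - (2 * 'i * k * w).
  have k0 := cabs_ge0 k; have t0 : 0 <= 1 + `|t| by rewrite addr_ge0.
  rewrite (_ : Df k t = dilog_integrand b z w * (cexp zeta - 1 - zeta)); last first.
    rewrite /Df -/w /D /dilog_integrand /zeta.
    rewrite (_ : - (2 * 'i * (z + k) * w) = - (2 * 'i * z * w) + - (2 * 'i * k * w)); last by ring.
    by rewrite cexpD; ring.
  have zA : cabs zeta <= 2 * cabs k * (A * (1 + `|t|)).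
    by rewrite cabsN !cabsM cabs_nat cabs_i mulr1 ler_wpM2l ?mulr_ge0 ?cabs_ge0//; exact: wA.
  have z2 : 4 * cabs zeta ^+ 2 <= 16 * (cabs k ^+ 2 * A ^+ 2 * (1 + `|t|) ^+ 2).
    rewrite (_ : 16 * _ = 4 * (2 * cabs k * (A * (1 + `|t|))) ^+ 2); last by ring.
    by rewrite ler_wpM2l// lerXn2r ?nnegrE ?cabs_ge0// !mulr_ge0// ltW.
  have z3 : expR (cabs zeta) <= expR (d / 2) * expR (d / 2 * `|t|).
    rewrite -expRD ler_expR (le_trans zA)// [leRHS](_ : _ = d / 2 * (1 + `|t|)); last by ring.
    rewrite mulrA ler_wpM2r// ; move: kd; rewrite ltr_pdivlMr ?mulr_gt0// => kd.
    by rewrite ler_pdivlMr// (le_trans _ (ltW kd))// le_eqVlt; apply/orP; left; apply/eqP; ring.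
  have R0 := le_trans (cexp_taylor2 zeta) (ler_pM (mulr_ge0 (ler0n _ 4) (sqr_ge0 _)) (expR_ge0 _) z2 z3).
  rewrite cabsM (le_trans (ler_pM (cabs_ge0 _) (cabs_ge0 _) (hK x v t vv) R0))//.
  rewrite (_ : - (d * `|t|) = - (d / 2 * `|t|) + - (d / 2 * `|t|)); last by field.
  rewrite expRD; have ee : expR (- (d / 2 * `|t|)) * expR (d / 2 * `|t|) = 1 by rewrite mulrC expRxMexpNx_1.
  set E1 := expR (- (d / 2 * `|t|)) in ee *; set E2 := expR (d / 2 * `|t|) in ee *.
  rewrite (_ : _ * _ * (_ * _) = expR (2 * (x * h)) * cabs k ^+ 2 * (16 * A ^+ 2 * K * expR (d / 2)) * ((1 + `|t|) ^+ 2 * E1) * (E1 * E2)); last by ring.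
  rewrite ee mulr1 (_ : _ * L * pk t = expR (2 * (x * h)) * cabs k ^+ 2 * (16 * A ^+ 2 * K * expR (d / 2)) * (K2 * pk t)); last by rewrite /L; ring.
  by rewrite ler_wpM2l// !mulr_ge0 ?expR_ge0 ?exprn_ge0 ?cabs_ge0 ?(ltW A0) ?(ltW K0).
have sDf k : scont (Df k).
  move=> u l ul; apply: ccvgB; first apply: ccvgB.
  - exact: (scont_contour (GC (z + k))).
  - exact: (scont_contour (GC z)).
  - by apply: ccvgM; [exact: ccvg_cst|exact: (scont_contour (DC z))].
have nG : nice (fun t => dilog_integrand b z (t +i* h)).
  by apply: (niceI (scont_contour (GC z))) => t; exact: GB.
have nD : nice (fun t => D z (t +i* h)).
  by apply: (niceI (scont_contour (DC z))) => t; exact: DB.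
have pL : 0 < 2 * pi * L := mulr_gt0 (mulr_gt0 (ltr0n _ 2) (pi_gt0 R)) L0.
have pA : 0 < 4 * A := mulr_gt0 (ltr0n _ 4) A0.
move=> e e0; exists (Num.min (d / (4 * A)) (e / (2 * pi * L))) => [|k].
  by rewrite lt_min (divr_gt0 d0 pA) (divr_gt0 e0 pL).
rewrite lt_min => /andP[k1 k2].
have nDf : nice (Df k) := niceI (sDf k) (diff k k1).
have E : dilog_int b (z + k) - dilog_int b z - k * cint (fun t : R => D z (t +i* h)) = cint (Df k).
  have -> : dilog_int b (z + k) = cint (fun t => Df k t + (dilog_integrand b z (t +i* h) + k * D z (t +i* h))).
    by apply: eq_cint => t; rewrite /Df -/h; ring.
  rewrite (cintD nDf (niceD nG (niceZ k nD))) (cintD nG (niceZ k nD)) (cintZ k nD).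
  by rewrite -/(dilog_int b z); ring.
rewrite E (le_trans (cabs_cint (scont_cmeas (sDf k)) (diff k k1))) //.
rewrite [leLHS](_ : _ = cabs k * (2 * pi * L) * cabs k); last by ring.
by rewrite ler_wpM2r ?cabs_ge0// -ler_pdivlMr// ltW.
Qed.
End Strip.
End DilogIntegral.

(** * Odd integrands on the contour and the cosine remainder *)

Section DilogGrowth.
Variable R : realType.
Local Notation C := R[i].
Variables (b : C) (b0 : 0 < Re b).
Let h := dilog_height b.
Let h0 : 0 < h := dilog_height_gt0 b0.

(** The bound holds right up to 0, so the contour can be lowered to heights tending to 0. Folding t
    to -t, the sum of the two values tends to H(t) + H(-t) = 0 for t <> 0, and twice the integral is
    0 by dominated convergence. *)
Lemma cint_odd_contour (H : C -> C) (K : R) : (forall w, H (- w) = - H w) ->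
  C1on (fun w => w != 0 /\ `|Im w| <= h) H ->
  (forall t y : R, `|y| <= h -> t +i* y != 0 -> cabs (H (t +i* y)) <= K * pk t) ->
  cint (fun t : R => H (t +i* h)) = 0.
Proof.
move=> oH hH HK; set J := cint _.
pose e (n : nat) : R := h * n.+1%:R^-1.
have e0 n : 0 < e n by rewrite mulr_gt0// invr_gt0.
have eh n : e n <= h by rewrite ler_piMr ?(ltW h0)// invf_le1// ler1n.
have ein n y : e n <= y <= h -> `|y| <= h /\ 0 < y.
  by move=> /andP[y1 y2]; have y0 := lt_le_trans (e0 n) y1; rewrite gtr0_norm.
have nz n (t y : R) : e n <= y <= h -> t +i* y != 0 by move=> /ein[_]; exact: contour_neq0.
have eb n : e n <= e n <= h by rewrite lexx eh.
have hb n : e n <= h <= h by rewrite lexx eh.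
have sc n : scont (fun t => H (t +i* e n)).
  apply: (scont_line (C1on_cont hH)) => x; split; first exact: nz (eb n).
  by have [] := ein n _ (eb n).
have bd n : pk_bounded (fun t => H (t +i* e n)) K.
  by move=> t; apply: HK; [have [] := ein n _ (eb n)|exact: nz (eb n)].
have JE n : J = cint (fun t => H (t +i* e n)).
  symmetry; apply: (cint_strip_shift (eh n) (M := K)).
    apply: C1onS hH => -[t y] /= yy; split; first exact: nz yy.
    by have [] := ein n _ yy.
  by move=> t y yy; apply: HK; [have [] := ein n _ yy|exact: nz yy].
have sc2 n : scont (fun t => H ((0 - t) +i* e n)).
  by move=> u l ul; apply: (sc n (fun k => 0 - u k)); apply: cvgB => //; exact: cvg_cst.
have bd2 n : pk_bounded (fun t => H ((0 - t) +i* e n)) K.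
  by move=> t; have := bd n (0 - t); rewrite sub0r pkN.
have JJ n : J + J = cint (fun t => H (t +i* e n) + H ((0 - t) +i* e n)).
  rewrite (cintD (niceI (sc n) (bd n)) (niceI (sc2 n) (bd2 n))) (JE n); congr (_ + _).
  by rewrite (cint_refl 0 (niceI (sc n) (bd n))).
have l0 : ccvg (fun n => cint (fun t => H (t +i* e n) + H ((0 - t) +i* e n))) (cint (fun=> 0)).
  apply: (@cint_cvg _ _ _ (K + K)).
  - by move=> n; apply: scont_cmeas => u l ul; apply: ccvgD; [exact: sc|exact: sc2].
  - by apply: scont_cmeas => u l ul; exact: ccvg_cst.
  - by move=> n t; rewrite (le_trans (ler_cabsD _ _))// mulrDl lerD//; [exact: bd|exact: bd2].
  - move=> t t0; have t0' : t%:C != 0 by apply: contra_neq t0 => /(congr1 (@complex.Re R)).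
    rewrite -(subrr (H t%:C)) -oH.
    have ce : e @ \oo --> (0 : R).
      rewrite -[0](mulr0 h); apply: cvgM; [exact: cvg_cst|exact: cvg_harmonic].
    apply: ccvgD.
      apply: (C1on_cont hH (u := fun n => t +i* e n)).
      - by move=> n; split; [exact: nz (eb n)|have [] := ein n _ (eb n)].
      - by split => //=; rewrite normr0 ltW.
      - by apply/ccvgP; split => //=; exact: cvg_cst.
    apply: (C1on_cont hH (u := fun n => (0 - t) +i* e n)).
    - by move=> n; split; [exact: nz (eb n)|have [] := ein n _ (eb n)].
    - by split; [rewrite oppr_eq0|rewrite /= oppr0 normr0 ltW].
    - by apply/ccvgP; split => /=; rewrite ?sub0r ?oppr0; [exact: cvg_cst|].
have l1 : ccvg (fun n : nat => J + J) (cint (fun=> 0)).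
  by rewrite (_ : (fun n => J + J) = (fun n => cint (fun t => H (t +i* e n) + H ((0 - t) +i* e n))))//; apply/funext.
have := ccvg_unique l1 (ccvg_cst _); rewrite cint0 -mulr2n -mulr_natl => /esym/eqP.
by rewrite mulf_eq0 pnatr_eq0 /= => /eqP.
Qed.

Lemma dilog_integrand_le_pk (v0 : R) : v0 < Re (eta b) ->
  exists2 K : R, 0 < K & forall x v t : R, `|v| <= v0 ->
    cabs (dilog_integrand b (x +i* v) (t +i* h)) <= expR (2 * (x * h)) * K * pk t.
Proof.
move=> hv; have [K K0 hK] := dilog_integrand_bound b0 hv.
have d0 : 0 < Re (eta b) - v0 by rewrite subr_gt0.
have [K1 K10 hK1] := poly_exp_le_pk 0 d0.
exists (K * K1) => [|x v t vv]; first exact: mulr_gt0.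
rewrite (le_trans (hK _ _ _ vv))// -[leRHS]mulrA ler_wpM2l ?expR_ge0//.
rewrite -[leRHS]mulrA ler_wpM2l ?(ltW K0)//.
by have := hK1 t; rewrite expr0 mul1r.
Qed.

(* Taylor expansion near w = 0, trivial bounds elsewhere. *)
Lemma cosh_remainder_bound (z : C) (v0 : R) : `|Im z| <= v0 -> exists2 M : R, 0 < M &
  forall w : C, `|Im w| <= h ->
    cabs (cexp (- (2 * 'i * z * w)) + cexp (2 * 'i * z * w) - 2 - (2 * 'i * z * w) ^+ 2) <=
      M * (cabs w ^+ 3 * expR (2 * v0 * `|Re w|)).
Proof.
move=> vv; pose x := Re z; pose v := Im z.
have zE : z = x +i* v by rewrite /x /v; case: (z).
have v00 : 0 <= v0 := le_trans (normr_ge0 _) vv.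
(* [M1] serves |w| <= 1, with 128 = 2 * 8 * 2^3 from two third-order Taylor bounds at modulus 2 |z|
   |w|; [M2] serves |w| > 1 and bounds the terms one by one. *)
pose M1 := 128 * cabs z ^+ 3 * expR (2 * cabs z); pose M2 := 2 * expR (2 * (`|x| * h)) + 2 + 4 * cabs z ^+ 2.
have M10 : 0 <= M1 by rewrite !mulr_ge0 ?expR_ge0 ?exprn_ge0 ?cabs_ge0.
have M20 : 0 < M2 by rewrite ltr_pwDl ?mulr_ge0 ?exprn_ge0 ?cabs_ge0// addr_gt0// mulr_gt0// expR_gt0.
exists (M1 + M2) => [|w hy]; first by rewrite ltr_wpDl.
pose zeta := - (2 * 'i * z * w); rewrite -[2 * 'i * z * w]opprK -/zeta opprK sqrrN.
pose t := Re w; pose y := Im w.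
have wE : w = t +i* y by rewrite /t /y; case: (w).
rewrite -/t.
have E1 : 1 <= expR (2 * v0 * `|t|) by rewrite -expR0 ler_expR !mulr_ge0.
have cz : cabs zeta = 2 * cabs z * cabs w.
  by rewrite cabsN !cabsM cabs_nat cabs_i mulr1.
have z0 := cabs_ge0 z; have w0 := cabs_ge0 w.
have [w1|w1] := leP (cabs w) 1.
  rewrite (_ : _ - _ = (cexp zeta - 1 - zeta - zeta ^+ 2 / 2) + (cexp (- zeta) - 1 - - zeta - (- zeta) ^+ 2 / 2)); last by field.
  have h1 := cexp_taylor3 zeta; have := cexp_taylor3 (- zeta); rewrite cabsN => h2.
  rewrite (le_trans (ler_cabsD _ _))// (le_trans (lerD h1 h2))//.
  have e2 : expR (cabs zeta) <= expR (2 * cabs z) by rewrite ler_expR cz ler_piMr// mulr_ge0.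
  apply: (@le_trans _ _ (M1 * cabs w ^+ 3)).
    rewrite [leRHS](_ : _ = 16 * (2 * cabs z * cabs w) ^+ 3 * expR (2 * cabs z)); last by rewrite /M1; ring.
    rewrite -cz [leLHS](_ : _ = 16 * cabs zeta ^+ 3 * expR (cabs zeta)); last by ring.
    by rewrite ler_wpM2l// mulr_ge0// exprn_ge0// cabs_ge0.
  rewrite mulrA; apply: (@le_trans _ _ ((M1 + M2) * cabs w ^+ 3)).
    by rewrite ler_wpM2r ?exprn_ge0// lerDl ltW.
  by rewrite ler_peMr// mulr_ge0 ?exprn_ge0// addr_ge0// ltW.
have h1 : cabs (cexp zeta) <= expR (2 * (`|x| * h)) * expR (2 * v0 * `|t|).
  rewrite /zeta zE wE cabs_cexp_phase -expRD ler_expR -mulrA -mulrDr ler_wpM2l//.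
  rewrite (le_trans (ler_norm _))// (le_trans (ler_normD _ _))// !normrM lerD//.
    by rewrite ler_wpM2l.
  by rewrite ler_wpM2r.
have h2 : cabs (cexp (- zeta)) <= expR (2 * (`|x| * h)) * expR (2 * v0 * `|t|).
  rewrite (_ : - zeta = - (2 * 'i * z * ((- t) +i* (- y)))); last first.
    by rewrite (_ : _ +i* _ = - w) ?wE// /zeta wE; ring.
  rewrite zE cabs_cexp_phase -expRD ler_expR -mulrA -mulrDr ler_wpM2l//.
  rewrite (le_trans (ler_norm _))// (le_trans (ler_normD _ _))// !normrM !normrN lerD//.
    by rewrite ler_wpM2l.
  by rewrite ler_wpM2r.
have w3 : 1 <= cabs w ^+ 3 by rewrite exprn_ege1// ltW.
have w23 : cabs w ^+ 2 <= cabs w ^+ 3 by rewrite ler_weXn2l// ltW.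
set E := expR (2 * v0 * `|t|) in E1 h1 h2 *; set F := expR (2 * (`|x| * h)) in h1 h2 *.
set W3 := cabs w ^+ 3 in w3 w23 *.
have F0 : 0 < F by exact: expR_gt0.
have WE : E <= W3 * E by rewrite ler_peMl// (le_trans _ E1).
have a1 : 1 <= W3 * E by rewrite (le_trans E1).
have a2 : cabs w ^+ 2 <= W3 * E by rewrite (le_trans w23)// ler_peMr// (le_trans _ w3).
apply: (@le_trans _ _ (M2 * (W3 * E))); last first.
  by rewrite ler_wpM2r ?lerDr// (le_trans _ a1).
rewrite (le_trans (ler_cabsB _ _))// /M2 2!mulrDl lerD//; last first.
  by rewrite cabsX cz (_ : _ ^+ 2 = 4 * cabs z ^+ 2 * cabs w ^+ 2) ?ler_wpM2l ?mulr_ge0 ?exprn_ge0//; ring.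
rewrite (le_trans (ler_cabsB _ _))// lerD ?cabs_nat ?ler_peMr//.
rewrite (le_trans (ler_cabsD _ _))// -mulrA mulr_natl mulr2n lerD//.
  by rewrite (le_trans h1)// ler_wpM2l// ltW.
by rewrite (le_trans h2)// ler_wpM2l// ltW.
Qed.
End DilogGrowth.

(** * Vanishing of the even remainder and the real part of the second moment *)

Section DilogReflection.
Variable R : realType.
Local Notation C := R[i].
Variables (b : C) (b0 : 0 < Re b).
Let h := dilog_height b.
Let h0 : 0 < h := dilog_height_gt0 b0.
Let off0 (w : C) := w != 0 /\ `|Im w| <= h.

(** Since Re b * Re b^-1 <= 1, the smaller factor is at most 1. This keeps the strip away from the
    poles 2i and -2i of [pole_model]. *)
Lemma dilog_height_le1 : h <= 1.
Proof.
rewrite /h /dilog_height Re_inv; have [b1|b1] := leP (Re b) 1; first by rewrite ge_min b1.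
rewrite ge_min; apply/orP; right; rewrite ler_pdivrMr; last by rewrite ltr_pwDl ?sqr_ge0// exprn_gt0.
rewrite mul1r (@le_trans _ _ (Re b ^+ 2)) ?lerDl ?sqr_ge0//.
by rewrite expr2 ler_peMl ?ltW.
Qed.

Lemma inv_dilog_den_bound (d : R) : 0 < d -> exists2 c : R, 0 < c & forall w : C, off0 w ->
  cabs w ^+ 3 * cabs (dilog_den b w)^-1 <= c * expR (- ((2 * Re (eta b) - d) * `|Re w|)).
Proof.
move=> d0; have [c c0 hc] := dilog_den_lower b0 d0; exists c => // w [w0 hw].
have := hc (Re w) (Im w) hw; rewrite (_ : _ +i* _ = w); last by case: (w).
have D0 : 0 < cabs (dilog_den b w) by apply/cabs_gt0; exact: dilog_den_neq0.
rewrite cabsV expRN; set E := expR _; have E0 : 0 < E := expR_gt0 _.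
by move=> hE; rewrite ler_pdivrMr// [leRHS]mulrAC ler_pdivlMr.
Qed.

(** An even numerator over an odd denominator is odd, and the subtracted Taylor terms make the
    numerator small enough to compensate the triple zero. *)
Lemma dilog_cosh_remainder_eq0 (z : C) : `|Im z| < Re (eta b) ->
  cint (fun t : R => let w := t +i* h in
    (cexp (- (2 * 'i * z * w)) + cexp (2 * 'i * z * w) - 2 - (2 * 'i * z * w) ^+ 2) / dilog_den b w) = 0.
Proof.
pose v0 : R := `|Im z|; pose e1 : R := Re (eta b).
rewrite -/v0 -/e1 => zv.
have d0 : 0 < e1 - v0 by rewrite subr_gt0.
have [M M0 hM] := @cosh_remainder_bound R b z v0 (lexx _).
have [c c0 hc] := inv_dilog_den_bound d0.
have [K K0 hK] := poly_exp_le_pk 0 d0.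
pose H w := (cexp (- (2 * 'i * z * w)) + cexp (2 * 'i * z * w) - 2 - (2 * 'i * z * w) ^+ 2) / dilog_den b w.
have CL (a : C) : C1on off0 (fun w => a * w).
  by have := @C1on_affine R off0 a 0; rewrite (_ : (fun w => _) = (fun w => a * w))//; apply/funext => w; rewrite addr0.
apply: (@cint_odd_contour R b b0 H (M * c * K)).
- move=> w; rewrite /H dilog_denN invrN !mulrN opprK sqrrN; congr (- (_ * _)); ring.
- apply: C1onM; last first.
    by apply: C1onV; [exact: C1on_dilog_den|move=> w [w0 hw]; exact: dilog_den_neq0].
  apply: C1onD; last by apply: C1onN; rewrite (_ : (fun z0 => _) = (fun w => (2 * 'i * z * w) * (2 * 'i * z * w))); [exact: C1onM|apply/funext => w; rewrite expr2].
  apply: C1onD; last exact: C1on_cst.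
  by apply: C1onD; apply: C1on_cexp => //; apply: C1onN.
- move=> t y hy w0; set w := t +i* y in w0 *; have hw : off0 w by split.
  rewrite cabsM (le_trans (ler_wpM2r (cabs_ge0 _) (hM w hy)))//.
  have := hc w hw; rewrite -/e1 [Re w]/=.
  set W := cabs w ^+ 3; set D := cabs _^-1; set E := expR (2 * v0 * `|t|) => hW.
  have {}hK := hK t; rewrite expr0 mul1r in hK.
  have EE : E * expR (- ((2 * e1 - (e1 - v0)) * `|t|)) = expR (- ((e1 - v0) * `|t|)).
    by rewrite /E -expRD; congr expR; ring.
  rewrite [leLHS](_ : _ = M * E * (W * D)); last by ring.
  rewrite (le_trans (ler_wpM2l _ hW))//; first by rewrite mulr_ge0 ?expR_ge0// ltW.
  rewrite [leLHS](_ : _ = M * c * (E * expR (- ((2 * e1 - (e1 - v0)) * `|t|)))); last by ring.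
  by rewrite EE -[leRHS]mulrA ler_wpM2l// mulr_ge0// ltW.
Qed.

Lemma cabs_csinh_le (a w : C) : cabs w <= 1 ->
  cabs (csinh (w * a) - w * a) <= 4 * cabs a ^+ 2 * expR (cabs a) * cabs w ^+ 2.
Proof.
move=> w1; rewrite (le_trans (csinh_taylor2 _))// cabsM exprMn.
rewrite [leRHS](_ : _ = 4 * (cabs w ^+ 2 * cabs a ^+ 2) * expR (cabs a)); last by ring.
rewrite ler_wpM2l ?mulr_ge0 ?exprn_ge0 ?cabs_ge0// ler_expR.
by rewrite ler_piMl ?cabs_ge0.
Qed.

(** Because b * b^-1 = 1, the denominator is w^3 (1 + O(w)) whatever b is; the pole of the quotient
    has the real residue 1. *)
Lemma dilog_den_pole : exists2 k : R, 0 < k & forall w : C, off0 w -> cabs w <= 1 ->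
  cabs (w ^+ 2 / dilog_den b w - w^-1) <= k.
Proof.
have e0 : 0 < Re (eta b) by rewrite Re_eta divr_gt0// addr_gt0// Re_inv_gt0.
have [c c0 hc] := inv_dilog_den_bound e0.
pose q (a : C) := 4 * cabs a ^+ 2 * expR (cabs a).
have q0 a : 0 <= q a by rewrite !mulr_ge0 ?expR_ge0 ?exprn_ge0 ?cabs_ge0.
exists ((q b * (q b^-1 + cabs b^-1) + cabs b * q b^-1) * c + 1).
  by rewrite ltr_wpDl// mulr_ge0 ?(ltW c0)// addr_ge0 ?mulr_ge0 ?addr_ge0 ?cabs_ge0.
move=> w hw w1; have [w0 wh] := hw.
have D0 : dilog_den b w != 0 by exact: dilog_den_neq0.
have W0 : 0 <= cabs w := cabs_ge0 w.
have bn0 : b != 0 := Re_gt0_neq0 b0.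
set s1 := csinh (w * b) - w * b; set s2 := csinh (w * b^-1) - w * b^-1.
have h1 : cabs s1 <= q b * cabs w ^+ 2 by exact: cabs_csinh_le.
have h2 : cabs s2 <= q b^-1 * cabs w ^+ 2 by exact: cabs_csinh_le.
have E : w ^+ 2 / dilog_den b w - w^-1 = - ((s1 * (s2 + w * b^-1) + w * b * s2) / dilog_den b w).
  set N := s1 * _ + _.
  have den : dilog_den b w = (N + w ^+ 2) * w.
    rewrite (_ : N + w ^+ 2 = (s1 + w * b) * (s2 + w * b^-1)); last by rewrite /N; field.
    by rewrite /s1 /s2 !subrK.
  have P0 : N + w ^+ 2 != 0 by apply: contra_neq D0 => P0; rewrite den P0 mul0r.
  by rewrite den; field; rewrite w0 P0.
rewrite E cabsN cabsM.
have := hc w hw; set D := cabs _^-1; set F := expR _ => hD.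
have F1 : F <= 1.
  rewrite /F -[leRHS]expR0 ler_expR oppr_le0 mulr_ge0// (_ : _ - _ = Re (eta b)) ?ltW//.
  by rewrite mulr_natl mulr2n addrK.
have n1 : cabs (s1 * (s2 + w * b^-1)) <= q b * cabs w ^+ 2 * ((q b^-1 + cabs b^-1) * cabs w).
  rewrite cabsM ler_pM ?cabs_ge0// (le_trans (ler_cabsD _ _))// mulrDl lerD//.
    by rewrite (le_trans h2)// ler_wpM2l// expr2 ler_piMl.
  by rewrite cabsM mulrC.
have n2 : cabs (w * b * s2) <= cabs w * cabs b * (q b^-1 * cabs w ^+ 2).
  by rewrite cabsM cabsM ler_wpM2l// mulr_ge0 ?cabs_ge0.
have D00 : 0 <= D := cabs_ge0 _.
rewrite (le_trans (ler_wpM2r D00 (le_trans (ler_cabsD _ _) (lerD n1 n2))))//.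
rewrite [leLHS](_ : _ = (q b * (q b^-1 + cabs b^-1) + cabs b * q b^-1) * (cabs w ^+ 3 * D)); last by ring.
rewrite (@le_trans _ _ ((q b * (q b^-1 + cabs b^-1) + cabs b * q b^-1) * c))//; last by rewrite lerDl.
rewrite ler_wpM2l ?addr_ge0 ?mulr_ge0 ?addr_ge0 ?cabs_ge0//.
by rewrite (le_trans hD)// ler_piMr// ltW.
Qed.

Lemma cabs_4Dsqr (w : C) : `|Im w| <= 1 -> 3 + Re w ^+ 2 <= cabs (4 + w ^+ 2).
Proof.
move=> wh; have E : Re (4 + w ^+ 2) = 4 + Re w ^+ 2 - Im w ^+ 2.
  by rewrite natcE cReD expr2 cReM /=; ring.
rewrite (le_trans _ (ler_Re_cabs _))// E (le_trans _ (ler_norm _))//.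
have : Im w ^+ 2 <= 1.
  by rewrite -[_ ^+ 2]real_normK ?num_real// exprn_ile1.
lra.
Qed.

(** An explicit odd function that is real on the real axis, has the principal part 1/w at 0, decays
    like w^-3, and has its other poles outside |Im w| <= 1. *)
Definition pole_model (w : C) : C := 4 / (w * (4 + w ^+ 2)).

Lemma pole_model_bound (w : C) : `|Im w| <= 1 -> w != 0 ->
  cabs (pole_model w) <= 4 * pk (Re w) / cabs w.
Proof.
move=> wh w0; have h4 := cabs_4Dsqr wh; have W0 := cabs_gt0 w0.
have p0 : 0 < 1 + Re w ^+ 2 by rewrite ltr_pwDl ?sqr_ge0.
rewrite cabsM cabsV cabsM cabs_nat invfM [_^-1 * _]mulrC mulrA ler_wpM2r ?invr_ge0 ?(ltW W0)//.
rewrite ler_wpM2l// lef_pV2 ?posrE ?(lt_le_trans _ h4)//; last lra.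
by rewrite (le_trans _ h4)// /oneDsqr; lra.
Qed.

Lemma pole_model_near0 (w : C) : `|Im w| <= 1 -> w != 0 -> cabs w <= 1 ->
  cabs (w^-1 - pole_model w) <= 1.
Proof.
move=> wh w0 w1; have h4 := cabs_4Dsqr wh.
have c4 : 1 <= cabs (4 + w ^+ 2) by have := sqr_ge0 (Re w); lra.
have n4 : 4 + w ^+ 2 != 0 by apply/eqP => e; rewrite e cabs0 in c4; lra.
rewrite (_ : _ - _ = w / (4 + w ^+ 2)); last by rewrite /pole_model; field; rewrite n4 w0.
rewrite cabsM cabsV ler_pdivrMr ?mul1r ?(lt_le_trans ltr01)//.
exact: le_trans w1 c4.
Qed.

Lemma C1on_pole_model : C1on off0 pole_model.
Proof.
apply: C1onM; first exact: C1on_cst.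
apply: C1onV.
  apply: C1onM; first exact: C1on_id.
  apply: C1onD; first exact: C1on_cst.
  by rewrite (_ : (fun z => _) = fun z => z * z); [apply: C1onM; exact: C1on_id|apply/funext => z; rewrite expr2].
move=> w [w0 wh]; rewrite mulf_neq0//; apply/eqP => e.
have := cabs_4Dsqr (le_trans wh dilog_height_le1); rewrite e cabs0.
by have := sqr_ge0 (Re w); lra.
Qed.

Lemma pole_model_conj (t y : R) : Re (pole_model ((- t) +i* y)) = - Re (pole_model (t +i* y)).
Proof.
have -> : (- t) +i* y = - conjc (t +i* y) :> C by apply: complexP; rewrite ?cReN ?cImN /= ?opprK.
set w := t +i* y; have -> : pole_model (- conjc w) = - conjc (pole_model w).
  rewrite /pole_model !expr2 mulrNN mulNr invrN mulrN.
  have cM (x z : C) : conjc (x * z) = conjc x * conjc z.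
    by apply: complexP; case: x => ? ?; case: z => ? ? /=; ring.
  have cD (x z : C) : conjc (x + z) = conjc x + conjc z.
    by apply: complexP; case: x => ? ?; case: z => ? ? /=; ring.
  have cV (x : C) : conjc x^-1 = (conjc x)^-1 := conjc_inv x.
  have c4 : conjc (4 : C) = 4 := conjc_nat R 4.
  have -> : conjc (4 / (w * (4 + w * w))) = conjc (4 : C) * (conjc (w * (4 + w * w)))^-1.
    by rewrite -cV -cM.
  by rewrite c4 (cM w) (cD 4) c4 (cM w).
by case: (pole_model w).
Qed.

(** Subtracting the model leaves an odd bounded integrand with integral 0, so the moment is the
    integral of the model. On a horizontal line the real part of the model is odd in t. Behind this
    lies half a residue at a simple pole with real residue. *)
Lemma Re_dilog_moment2 : Re (cint (fun t : R => (t +i* h) ^+ 2 / dilog_den b (t +i* h))) = 0.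
Proof.
pose H (w : C) := w ^+ 2 / dilog_den b w - pole_model w.
have e0 : 0 < Re (eta b) by rewrite Re_eta divr_gt0// addr_gt0// Re_inv_gt0.
have [c c0 hc] := inv_dilog_den_bound e0.
have [k k0 hk] := dilog_den_pole.
have [K K0 hK] := poly_exp_le_pk 0 e0.
have bM (w : C) : off0 w -> cabs (w ^+ 2 / dilog_den b w) <= c * K * pk (Re w) / cabs w.
  move=> hw; have W0 := cabs_gt0 hw.1; rewrite ler_pdivlMr// cabsM cabsX.
  rewrite [leLHS](_ : _ = cabs w ^+ 3 * cabs (dilog_den b w)^-1); last by ring.
  rewrite (le_trans (hc w hw))// -[leRHS]mulrA ler_wpM2l ?(ltW c0)//.
  rewrite (_ : 2 * Re (eta b) - Re (eta b) = Re (eta b)); last by ring.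
  by have := hK (Re w); rewrite expr0 mul1r.
have sq : C1on off0 (fun w => w ^+ 2 / dilog_den b w).
  apply: C1onM.
    by rewrite (_ : (fun z => _) = fun z => z * z); [apply: C1onM; exact: C1on_id|apply/funext => z; rewrite expr2].
  by apply: C1onV; [exact: C1on_dilog_den|move=> w [w0 hw]; exact: dilog_den_neq0].
have off (t : R) : off0 (t +i* h).
  by split; [exact: contour_neq0|rewrite /= gtr0_norm].
have hw1 (w : C) : off0 w -> `|Im w| <= 1 by move=> [_ /le_trans]; apply; exact: dilog_height_le1.
have wh (t : R) : h <= cabs (t +i* h) by rewrite (le_trans _ (ler_Im_cabs _))//= ler_norm.
have inv_le (t : R) : (cabs (t +i* h))^-1 <= h^-1 by rewrite lef_pV2 ?posrE// (lt_le_trans h0).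
have n1 : nice (fun t : R => (t +i* h) ^+ 2 / dilog_den b (t +i* h)).
  apply: (@niceI _ _ (c * K * h^-1) (scont_contour b0 sq)) => t; rewrite (le_trans (bM _ (off t)))//.
  by rewrite mulrAC ler_wpM2r ?pk_ge0// ler_wpM2l// mulr_ge0// ltW.
have n2 : nice (fun t : R => pole_model (t +i* h)).
  apply: (@niceI _ _ (4 * h^-1) (scont_contour b0 C1on_pole_model)) => t.
  rewrite (le_trans (pole_model_bound (hw1 _ (off t)) (off t).1))//.
  by rewrite mulrAC ler_wpM2r ?pk_ge0// ler_wpM2l.
have : cint (fun t : R => H (t +i* h)) = 0.
  apply: (@cint_odd_contour R b b0 H (2 * (k + 1) + c * K + 4)).
  - by move=> w; rewrite /H /pole_model dilog_denN !sqrrN mulNr !invrN !mulrN opprB opprK addrC.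
  - by apply: C1onD => //; apply: C1onN; exact: C1on_pole_model.
  - move=> t y hy w0; set w := t +i* y in w0 *; have hw : off0 w by split.
    have p0 := pk_ge0 t; have W0 := cabs_gt0 w0.
    have cK : 0 <= c * K * pk t by rewrite !mulr_ge0// ltW.
    have [w1|w1] := leP (cabs w) 1.
      have hp : 1 <= 2 * pk t.
        rewrite /pk /oneDsqr ler_pdivlMr ?mul1r; last by rewrite ltr_pwDl// sqr_ge0.
        rewrite (_ : 2 = 1 + 1)// lerD2l -[leLHS]real_normK ?num_real// exprn_ile1//.
        by rewrite (le_trans (ler_Re_cabs w)).
      have hH : cabs (H w) <= k + 1.
        rewrite (_ : H w = (w ^+ 2 / dilog_den b w - w^-1) + (w^-1 - pole_model w)); last by rewrite /H; ring.
        by rewrite (le_trans (ler_cabsD _ _))// lerD ?hk// pole_model_near0// hw1.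
      rewrite (le_trans hH)//; have : k + 1 <= (k + 1) * (2 * pk t) by rewrite ler_peMr// addr_ge0// ltW.
      rewrite !mulrDl; lra.
    rewrite (le_trans (ler_cabsB _ _))//.
    have h1 : cabs (w ^+ 2 / dilog_den b w) <= c * K * pk t.
      by rewrite (le_trans (bM _ hw))// ler_piMr// invf_le1// ltW.
    have h2 : cabs (pole_model w) <= 4 * pk t.
      by rewrite (le_trans (pole_model_bound (hw1 _ hw) w0))// ler_piMr ?mulr_ge0// invf_le1// ltW.
    have : 0 <= (k + 1) * pk t by rewrite mulr_ge0// addr_ge0// ltW.
    rewrite !mulrDl; lra.
rewrite /H (cintB n1 n2) => /eqP; rewrite subr_eq0 => /eqP ->.
pose I1 : R := \int[@lebesgue_measure R]_(t in [set: R]) Re (pole_model (t +i* h)).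
pose I2 : R := \int[@lebesgue_measure R]_(t in [set: R]) Re (pole_model ((0 - t) +i* h)).
have E1 : I2 = I1 := congr1 (@complex.Re R) (cint_refl 0 n2).
have E2 : I2 = - I1.
  have -> : - I1 = \int[@lebesgue_measure R]_(t in [set: R]) Re (- pole_model (t +i* h)).
    by have := congr1 (@complex.Re R) (cintN n2); rewrite cReN => /esym.
  by apply: eq_Rintegral => t _; rewrite sub0r pole_model_conj cReN.
rewrite -[LHS]/I1; move: E2; rewrite E1.
by move=> /eqP; rewrite -subr_eq0 opprK -mulr2n mulrn_eq0 /= => /eqP.
Qed.
End DilogReflection.

(** * Reflection formula and exponential growth of phi *)

Section DilogBound.
Variable R : realType.
Local Notation C := R[i].
Variables (b : C) (b0 : 0 < Re b).
Let h := dilog_height b.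
Let h0 : 0 < h := dilog_height_gt0 b0.

Let moment0 : C := cint (fun t : R => (dilog_den b (t +i* h))^-1).
Let moment2 : C := cint (fun t : R => (t +i* h) ^+ 2 / dilog_den b (t +i* h)).

Lemma nice_dilog_integrand (z : C) : `|Im z| < Re (eta b) ->
  nice (fun t : R => dilog_integrand b z (t +i* h)).
Proof.
move=> zv; have [K K0 hK] := dilog_integrand_le_pk b0 zv.
apply: (niceI (M := expR (2 * (Re z * h)) * K)).
  exact: (scont_contour b0 (C1on_dilog_integrand b0 z)).
move=> t; have := hK (Re z) (Im z) t (lexx _).
by rewrite (_ : Re z +i* Im z = z)//; case: (z).
Qed.

Lemma nice_dilog_moment2 : nice (fun t : R => (t +i* h) ^+ 2 / dilog_den b (t +i* h)).
Proof.
have e0 : 0 < Re (eta b) by rewrite Re_eta divr_gt0// addr_gt0// Re_inv_gt0.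
have [c c0 hc] := inv_dilog_den_bound b0 e0.
have [K K0 hK] := poly_exp_le_pk 0 e0.
apply: (niceI (M := c * K / h)).
  apply: (scont_contour b0 (f := fun w => w ^+ 2 / dilog_den b w)); apply: C1onM.
    by rewrite (_ : (fun z => _) = fun z => z * z); [apply: C1onM; exact: C1on_id|apply/funext => z; rewrite expr2].
  by apply: C1onV; [exact: C1on_dilog_den|move=> w [w0 hw]; exact: dilog_den_neq0].
move=> t; set w := t +i* h.
have w0 : w != 0 by exact: contour_neq0.
have wh : h <= cabs w by rewrite (le_trans _ (ler_Im_cabs _))//= ler_norm.
have wi : `|Im w| <= h by rewrite /= gtr0_norm.
have hw := hc w (conj w0 wi); rewrite -[Re w]/t in hw.
have W0 : 0 < cabs w := lt_le_trans h0 wh.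
rewrite cabsM cabsX [leRHS](_ : _ = c * K * pk t / h); last by ring.
rewrite ler_pdivlMr//; set D := cabs (dilog_den b w)^-1 in hw *.
have D0 : 0 <= D by exact: cabs_ge0.
have s1 : cabs w ^+ 2 * D * h <= cabs w ^+ 3 * D.
  rewrite [leRHS](_ : _ = cabs w ^+ 2 * D * cabs w); last by ring.
  by rewrite ler_wpM2l// mulr_ge0// exprn_ge0// cabs_ge0.
apply: (le_trans s1); apply: (le_trans hw).
rewrite -[leRHS]mulrA ler_wpM2l ?(ltW c0)//.
rewrite (_ : 2 * Re (eta b) - Re (eta b) = Re (eta b)); last by ring.
by have := hK t; rewrite expr0 mul1r.
Qed.

(** The vanishing cosine remainder, integrated term by term; on the raised contour every term is
    integrable by itself. *)
Lemma dilog_int_reflection (z : C) : `|Im z| < Re (eta b) ->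
  dilog_int b z + dilog_int b (- z) = 2 * moment0 + (2 * 'i * z) ^+ 2 * moment2.
Proof.
move=> zv; have e0 : `|Im (0 : C)| < Re (eta b).
  by rewrite normr0 (le_lt_trans (normr_ge0 _) zv).
have zvN : `|Im (- z)| < Re (eta b) by rewrite cImN normrN.
have n1 := nice_dilog_integrand zv; have n2 := nice_dilog_integrand zvN.
have n3 : nice (fun t : R => (dilog_den b (t +i* h))^-1).
  have := nice_dilog_integrand e0; congr nice; apply/funext => t.
  by rewrite /dilog_integrand mulr0 mul0r oppr0 cexp0 mul1r.
have n4 := nice_dilog_moment2.
have n5 := niceD n1 n2; have n6 := niceD (niceZ 2 n3) (niceZ ((2 * 'i * z) ^+ 2) n4).
have E := cintB n5 n6; rewrite (cintD n1 n2) (cintD (niceZ 2 n3) (niceZ ((2 * 'i * z) ^+ 2) n4)) in E.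
rewrite (cintZ 2 n3) (cintZ ((2 * 'i * z) ^+ 2) n4) in E.
apply/eqP; rewrite -subr_eq0 -[X in X == 0]E; apply/eqP.
rewrite -[RHS](dilog_cosh_remainder_eq0 b0 zv); apply: eq_cint => t /=.
rewrite /dilog_integrand -/h; set w := t +i* h.
rewrite (_ : - (2 * 'i * - z * w) = 2 * 'i * z * w); last by ring.
by rewrite exprMn; ring.
Qed.

Lemma qdilog_growth (v0 : R) : v0 < Re (eta b) -> exists AB : R * R,
  forall z : C, `|Im z| <= v0 -> cabs (qdilog b z) <= expR (AB.1 + AB.2 * `|Re z|).
Proof.
move=> hv; have [K K0 hK] := dilog_integrand_le_pk b0 hv.
have left (z : C) : `|Im z| <= v0 -> Re z <= 0 -> cabs (dilog_int b z) <= 2 * pi * K.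
  move=> zv xn; apply: cabs_cint.
    by apply: scont_cmeas; exact: (scont_contour b0 (C1on_dilog_integrand b0 z)).
  move=> t; have := hK (Re z) (Im z) t zv.
  rewrite (_ : Re z +i* Im z = z); last by case: (z).
  move/le_trans; apply; rewrite ler_wpM2r ?pk_ge0// ler_piMl ?(ltW K0)//.
  by rewrite -expR0 ler_expR pmulr_rle0// mulr_le0_ge0// ltW.
pose g := Im moment2.
pose A := 4^-1 * (2 * pi * K + 2 * cabs moment0 + 2 * pi * K); pose B := 4^-1 * (8 * `|v0| * `|g|).
exists (A, B) => z zv.
rewrite qdilogE cabs_cexp ler_expR -[(A, B).1]/A -[(A, B).2]/B.
rewrite [leRHS](_ : _ = 4^-1 * (2 * pi * K + 2 * cabs moment0 + 2 * pi * K + 8 * `|v0| * `|g| * `|Re z|)); last by rewrite /A /B; ring.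
have -> : Re (4^-1 * dilog_int b z) = 4^-1 * Re (dilog_int b z).
  by rewrite natcE -fmorphV cReZ.
rewrite ler_wpM2l//.
have m0 := cabs_ge0 moment0; have piK : 0 <= 2 * pi * K by rewrite !mulr_ge0 ?pi_ge0// ltW.
have gv : 0 <= 8 * `|v0| * `|g| * `|Re z| by rewrite !mulr_ge0.
have [xn|xp] := leP (Re z) 0.
  have := left z zv xn; have := ler_Re_cabs (dilog_int b z).
  have := ler_norm (Re (dilog_int b z)); lra.
have lN : cabs (dilog_int b (- z)) <= 2 * pi * K.
  by apply: left; rewrite ?cImN ?normrN// cReN oppr_le0 ltW.
have zlt : `|Im z| < Re (eta b) := le_lt_trans zv hv.
have := congr1 (@complex.Re R) (dilog_int_reflection zlt); rewrite !cReD.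
(* With an imaginary moment the square of Re z drops out, and what remains is linear in Re z as long
   as Im z stays bounded. *)
have -> : Re ((2 * 'i * z) ^+ 2 * moment2) = 8 * Im z * g * Re z.
  have -> : moment2 = 0 +i* g.
    by apply: complexP => //=; exact: Re_dilog_moment2.
  by rewrite natcE expr2 !(cReM, cImM) /=; ring.
have -> : Re (2 * moment0) = 2 * Re moment0 by rewrite natcE cReZ.
have a1 : 8 * Im z * g * Re z <= 8 * `|v0| * `|g| * `|Re z|.
  rewrite (le_trans (ler_norm _))// !normrM ger0_norm// !ler_wpM2r// ler_wpM2l//.
  by rewrite (le_trans zv)// ler_norm.
have a2 := ler_Re_cabs moment0; have a3 := ler_norm (Re moment0).
have a4 := ler_Re_cabs (dilog_int b (- z)); have a5 := ler_norm (- Re (dilog_int b (- z))).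
rewrite normrN in a5.
have aux (I J m M P G n x : R) : 0 <= P -> m <= M -> n <= P -> - J <= n ->
    x <= G -> I + J = 2 * m + x -> I <= P + 2 * M + P + G by lra.
by apply: aux piK (le_trans a3 a2) (le_trans a4 lN) a5 a1.
Qed.
End DilogBound.

(** * Iterated integrals *)

Section IteratedIntegral.
Variable R : realType.
Local Notation C := R[i].
Implicit Types (v : nat -> R) (F G : (nat -> R) -> C) (ks ls : seq nat).

Definition upd v k (t : R) : nat -> R := fun j => if j == k then t else v j.

(** Variables are numbered and read from an environment, so that reordering a tenfold integral
    becomes a permutation of a list. The head of the list is the outermost integral. *)
Fixpoint iint ks F v : C :=
  if ks is k :: ks' then cint (fun t => iint ks' F (upd v k t)) else F v.

Definition mcont F := forall (u : nat -> nat -> R) v,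
  (forall k, (fun n => u n k) @ \oo --> v k) -> ccvg (fun n => F (u n)) (F v).

(** A product majorant is inherited by all partial integrals and allows any order of integration. *)
Definition good ks F := mcont F /\
  exists M, forall v, cabs (F v) <= M * \prod_(k <- ks) pk (v k).

Lemma iint_cat ks ls F v : iint (ks ++ ls) F v = iint ks (iint ls F) v.
Proof. by elim: ks v => //= k ks IH v; apply: eq_cint => t. Qed.

Lemma eq_iint ks F G v : (forall v, F v = G v) -> iint ks F v = iint ks G v.
Proof. by move=> FG; elim: ks v => //= k ks IH v; apply: eq_cint => t. Qed.

Lemma updC v j k s t : j != k -> upd (upd v j s) k t = upd (upd v k t) j s.
Proof.
move=> jk; apply/funext => i; rewrite /upd.
by case: (eqVneq i k) => // ->; rewrite eq_sym (negbTE jk).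
Qed.

Lemma prod_pk_upd ks v k t : k \notin ks ->
  \prod_(j <- ks) pk (upd v k t j) = \prod_(j <- ks) pk (v j).
Proof.
move=> kn; apply: eq_big_seq => j jk; rewrite /upd.
by case: eqP => // e; rewrite e (negbTE kn) in jk.
Qed.

Lemma upd_cvg (u : nat -> nat -> R) v k (s : nat -> R) t :
  (forall k, (fun n => u n k) @ \oo --> v k) -> s @ \oo --> t ->
  forall j, (fun n => upd (u n) k (s n) j) @ \oo --> upd v k t j.
Proof. by move=> uv st j; rewrite /upd; case: (j == k). Qed.

Lemma prod_pk_ge0 ks v : 0 <= \prod_(j <- ks) pk (v j).
Proof. by apply: prodr_ge0 => j _; exact: pk_ge0. Qed.

Lemma prod_pk_le1 ks v : \prod_(j <- ks) pk (v j) <= 1.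
Proof.
elim: ks => [|k ks IH]; first by rewrite big_nil.
by rewrite big_cons mulr_ile1 ?pk_ge0 ?pk_le1 ?prod_pk_ge0.
Qed.

Lemma mcont_upd F v k : mcont F -> scont (fun t => F (upd v k t)).
Proof.
move=> cF u l ul; apply: (cF (fun n => upd v k (u n))).
by apply: upd_cvg => // j; exact: cvg_cst.
Qed.

Lemma good_upd_bound k ks F : k \notin ks -> good (k :: ks) F -> exists M,
  forall v, pk_bounded (fun t => F (upd v k t)) (M * \prod_(j <- ks) pk (v j)).
Proof.
move=> kn [_ [M hM]]; exists M => v t; rewrite (le_trans (hM _))//.
by rewrite big_cons prod_pk_upd// /upd eqxx mulrCA mulrC.
Qed.

Lemma good_nice k ks F v : k \notin ks -> good (k :: ks) F ->
  nice (fun t => F (upd v k t)).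
Proof.
move=> kn gF; have [M hM] := good_upd_bound kn gF.
exact: (niceI (mcont_upd _ _ gF.1) (hM v)).
Qed.

Lemma good_cint k ks F : k \notin ks -> good (k :: ks) F ->
  good ks (fun v => cint (fun t => F (upd v k t))).
Proof.
move=> kn gF; have [M hM] := good_upd_bound kn gF; split.
  move=> u v uv; apply: (@cint_cvg _ _ _ `|M|).
  - by move=> n; apply: scont_cmeas; apply: mcont_upd; exact: gF.1.
  - by apply: scont_cmeas; apply: mcont_upd; exact: gF.1.
  - move=> n t; rewrite (le_trans (hM _ _))// ler_wpM2r ?pk_ge0//.
    rewrite (le_trans (ler_norm _))// normrM ler_piMr//.
    by rewrite ger0_norm ?prod_pk_ge0 ?prod_pk_le1.
  - by move=> t _; apply: gF.1; apply: upd_cvg => //; exact: cvg_cst.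
exists (2 * pi * M) => v; rewrite -mulrA; apply: cabs_cint.
  by apply: scont_cmeas; apply: mcont_upd; exact: gF.1.
exact: hM.
Qed.

Lemma good_perm ks ls F : perm_eq ks ls -> good ks F -> good ls F.
Proof.
move=> p [cF [M hM]]; split=> //; exists M => v.
by rewrite -(perm_big _ p).
Qed.

Lemma good_catr ks ls F : good (ls ++ ks) F -> good ks F.
Proof.
move=> [cF [M hM]]; split=> //; exists `|M| => v; rewrite (le_trans (hM _))//.
rewrite (le_trans (ler_norm _))// normrM ler_wpM2l// ger0_norm ?prod_pk_ge0//.
by rewrite big_cat/= ler_piMl ?prod_pk_ge0 ?prod_pk_le1.
Qed.

Lemma good_iint ks ls F : uniq (ls ++ ks) -> good (ls ++ ks) F -> good ks (iint ls F).
Proof.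
elim: ls ks F => [|l ls IH] ks F //= /andP[ln un] gF.
apply: (@good_cint l ks (iint ls F)); first by move: ln; rewrite mem_cat negb_or => /andP[].
apply: IH.
  by rewrite -cat1s uniq_catCA /= ln.
by apply: good_perm gF; rewrite -cat1s -[l :: ks]cat1s perm_catCA.
Qed.

Lemma cint_upd_swap j k ks F v : j != k -> j \notin ks -> k \notin ks ->
  good (j :: k :: ks) F ->
  cint (fun s => cint (fun t => F (upd (upd v j s) k t))) =
  cint (fun t => cint (fun s => F (upd (upd v k t) j s))).
Proof.
move=> jk jn kn [cF [M hM]].
rewrite (@cint_swap _ (fun s t => F (upd (upd v j s) k t)) `|M|).
- by apply: eq_cint => t; apply: eq_cint => s; rewrite updC.
- move=> s t a c sa tc; apply: cF; apply: upd_cvg => //.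
  by apply: upd_cvg => // i; exact: cvg_cst.
- move=> s t; rewrite (le_trans (hM _))// !big_cons prod_pk_upd// prod_pk_upd//.
  rewrite (_ : upd (upd v j s) k t j = s); last by rewrite /upd (negbTE jk) eqxx.
  rewrite (_ : upd (upd v j s) k t k = t); last by rewrite /upd eqxx.
  rewrite (le_trans (ler_norm _))// normrM -mulrA ler_wpM2l// ger0_norm; last first.
    by rewrite !mulr_ge0 ?pk_ge0 ?prod_pk_ge0.
  by rewrite mulrA ler_piMr ?mulr_ge0 ?pk_ge0 ?prod_pk_le1.
Qed.

(** Carries the outermost integration to the innermost place by successive swaps of two
    neighbours. *)
Lemma iint_cons k ks F v : uniq (k :: ks) -> good (k :: ks) F ->
  iint (k :: ks) F v = iint ks (fun v => cint (fun t => F (upd v k t))) v.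
Proof.
elim: ks F v => // j ks IH F v un gF.
have /and3P[kn jn uks] : [&& k \notin (j :: ks), j \notin ks & uniq ks] := un.
have [kj kks] : k != j /\ k \notin ks by move: kn; rewrite inE negb_or => /andP[].
have g1 : good (k :: j :: ks) F by [].
have g2 : good (ks ++ [:: j; k]) F.
  by apply: good_perm g1; rewrite perm_sym perm_catC /= -[k :: _]cat1s -[j :: _]cat1s perm_catCA.
have ukj : uniq (ks ++ [:: j; k]).
  by rewrite cat_uniq uks /= inE eq_sym kj orbF !andbT negb_or jn.
have g3 := good_iint ukj g2; have g4 : good [:: k; j] (iint ks F).
  by apply: good_perm g3; rewrite -[[:: j; k]]/([:: j] ++ [:: k]) perm_catC.
have ks0 : k \notin [::] by []. have js0 : j \notin [::] by [].
have E := cint_upd_swap v kj ks0 js0 g4.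
rewrite [LHS]E /=; apply: eq_cint => t.
apply: (IH F (upd v j t)); first by rewrite /= kks.
by apply: (@good_catr _ [:: j]); apply: good_perm gF; rewrite -cat1s -[j :: _]cat1s perm_catCA.
Qed.

Lemma iint_perm ks ls F v : uniq ks -> perm_eq ks ls -> good ks F ->
  iint ks F v = iint ls F v.
Proof.
elim: ks ls F v => [|k ks IH] ls F v.
  by move=> _ /perm_size /esym/size0nil ->.
move=> uk p gF; rewrite (iint_cons _ uk gF).
have uls : uniq ls by rewrite -(perm_uniq p).
have kl : k \in ls by rewrite -(perm_mem p) mem_head.
have /andP[kn uks] := uk.
case/splitPr: kl p uls => a c p uls.
have p2 : perm_eq ks (a ++ c).
  by rewrite -(perm_cons k) (perm_trans p)// -cat1s perm_catCA.
have gk : good (k :: a ++ c) F by apply: good_perm gF; rewrite perm_cons.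
have uac : uniq (k :: a ++ c) by rewrite /= -(perm_mem p2) kn -(perm_uniq p2).
have kc : k \notin c by move: uac => /= /andP[]; rewrite mem_cat negb_or => /andP[].
rewrite (IH _ _ _ uks p2 (good_cint kn gF)) iint_cat [RHS]iint_cat.
apply: eq_iint => w; rewrite iint_cons//.
  by rewrite /= kc; have := uls; rewrite cat_uniq => /and3P[_ _ /andP[]].
by apply: (@good_catr _ a); apply: good_perm gk; rewrite -cat1s perm_catCA.
Qed.

(** The integrands need to agree only after integration over one variable, the situation of a
    contour shift in that variable. *)
Lemma eq_iint_cint k ks F G v : k \in ks -> uniq ks -> good ks F -> good ks G ->
  (forall v, cint (fun t => F (upd v k t)) = cint (fun t => G (upd v k t))) ->
  iint ks F v = iint ks G v.
Proof.
move=> kk uk gF gG FG; have p := perm_to_rem kk.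
have u2 : uniq (k :: rem k ks) by rewrite -(perm_uniq p).
rewrite (iint_perm _ uk p gF) (iint_perm _ uk p gG).
rewrite (iint_cons _ u2 (good_perm p gF)) (iint_cons _ u2 (good_perm p gG)).
exact: eq_iint.
Qed.
End IteratedIntegral.

(** * Test functions and plane waves *)

Section TestFunctions.
Variable R : realType.
Local Notation C := R[i].
Local Notation V := 'rV[R[i]^o]_6.
Implicit Types (z D : nat -> C).

Lemma cvg_ccvg (f : nat -> R[i]^o) (l : R[i]^o) : f @ \oo --> l <-> ccvg f l.
Proof.
split=> [h|h].
  apply/cvgrPdist_lt => e e0; have e1 : 0 < e%:C :> R[i]^o by rewrite ltcR.
  move/cvgrPdist_lt: h => /(_ _ e1); apply: filterS => n.
  by rewrite normC_cabs ltcR cabsBC sub0r normrN ger0_norm ?cabs_ge0.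
(* The norm takes values in [R[i]], where being positive forces the imaginary part of the radius to
   vanish. *)
apply/cvgrPdist_lt => -[e f0]; rewrite ltcE /= => /andP[/eqP -> e0].
move/cvgrPdist_lt: h => /(_ _ e0); apply: filterS => n.
by rewrite normC_cabs -[e +i* 0]/(e%:C) ltcR [cabs (l - _)]cabsBC sub0r normrN ger0_norm ?cabs_ge0.
Qed.

Definition pt z : V := \row_(k < 6) z k.

Lemma pt6E (x0 x1 x2 x3 x4 x5 : C) :
  pt6 x0 x1 x2 x3 x4 x5 = pt (nth 0 [:: x0; x1; x2; x3; x4; x5]).
Proof. by []. Qed.

Lemma pt_cvg (u : nat -> nat -> C) z : (forall k, (k < 6)%N -> ccvg (u^~ k) (z k)) ->
  (fun n => pt (u n)) @ \oo --> pt z.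
Proof.
move=> h; apply/cvg_ballP => e e0.
have : \forall n \near \oo, forall k : 'I_6, `|z k - u n k| < e.
  apply: (@filter_forall _ 'I_6 (fun (k : 'I_6) (n : nat) => is_true (`|z k - u n k| < e))) => k.
  have /cvg_ccvg/cvgrPdist_lt := h k (ltn_ord k).
  exact.
apply: filterS => n hn; split=> // i k.
by have := hn k; rewrite /pt !mxE.
Qed.

Lemma continuous_pt_cvg (f : V -> R[i]^o) (u : nat -> nat -> C) z : continuous f ->
  (forall k, (k < 6)%N -> ccvg (u^~ k) (z k)) -> ccvg (fun n => f (pt (u n))) (f (pt z)).
Proof.
move=> cf /pt_cvg h; apply/cvg_ccvg.
exact: (cvg_comp (fun n => pt (u n)) f h (cf (pt z))).
Qed.

Variable psi : V -> R[i]^o.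
Hypothesis tpsi : test_function psi.

Lemma test_cvg (u : nat -> nat -> C) z : (forall k, (k < 6)%N -> ccvg (u^~ k) (z k)) ->
  ccvg (fun n => psi (pt (u n))) (psi (pt z)).
Proof.
have [dpsi _ _] := tpsi; apply: continuous_pt_cvg => x.
exact: differentiable_continuous.
Qed.

(** The constant is moved into the exponent, so that later estimates are linear inequalities between
    exponents. *)
Lemma test_bound (a : R) : 0 <= a -> exists L, forall z,
  (forall k, (k < 6)%N -> `|Im (z k)| <= a) ->
  cabs (psi (pt z)) <= expR (L - a * \sum_(k < 6) `|Re (z k)|).
Proof.
move=> a0; have [_ _ /(_ a)[M hM]] := tpsi; exists (ln (`|M| + 1)) => z hz.
have := hM (pt z); rewrite normC_cabs lecR => /(_ _)/le_trans; apply.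
  by move=> k; rewrite mxE; exact: hz.
rewrite expRD lnK ?posrE ?ltr_wpDl//.
rewrite (eq_bigr (fun k : 'I_6 => `|Re (z k)|)); last by move=> k _; rewrite mxE.
by rewrite ler_wpM2r ?expR_ge0// (le_trans (ler_norm _))// lerDl.
Qed.

Lemma test_line_C1on z D : C1on (fun=> True) (fun p => psi (pt (fun k => z k + p * D k))).
Proof.
have [dpsi cpsi _] := tpsi.
have lineE p k : pt (fun j => z j + (p + k) * D j) = k *: pt D + pt (fun j => z j + p * D j).
  by apply/matrixP => i j; rewrite !mxE (mulrDl p k) addrA addrC.
exists (fun p => 'D_(pt D) psi (pt (fun k => z k + p * D k))); split; last first.
  move=> u p _ _ up.
  apply: (@continuous_pt_cvg _ (fun n k => z k + u n * D k) (fun k => z k + p * D k) (cpsi (pt D))).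
  move=> k _; apply: ccvgD; first exact: ccvg_cst.
  by apply: ccvgM; [exact: up|exact: ccvg_cst].
move=> p _ e e0; set a := pt (fun k => z k + p * D k).
have := @diff_derivable _ _ _ psi a (pt D) (dpsi a); rewrite /derivable.
have e1 : 0 < e%:C :> R[i] by rewrite ltcR.
move=> /cvgrPdist_le/(_ _ e1); rewrite -/('D_(pt D) psi a).
move=> /nbhs_ballP[[d f0]]; rewrite /= ltcE /= => /andP[/eqP -> d0] H.
exists d => // k kd; have [->|k0] := eqVneq k 0.
  by rewrite addr0 subrr mul0r subr0 cabs0 mulr0.
have := H k; rewrite /ball /= sub0r normrN normC_cabs -[d +i* 0]/(d%:C) ltcR => /(_ kd k0).
rewrite normC_cabs lecR -lineE => hk.
have E (X Y : C) : X - k * Y = - (k * (Y - k^-1 * X)) by rewrite mulrBr mulVKf// opprB.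
by rewrite E cabsN cabsM mulrC ler_wpM2r ?cabs_ge0.
Qed.
End TestFunctions.

(** * Test functions times exponentials on complex lines *)

Section PlaneWaves.
Variable R : realType.
Local Notation C := R[i].
Variable psi : 'rV[R[i]^o]_6 -> R[i]^o.
Hypothesis tpsi : test_function psi.
Implicit Types (z : nat -> C) (D : nat -> R) (ka al ga : C).

(** The shape of all integrands, apart from phi, along one complex line. A real direction with some
    entry equal to 1 guarantees decay along the line. *)
Definition wave ka al ga z D (p : C) : C :=
  ka * cexp (al + ga * p) * psi (pt (fun k => z k + p * (D k)%:C)).

Lemma wave_C1on ka al ga z D : C1on (fun=> True) (wave ka al ga z D).
Proof.
apply: C1onM; last exact: test_line_C1on.
apply: C1onM; first exact: C1on_cst.
apply: C1on_cexp.
rewrite (_ : (fun p => _) = fun p => ga * p + al); first exact: C1on_affine.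
by apply/funext => p; rewrite addrC.
Qed.

Lemma wave_bound ka al ga z D k0 (Y : R) : (k0 < 6)%N -> D k0 = 1 ->
  exists M, forall x y : R, `|y| <= Y -> cabs (wave ka al ga z D (x +i* y)) <= M * pk x.
Proof.
(* The same number is the tube width and the decay rate in [test_function]: it must exceed all
   imaginary parts that occur, and the growth rate of the exponential by 1. *)
move=> k06 D1; pose a := cabs ga + 1 + \sum_(k < 6) (`|Im (z k)| + `|Y| * `|D k|).
have a1 : cabs ga + 1 <= a by rewrite lerDl sumr_ge0// => k _; rewrite addr_ge0// mulr_ge0.
have a0 : 0 <= a by rewrite (le_trans _ a1)// addr_ge0 ?cabs_ge0.
have [L hL] := test_bound tpsi a0.
pose E := Re al + cabs ga * `|Y| + L + a * `|Re (z k0)|.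
exists (cabs ka * (expR E * 4)) => x y yY; have YY : `|y| <= `|Y| by rewrite (le_trans yY)// ler_norm.
have ImE k : Im (z k + (x +i* y) * (D k)%:C) = Im (z k) + y * D k.
  by rewrite cImD cImM /= mulr0 add0r.
have ReE k : Re (z k + (x +i* y) * (D k)%:C) = Re (z k) + x * D k.
  by rewrite cReD cReM /= mulr0 subr0.
rewrite /wave !cabsM cabs_cexp -!mulrA ler_wpM2l ?cabs_ge0//.
set P := cabs (psi _).
have hP : P <= expR (L - a * `|Re (z k0) + x|).
  rewrite /P (le_trans (hL _ _))//.
    move=> k k6; rewrite ImE (le_trans (ler_normD _ _))// normrM /a.
    rewrite (bigD1 (Ordinal k6))//= addrCA -addrA lerD2l.
    apply: ler_wpDr; last by rewrite ler_wpM2r.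
    rewrite addr_ge0 ?addr_ge0 ?cabs_ge0//.
    by rewrite sumr_ge0// => j _; rewrite addr_ge0// mulr_ge0.
  rewrite ler_expR lerD2l lerN2 ler_wpM2l//.
  rewrite (bigD1 (Ordinal k06))//= ReE D1 mulr1 lerDl sumr_ge0//.
apply: (le_trans (ler_wpM2l (expR_ge0 _) hP)); rewrite -expRD.
apply: (@le_trans _ _ (expR (E - `|x|))); last first.
  by rewrite expRD ler_wpM2l ?expR_ge0// expRN_le_pk.
rewrite ler_expR cReD cReM /= /E.
have h1 : Re ga * x - Im ga * y <= cabs ga * `|x| + cabs ga * `|Y|.
  rewrite lerD//; rewrite (le_trans (ler_norm _))// ?normrN normrM.
    by rewrite ler_wpM2r// ler_Re_cabs.
  by rewrite ler_pM// ler_Im_cabs.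
have h2 : a * `|x| <= a * `|Re (z k0) + x| + a * `|Re (z k0)|.
  rewrite -mulrDr ler_wpM2l// addrC -[`|Re (z k0)|]normrN.
  by rewrite (le_trans _ (ler_normD _ _))// addrA addNr add0r.
have h3 : (cabs ga + 1) * `|x| <= a * `|x| by rewrite ler_wpM2r.
rewrite mulrDl mul1r in h3; lra.
Qed.

Section Direction.
Variables (ka al ga : C) (z : nat -> C) (D : nat -> R) (k0 : nat).
Hypotheses (k06 : (k0 < 6)%N) (Dk0 : D k0 = 1).
Let W := wave ka al ga z D.

Lemma nice_wave (y : R) : nice (fun x => W (x +i* y)).
Proof.
have [M hM] := wave_bound ka al ga z `|y| k06 Dk0.
apply: (niceI (M := M)); last by move=> x; exact: hM.
exact: (scont_line (S := fun=> True) (C1on_cont (wave_C1on ka al ga z D))).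
Qed.

Lemma wave_shift (y : R) : cint (fun x => W (x +i* y)) = cint (fun x => W x%:C).
Proof.
have [M hM] := wave_bound ka al ga z `|y| k06 Dk0.
have hC := wave_C1on ka al ga z D.
have [y0|y0] := leP 0 y.
  apply/esym; apply: (@cint_strip_shift _ _ _ _ M y0); first exact: C1onS hC.
  by move=> x y1 /andP[h1 h2]; apply: hM; rewrite !ger0_norm// (le_trans h1).
apply: (@cint_strip_shift _ _ _ _ M (ltW y0)); first exact: C1onS hC.
move=> x y1 /andP[h1 h2]; apply: hM.
by rewrite ler0_norm// (ltr0_norm y0) lerN2.
Qed.

Lemma wave_inversion (a : C) :
  cint (fun t : R => cint (fun p : R => cexp (cpi R * 'i * (t%:C * (a - p%:C))) * W p%:C)) = 2 * W a.
Proof.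
have [M hM] := wave_bound ka al ga z (`|Im a| + 1) k06 Dk0.
exact: (fourier_inversion (wave_C1on ka al ga z D) hM).
Qed.

Lemma wave_inversionN (a : C) :
  cint (fun t : R => cint (fun p : R => cexp (cpi R * 'i * (t%:C * (p%:C - a))) * W p%:C)) = 2 * W a.
Proof.
have [M hM] := wave_bound ka al ga z (`|Im a| + 1) k06 Dk0.
exact: (fourier_inversionN (wave_C1on ka al ga z D) hM).
Qed.
End Direction.
End PlaneWaves.

(** * The kernels *)

Section Kernel.
Variable R : realType.
Local Notation C := R[i].
Variable psi : 'rV[R[i]^o]_6 -> R[i]^o.
Hypothesis tpsi : test_function psi.
Variables b w0 beta A : C.
Implicit Types (ka u x z : C).

Lemma mul_middle (x y z w : C) : x * (y * z * w) = y * (x * z) * w.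
Proof. by ring. Qed.

(** The total phase, with z0, ..., z5 standing for p1, p2, p3, p1', p2', p3'. *)
Definition kphase u x1 x2 x2' z0 z1 z2 z3 z4 z5 : C :=
  x2 * (u + beta + z5 - z1) - x2' * (u + beta + z2 - z4)
  + x1 * (z3 - z5 + z2 - z0) - u * (z3 - z5) + (u + beta) * A.

(** The constant [ka] collects the factors 2 of the successive inversions. *)
Definition kfun ka u x1 x2 x2' z0 z1 z2 z3 z4 z5 : C :=
  ka * qdilog b (u + w0) * cexp (cpi R * 'i * kphase u x1 x2 x2' z0 z1 z2 z3 z4 z5)
  * psi (pt6 z0 z1 z2 z3 z4 z5).

Lemma pt6_line z0 z1 z2 z3 z4 z5 (d0 d1 d2 d3 d4 d5 : R) (p : C) :
  pt (fun k => nth 0 [:: z0; z1; z2; z3; z4; z5] k + p * (nth 0 [:: d0; d1; d2; d3; d4; d5] k)%:C) =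
  pt6 (z0 + p * d0%:C) (z1 + p * d1%:C) (z2 + p * d2%:C)
      (z3 + p * d3%:C) (z4 + p * d4%:C) (z5 + p * d5%:C).
Proof.
apply/matrixP => i j; rewrite !mxE.
by case: j => -[|[|[|[|[|[|//]]]]]] hj.
Qed.

(** The phase is affine in each momentum, so contour shifts and inversion for waves become available
    one momentum at a time. *)
Lemma kfun_wave1 ka u x1 x2 x2' z0 z2 z3 z4 z5 (p : C) :
  kfun ka u x1 x2 x2' z0 p z2 z3 z4 z5 =
  wave psi (ka * qdilog b (u + w0)) (cpi R * 'i * kphase u x1 x2 x2' z0 0 z2 z3 z4 z5)
    (- (cpi R * 'i * x2)) (nth 0 [:: z0; 0; z2; z3; z4; z5]) (nth 0 [:: 0; 1; 0; 0; 0; 0]) p.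
Proof.
rewrite /wave pt6_line !(rmorph0, rmorph1, mulr0, mulr1, addr0, add0r).
by rewrite /kfun /kphase; congr (_ * cexp _ * _); ring.
Qed.

Lemma kfun_wave4 ka u x1 x2 x2' z0 z1 z2 z3 z5 (p : C) :
  kfun ka u x1 x2 x2' z0 z1 z2 z3 p z5 =
  wave psi (ka * qdilog b (u + w0)) (cpi R * 'i * kphase u x1 x2 x2' z0 z1 z2 z3 0 z5)
    (cpi R * 'i * x2') (nth 0 [:: z0; z1; z2; z3; 0; z5]) (nth 0 [:: 0; 0; 0; 0; 1; 0]) p.
Proof.
rewrite /wave pt6_line !(rmorph0, rmorph1, mulr0, mulr1, addr0, add0r).
by rewrite /kfun /kphase; congr (_ * cexp _ * _); ring.
Qed.

Lemma kfun_wave0 ka u x1 x2 x2' z1 z2 z3 z4 z5 (p : C) :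
  kfun ka u x1 x2 x2' p z1 z2 z3 z4 z5 =
  wave psi (ka * qdilog b (u + w0)) (cpi R * 'i * kphase u x1 x2 x2' 0 z1 z2 z3 z4 z5)
    (- (cpi R * 'i * x1)) (nth 0 [:: 0; z1; z2; z3; z4; z5]) (nth 0 [:: 1; 0; 0; 0; 0; 0]) p.
Proof.
rewrite /wave pt6_line !(rmorph0, rmorph1, mulr0, mulr1, addr0, add0r).
by rewrite /kfun /kphase; congr (_ * cexp _ * _); ring.
Qed.

(** Once p1 is tied to p1', both move together along the line, hence the direction with two entries
    1. *)
Lemma kfun_wave03 ka u z1 z2 z4 z5 (r p : C) :
  kfun ka u 0 0 0 (p + r) z1 z2 p z4 z5 =
  wave psi (ka * qdilog b (u + w0)) (cpi R * 'i * kphase u 0 0 0 0 z1 z2 0 z4 z5)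
    (- (cpi R * 'i * u)) (nth 0 [:: r; z1; z2; 0; z4; z5]) (nth 0 [:: 1; 0; 0; 1; 0; 0]) p.
Proof.
rewrite /wave pt6_line !(rmorph0, rmorph1, mulr0, mulr1, addr0, add0r) [r + p]addrC.
by rewrite /kfun /kphase; congr (_ * cexp _ * _); ring.
Qed.

(* The shift of [z1] only makes the double integral below absolutely convergent; for
   fixed [t] it can be undone, which leaves Fourier inversion on the real line. *)
Lemma kfun_inversion1 ka u x1 x2' z0 z2 z3 z4 z5 (m : R -> R) :
  cint (fun t : R => cint (fun p : R => kfun ka u x1 t%:C x2' z0 (p +i* m t) z2 z3 z4 z5)) =
  kfun (2 * ka) u x1 0 x2' z0 (u + beta + z5) z2 z3 z4 z5.
Proof.
have d1 : (1 < 6)%N by [].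
have D1 : nth 0 [:: 0; 1; 0; 0; 0; 0] 1 = 1 :> R by [].
transitivity (2 * kfun ka u x1 0 x2' z0 (u + beta + z5) z2 z3 z4 z5); last first.
  by rewrite /kfun; ring.
rewrite (kfun_wave1 ka u x1 0 x2') -(wave_inversion tpsi _ _ _ _ d1 D1).
apply: eq_cint => t; under eq_cint do rewrite kfun_wave1.
rewrite (wave_shift tpsi _ _ _ _ d1 D1); apply: eq_cint => p.
rewrite /wave [RHS]mul_middle -cexpD.
by congr (_ * cexp _ * _); rewrite /kphase; ring.
Qed.

(** The momentum z4 enters the phase with the opposite sign, which calls for the reflected form of
    the inversion. *)
Lemma kfun_inversion4 ka u x1 x2 z0 z1 z2 z3 z5 (m : R -> R) :
  cint (fun t : R => cint (fun p : R => kfun ka u x1 x2 t%:C z0 z1 z2 z3 (p +i* m t) z5)) =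
  kfun (2 * ka) u x1 x2 0 z0 z1 z2 z3 (u + beta + z2) z5.
Proof.
have d1 : (4 < 6)%N by [].
have D1 : nth 0 [:: 0; 0; 0; 0; 1; 0] 4 = 1 :> R by [].
transitivity (2 * kfun ka u x1 x2 0 z0 z1 z2 z3 (u + beta + z2) z5); last first.
  by rewrite /kfun; ring.
rewrite (kfun_wave4 ka u x1 x2 0) -(wave_inversionN tpsi _ _ _ _ d1 D1).
apply: eq_cint => t; under eq_cint do rewrite kfun_wave4.
rewrite (wave_shift tpsi _ _ _ _ d1 D1); apply: eq_cint => p.
rewrite /wave [RHS]mul_middle -cexpD.
by congr (_ * cexp _ * _); rewrite /kphase; ring.
Qed.

(** Only the real part of x1 takes part in the inversion. Its imaginary part c stays in the phase as
    a constant and disappears at the end, since the coefficient of x1 vanishes at the value found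
    for z0. *)
Lemma kfun_inversion0 ka u (c : R) x2 x2' z1 z2 z3 z4 z5 (m : R -> R) :
  cint (fun t : R => cint (fun p : R => kfun ka u (t +i* c) x2 x2' (p +i* m t) z1 z2 z3 z4 z5)) =
  kfun (2 * ka) u 0 x2 x2' (z3 - z5 + z2) z1 z2 z3 z4 z5.
Proof.
have d1 : (0 < 6)%N by [].
have D1 : nth 0 [:: 1; 0; 0; 0; 0; 0] 0 = 1 :> R by [].
transitivity (2 * kfun ka u ('i * c%:C) x2 x2' (z3 - z5 + z2) z1 z2 z3 z4 z5); last first.
  by rewrite /kfun !mulrA; congr (_ * cexp _ * _); rewrite /kphase; ring.
rewrite (kfun_wave0 ka u ('i * c%:C)) -(wave_inversion tpsi _ _ _ _ d1 D1).
apply: eq_cint => t; under eq_cint do rewrite kfun_wave0.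
rewrite (wave_shift tpsi _ _ _ _ d1 D1); apply: eq_cint => p.
rewrite /wave [RHS]mul_middle -cexpD complexRI.
by congr (_ * cexp _ * _); rewrite /kphase; ring.
Qed.

(** Straightens the p1' contour and passes to the integration variable p1 = p1' - p3' + p3. *)
Lemma kfun_translate03 ka u z1 z4 (m p2 p5 : R) :
  cint (fun p : R => kfun ka u 0 0 0 (p +i* m - p5%:C + p2%:C) z1 p2%:C (p +i* m) z4 p5%:C) =
  cint (fun p : R => kfun ka u 0 0 0 p%:C z1 p2%:C (p%:C + p5%:C - p2%:C) z4 p5%:C).
Proof.
have d1 : (0 < 6)%N by [].
have D1 : nth 0 [:: 1; 0; 0; 1; 0; 0] 0 = 1 :> R by [].
under eq_cint do rewrite -addrA kfun_wave03.
rewrite (wave_shift tpsi _ _ _ _ d1 D1) -(cint_shift (p5 - p2)); last first.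
  exact: (nice_wave tpsi _ _ _ _ d1 D1 0).
apply: eq_cint => p; rewrite -kfun_wave03.
rewrite rmorphD rmorphB /= (_ : p%:C + (p5%:C - p2%:C) + (- p5%:C + p2%:C) = p%:C); last by ring.
by rewrite addrA.
Qed.
End Kernel.

(** * The Fourier transform of a test function on shifted contours *)

Section Decay.
Variable R : realType.
Local Notation C := R[i].
Implicit Types (v w m : nat -> R) (ks : seq nat).

Lemma good_exp ks (F : (nat -> R) -> C) (E : R) : mcont F ->
  (forall v, cabs (F v) <= expR (E - \sum_(k <- ks) `|v k|)) -> good ks F.
Proof.
move=> cF hF; split=> //; exists (expR E * 4 ^+ size ks) => v.
rewrite (le_trans (hF v))// expRD -mulrA ler_wpM2l ?expR_ge0//.
elim: ks {hF} => [|k ks IH]; first by rewrite !big_nil oppr0 expR0 mulr1.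
rewrite !big_cons opprD expRD exprS mulrACA.
by rewrite ler_pM ?expR_ge0// expRN_le_pk.
Qed.

Variable psi : 'rV[R[i]^o]_6 -> R[i]^o.
Hypothesis tpsi : test_function psi.

Definition expwave (f : nat -> C) (z : nat -> C) : C :=
  cexp (\sum_(k < 6) f k * z k) * psi (pt z).

Lemma ccvg_sum n (F : nat -> nat -> C) (l : nat -> C) : (forall k, ccvg (F k) (l k)) ->
  ccvg (fun i => \sum_(k < n) F k i) (\sum_(k < n) l k).
Proof.
move=> h; elim: n => [|n IH].
  by rewrite big_ord0; under eq_fun do rewrite big_ord0; exact: ccvg_cst.
by rewrite big_ord_recr/=; under eq_fun do rewrite big_ord_recr/=; exact: ccvgD.
Qed.

Lemma ccvg_shifted (u : nat -> nat -> R) v m :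
  (forall k, (fun n => u n k) @ \oo --> v k) ->
  forall k, ccvg (fun n => u n k +i* m k) (v k +i* m k).
Proof. by move=> h k; apply/ccvgP; split => //=; exact: cvg_cst. Qed.

Lemma Re_sum n (F : nat -> C) : Re (\sum_(k < n) F k) = \sum_(k < n) Re (F k).
Proof.
elim: n => [|n IH]; first by rewrite !big_ord0.
by rewrite !big_ord_recr/= -IH cReD.
Qed.

Lemma good_expwave (f : nat -> C) m :
  good [:: 0; 1; 2; 3; 4; 5]%N (fun v => expwave f (fun k => v k +i* m k)).
Proof.
(* As tube width it dominates each shift; as decay rate it exceeds each frequency by at least 1, the
   rate that survives. *)
pose a := 1 + \sum_(k < 6) (`|m k| + cabs (f k)).
have S0 : 0 <= \sum_(k < 6) (`|m k| + cabs (f k)).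
  by apply: sumr_ge0 => k _; rewrite addr_ge0 ?cabs_ge0.
have a0 : 0 <= a by rewrite addr_ge0.
have [L hL] := test_bound tpsi a0.
pose E := \sum_(k < 6) cabs (f k) * `|m k| + L.
apply: (@good_exp _ _ E).
  move=> u v uv; apply: ccvgM.
    apply: ccvg_cexp.
    apply: (@ccvg_sum 6 (fun k n => f k * (u n k +i* m k)) (fun k => f k * (v k +i* m k))) => k.
    by apply: ccvgM; [exact: ccvg_cst|exact: ccvg_shifted].
  by apply: test_cvg => // k _; exact: ccvg_shifted.
move=> v; rewrite /expwave cabsM cabs_cexp.
have bnd (j : nat) : (j < 6)%N -> `|m j| + cabs (f j) + 1 <= a.
  move=> j6; rewrite /a addrC lerD2l (bigD1 (Ordinal j6))//= lerDl sumr_ge0// => k _.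
  by rewrite addr_ge0 ?cabs_ge0.
have h1 := hL (fun k => v k +i* m k).
apply: (le_trans (ler_wpM2l (expR_ge0 _) (h1 _))).
  move=> k k6 /=; rewrite (le_trans _ (bnd k k6))// -addrA lerDl.
  by rewrite addr_ge0// cabs_ge0.
rewrite -expRD ler_expR (@Re_sum 6 (fun k => f k * (v k +i* m k))) /E.
have -> : \sum_(k <- [:: 0; 1; 2; 3; 4; 5]%N) `|v k| = \sum_(k < 6) `|v k|.
  by rewrite !big_ord_recl big_ord0 !big_cons big_nil.
rewrite addrCA [leRHS]addrAC [leRHS]addrC lerD2l.
rewrite lerBlDr addrAC -lerBlDr opprK mulr_sumr -!big_split/=.
apply: ler_sum => k _; rewrite cReM /=.
have h2 : Re (f k) * v k <= cabs (f k) * `|v k|.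
  by rewrite (le_trans (ler_norm _))// normrM ler_wpM2r// ler_Re_cabs.
have h3 : - (Im (f k) * m k) <= cabs (f k) * `|m k|.
  by rewrite (le_trans (ler_norm _))// normrN normrM ler_wpM2r// ler_Im_cabs.
have h4 : (`|m k| + cabs (f k) + 1) * `|v k| <= a * `|v k|.
  by rewrite ler_wpM2r// bnd.
have h5 : 0 <= `|m k| * `|v k| by rewrite mulr_ge0.
rewrite [leLHS]mulrDl [X in X + _ <= _]mulrDl mul1r in h4; lra.
Qed.

Lemma expwave_shift (f : nat -> C) m k w : (k < 6)%N ->
  iint [:: 0; 1; 2; 3; 4; 5]%N (fun v => expwave f (fun j => v j +i* m j)) w =
  iint [:: 0; 1; 2; 3; 4; 5]%N (fun v => expwave f (fun j => v j +i* upd m k 0 j)) w.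
Proof.
move=> k6; apply: (@eq_iint_cint _ k).
- by case: k k6 => [|[|[|[|[|[|]]]]]].
- by [].
- exact: good_expwave.
- exact: good_expwave.
move=> v; pose D (j : nat) : R := (j == k)%:R.
have Dk : D k = 1 by rewrite /D eqxx.
pose z (j : nat) : C := if j == k then 0 else v j +i* m j.
pose W := wave psi 1 (\sum_(j < 6) f j * z j) (\sum_(j < 6) f j * (D j)%:C) z D.
have WE (p : C) : W p = expwave f (fun j => z j + p * (D j)%:C).
  rewrite /W /wave /expwave mul1r; congr (cexp _ * _).
  by rewrite mulr_suml -big_split/=; apply: eq_bigr => j _; ring.
have E1 t : expwave f (fun j => upd v k t j +i* m j) = W (t +i* m k).
  rewrite WE; congr (expwave f _); apply/funext => j.
  rewrite /upd /z /D; case: (j =P k) => [->|_]; first by rewrite rmorph1 mulr1 add0r.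
  by rewrite rmorph0 mulr0 addr0.
have E2 t : expwave f (fun j => upd v k t j +i* upd m k 0 j) = W t%:C.
  rewrite WE; congr (expwave f _); apply/funext => j.
  rewrite /upd /z /D; case: eqVneq => [_|_]; first by rewrite rmorph1 mulr1 add0r.
  by rewrite rmorph0 mulr0 addr0.
rewrite (eq_cint E1) (eq_cint E2).
exact: (wave_shift tpsi _ _ _ _ k6 Dk).
Qed.

Lemma expwave_unshift (f : nat -> C) m w :
  iint [:: 0; 1; 2; 3; 4; 5]%N (fun v => expwave f (fun j => v j +i* m j)) w =
  iint [:: 0; 1; 2; 3; 4; 5]%N (fun v => expwave f (fun j => (v j)%:C)) w.
Proof.
have E (k : nat) m' : (k < 6)%N -> _ := fun k6 => @expwave_shift f m' k w k6.
rewrite (E 0%N m isT) (E 1%N _ isT) (E 2%N _ isT) (E 3%N _ isT) (E 4%N _ isT) (E 5%N _ isT).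
apply: eq_iint => v; rewrite /expwave; congr (cexp _ * psi _).
  by apply: eq_bigr => -[k kk] _; move: k kk => [|[|[|[|[|[|//]]]]]].
by apply/matrixP => i [k kk]; rewrite !mxE; move: k kk => [|[|[|[|[|[|//]]]]]].
Qed.

Definition fourier_freq (x0 x1 x2 x3 x4 x5 : C) (k : nat) : C :=
  cpi R * 'i * nth 0 [:: - x0; - x1; - x2; x3; x4; x5] k.

(** The shifts [m] are arbitrary at each fixed x, so they may be chosen as functions of x. *)
Lemma fourier_test_shift (x0 x1 x2 x3 x4 x5 : C) m w :
  fourier_test psi (pt6 x0 x1 x2 x3 x4 x5) =
  iint [:: 0; 1; 2; 3; 4; 5]%N
    (fun v => expwave (fourier_freq x0 x1 x2 x3 x4 x5) (fun k => v k +i* m k)) w.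
Proof.
rewrite expwave_unshift /fourier_test.
pose F v : C := cexp (cpi R * 'i * ((v 3)%:C * x3 + (v 4)%:C * x4 + (v 5)%:C * x5
  - (v 0)%:C * x0 - (v 1)%:C * x1 - (v 2)%:C * x2))
  * psi (pt6 (v 0)%:C (v 1)%:C (v 2)%:C (v 3)%:C (v 4)%:C (v 5)%:C).
transitivity (iint [:: 0; 1; 2; 3; 4; 5]%N F w).
  rewrite /iint /F; do 6 (apply: eq_cint => ?).
  by rewrite !mxE !inordK.
apply: eq_iint => v; rewrite /F /expwave; congr (cexp _ * psi _).
  rewrite -(big_mkord xpredT (fun k => fourier_freq x0 x1 x2 x3 x4 x5 k * (v k)%:C)).
  by rewrite !big_nat_recl// big_geq// /fourier_freq ![nth _ _ _]/=; ring.
apply/matrixP => i j; rewrite !mxE.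
by case: j => -[|[|[|[|[|[|//]]]]]] hj.
Qed.
End Decay.

(** * Continuity and bounds of the integrands *)

Section Integrand.
Variable R : realType.
Local Notation C := R[i].
Variable psi : 'rV[R[i]^o]_6 -> R[i]^o.
Hypothesis tpsi : test_function psi.
Variables (b : C) (b0 : 0 < Re b).
Variables (v0 : R) (hv0 : v0 < Re (eta b)) (w0 beta A ka : C).
Implicit Types (v : nat -> R).

Local Notation kf := (kfun psi b w0 beta A ka).

Lemma C1on_qdilog : C1on (fun z => `|Im z| <= v0) (qdilog b).
Proof.
apply: C1on_cexp; apply: C1onM; first exact: C1on_cst.
exact: C1on_dilog_int.
Qed.

Lemma kfun_cvg (u x1 x2 x2' z0 z1 z2 z3 z4 z5 : nat -> C) (u_ y1 y2 y2' p0 p1 p2 p3 p4 p5 : C) :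
  (forall n, `|Im (u n + w0)| <= v0) -> `|Im (u_ + w0)| <= v0 ->
  ccvg u u_ -> ccvg x1 y1 -> ccvg x2 y2 -> ccvg x2' y2' -> ccvg z0 p0 -> ccvg z1 p1 ->
  ccvg z2 p2 -> ccvg z3 p3 -> ccvg z4 p4 -> ccvg z5 p5 ->
  ccvg (fun n => kf (u n) (x1 n) (x2 n) (x2' n) (z0 n) (z1 n) (z2 n) (z3 n) (z4 n) (z5 n))
    (kf u_ y1 y2 y2' p0 p1 p2 p3 p4 p5).
Proof.
move=> su su_ hu h1 h2 h2' g0 g1 g2 g3 g4 g5.
have cc (l : C) := @ccvg_cst R l.
apply: ccvgM.
  apply: ccvgM.
    apply: ccvgM; first exact: cc.
    exact: (C1on_cont C1on_qdilog (u := fun n => u n + w0) su su_ (ccvgD hu (cc w0))).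
  apply: ccvg_cexp; apply: ccvgM; first exact: cc.
  exact: (ccvgD (ccvgB (ccvgD (ccvgB
    (ccvgM h2 (ccvgB (ccvgD (ccvgD hu (cc beta)) g5) g1))
    (ccvgM h2' (ccvgB (ccvgD (ccvgD hu (cc beta)) g2) g4)))
    (ccvgM h1 (ccvgB (ccvgD (ccvgB g3 g5) g2) g0)))
    (ccvgM hu (ccvgB g3 g5))) (ccvgM (ccvgD hu (cc beta)) (cc A))).
apply: (test_cvg tpsi (u := fun n => nth 0 [:: z0 n; z1 n; z2 n; z3 n; z4 n; z5 n])).
by move=> -[|[|[|[|[|[|]]]]]].
Qed.

(** The order of quantifiers matters: the growth rate [B] of phi is fixed first, so that the decay
    rate [a] can be taken larger; only the constant [E] depends on [a]. *)
Lemma kfun_bound : exists2 B : R, 0 <= B & forall a : R, 0 <= a -> exists E : R,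
  forall u x1 x2 x2' z0 z1 z2 z3 z4 z5 : C, `|Im (u + w0)| <= v0 ->
  `|Im z0| <= a -> `|Im z1| <= a -> `|Im z2| <= a ->
  `|Im z3| <= a -> `|Im z4| <= a -> `|Im z5| <= a ->
  cabs (kf u x1 x2 x2' z0 z1 z2 z3 z4 z5) <=
  expR (E + B * `|Re u| - pi * Im (kphase beta A u x1 x2 x2' z0 z1 z2 z3 z4 z5)
    - a * (`|Re z0| + `|Re z1| + `|Re z2| + `|Re z3|
           + `|Re z4| + `|Re z5|)).
Proof.
have [[A1 B1] hAB] := qdilog_growth b0 hv0.
exists `|B1|; first exact: normr_ge0.
move=> a a0; have [L hL] := test_bound tpsi a0.
exists (ln (cabs ka + 1) + (A1 + `|B1| * `|Re w0|) + L).
move=> u x1 x2 x2' z0 z1 z2 z3 z4 z5 su i0 i1 i2 i3 i4 i5.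
have hpsi := hL (nth 0 [:: z0; z1; z2; z3; z4; z5]).
have {}hpsi : cabs (psi (pt6 z0 z1 z2 z3 z4 z5)) <=
    expR (L - a * (`|Re z0| + `|Re z1| + `|Re z2| + `|Re z3|
           + `|Re z4| + `|Re z5|)).
  rewrite pt6E (le_trans (hpsi _))//.
    by move=> -[|[|[|[|[|[|]]]]]].
  rewrite -(big_mkord xpredT (fun k => `|Re (nth 0 [:: z0; z1; z2; z3; z4; z5] k)|)).
  by rewrite !big_nat_recl// big_geq// ![nth _ _ _]/= addr0 !addrA.
have hka : cabs ka <= expR (ln (cabs ka + 1)).
  by rewrite lnK ?posrE ?ltr_wpDl ?cabs_ge0// lerDl.
have hq : cabs (qdilog b (u + w0)) <=
    expR (A1 + `|B1| * `|Re w0| + `|B1| * `|Re u|).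
  rewrite (le_trans (hAB _ su))// ler_expR -[(A1, B1).1]/A1 -[(A1, B1).2]/B1 -addrA lerD2l.
  rewrite -mulrDr cReD (@le_trans _ _ (`|B1| * `|Re u + Re w0|))//.
    by rewrite ler_wpM2r// ler_norm.
  by rewrite ler_wpM2l// addrC ler_normD.
rewrite /kfun 3!cabsM cabs_cexp; set K := kphase _ _ _ _ _ _ _ _ _ _ _ _.
have -> : Re (cpi R * 'i * K) = - (pi * Im K).
  by rewrite -mulrA cReZ cReM /= mul0r mul1r sub0r mulrN.
apply: le_trans (ler_pM _ _ (ler_pM _ _ (ler_pM _ _ hka hq) (lexx _)) hpsi) _;
  rewrite ?mulr_ge0 ?cabs_ge0 ?expR_ge0//.
rewrite -!expRD ler_expR le_eqVlt; apply/orP; left; apply/eqP; ring.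
Qed.

Lemma ler_mul_norm (x y Y : R) : `|y| <= Y -> x * y <= `|x| * Y.
Proof. by move=> h; rewrite (le_trans (ler_norm _))// normrM ler_wpM2l. Qed.

(** Here u = p2 - p3' - beta, and p1', p2' are eliminated by the delta functions. The free variables
    p1, p2, p3, p3' have the numbers 0, 1, 2, 5. *)
Definition momentum_integrand (y : R) v : C :=
  kf ((v 1) +i* y - (v 5)%:C - beta) 0 0 0 (v 0)%:C ((v 1) +i* y) (v 2)%:C
    ((v 0)%:C + (v 5)%:C - (v 2)%:C) ((v 1) +i* y + (v 2)%:C - (v 5)%:C) (v 5)%:C.

(** The constant is uniform over all admissible heights y, as a shift between two heights
    requires. *)
Lemma momentum_integrand_bound : exists E : R, forall (y : R) v,
  `|y - Im beta + Im w0| <= v0 ->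
  cabs (momentum_integrand y v) <= expR (E - (`|v 0| + `|v 1| + `|v 2| + `|v 5|)).
Proof.
have [B B_ge0 hB] := kfun_bound.
(* Bounds |y| for every admissible height. *)
pose Y := `|v0| + `|Im beta| + `|Im w0|.
have Y0 : 0 <= Y by rewrite !addr_ge0.
pose N := Y + `|Im beta| + `|Im A|.
have N0 : 0 <= N by rewrite !addr_ge0.
have pN : 0 <= pi * N by rewrite mulr_ge0 ?pi_ge0.
(* [B] pays for phi, [pi * N] for the phase, 1 is the decay that is left, and [Y] makes the tube
   wide enough. *)
pose a := B + pi * N + 1 + Y.
have a0 : 0 <= a by rewrite !addr_ge0.
have [E hE] := hB a a0.
exists (E + B * `|Re beta| + pi * (`|Re beta| * `|Im A| + Y * `|Re A|)).
move=> y v sy.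
have yY : `|y| <= Y.
  have := ler_norm v0; have := ler_normB (y - Im beta + Im w0) (Im w0 - Im beta).
  rewrite (_ : _ - (Im w0 - Im beta) = y); last by ring.
  by have := ler_normB (Im w0) (Im beta); rewrite /Y; lra.
have Ya : Y <= a by rewrite /a lerDr !addr_ge0.
apply: (le_trans (hE _ _ _ _ _ _ _ _ _ _ _ _ _ _ _ _ _)).
- by rewrite !cImD !cImN /= subr0.
- by rewrite /= normr0.
- exact: le_trans yY Ya.
- by rewrite /= normr0.
- by rewrite !cImD !cImN /= subr0 addr0 normr0.
- by rewrite !cImD !cImN /= subr0 addr0 (le_trans yY Ya).
- by rewrite /= normr0.
rewrite ler_expR.
have -> : Re (v 1 +i* y - (v 5)%:C - beta) = v 1 - v 5 - Re beta.
  by rewrite !cReD !cReN.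
rewrite [`|Re (v 0)%:C|]/= [`|Re (v 1 +i* y)|]/= [`|Re (v 2)%:C|]/=
  [`|Re (v 5)%:C|]/=.
have -> : Im (kphase beta A (v 1 +i* y - (v 5)%:C - beta) 0 0 0 (v 0)%:C (v 1 +i* y)
   (v 2)%:C ((v 0)%:C + (v 5)%:C - (v 2)%:C) (v 1 +i* y + (v 2)%:C - (v 5)%:C) (v 5)%:C) =
   - ((v 0 - v 2) * (y - Im beta)) + (v 1 - v 5) * Im A + y * Re A.
  by rewrite /kphase !(cImD, cImN, cImM, cReD, cReN, cReM) /=; ring.
have Z30 := normr_ge0 (Re ((v 0)%:C + (v 5)%:C - (v 2)%:C)).
have Z40 := normr_ge0 (Re (v 1 +i* y + (v 2)%:C - (v 5)%:C)).
move: Z30 Z40; move: (`|Re (_ + _ - _)|) (`|Re (_ +i* _ + _ - _)|) => Z3 Z4 Z30 Z40.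
clear hE hB.
have t1 : `|v 1 - v 5 - Re beta| <= `|v 1| + `|v 5| + `|Re beta|.
  by rewrite (le_trans (ler_normB _ _))// lerD2r ler_normB.
have t2 : (v 0 - v 2) * (y - Im beta) <= (`|v 0| + `|v 2|) * N.
  apply: le_trans (ler_mul_norm _ (Y := N) _) _; last by rewrite ler_wpM2r// ler_normB.
  by rewrite (le_trans (ler_normB _ _))// /N -addrA lerD// lerDl.
have t3 : (v 5 - v 1) * Im A <= (`|v 1| + `|v 5|) * N.
  apply: le_trans (ler_mul_norm _ (Y := N) _) _; last by rewrite ler_wpM2r// [`|v 1| + _]addrC ler_normB.
  by rewrite /N lerDr addr_ge0.
have t4 : - (y * Re A) <= Y * `|Re A|.
  by rewrite (le_trans (ler_norm _))// normrN normrM ler_wpM2r.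
pose S := `|v 0| + `|v 1| + `|v 2| + `|v 5|.
have S1 : S + 0 <= `|v 0| + `|v 1| + `|v 2| + Z3 + Z4 + `|v 5| by rewrite /S; lra.
have u1 := ler_wpM2l B_ge0 t1.
have u2 : - (pi * (- ((v 0 - v 2) * (y - Im beta)) + (v 1 - v 5) * Im A + y * Re A))
   <= pi * N * S + pi * (Y * `|Re A|).
  rewrite -mulrN -mulrA -mulrDr ler_wpM2l ?pi_ge0// /S; lra.
have u3 := ler_wpM2l a0 S1.
have u4 : B * (`|v 1| + `|v 5|) <= B * S.
  by rewrite ler_wpM2l// /S; have := normr_ge0 (v 0); have := normr_ge0 (v 2); lra.
have u5 : B * S + pi * N * S + S <= a * S.
  rewrite [leLHS](_ : _ = (B + pi * N + 1) * S); last by ring.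
  by rewrite ler_wpM2r ?addr_ge0// lerDl.
have u6 : 0 <= pi * (`|Re beta| * `|Im A|) by rewrite !mulr_ge0 ?pi_ge0.
rewrite -/S; rewrite addr0 in u3; rewrite [_ * (_ + _)]mulrDr in u1.
rewrite [pi * (_ + _ * `|Re A|)]mulrDr; lra.
Qed.
End Integrand.

(** * Contour of p2 and absolute convergence of the tenfold integral *)

Section AbsoluteConvergence.
Variable R : realType.
Local Notation C := R[i].
Variable psi : 'rV[R[i]^o]_6 -> R[i]^o.
Hypothesis tpsi : test_function psi.
Variables (b : C) (b0 : 0 < Re b).
Variables (v0 : R) (hv0 : v0 < Re (eta b)) (w0 beta A ka : C).
Implicit Types (v : nat -> R).

Local Notation kf := (kfun psi b w0 beta A ka).
Local Notation mi := (momentum_integrand psi b w0 beta A ka).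
Let in_strip (y : R) := `|y - Im beta + Im w0| <= v0.

Lemma good_momentum_integrand (y : R) : in_strip y -> good [:: 0; 1; 2; 5]%N (mi y).
Proof.
move=> sy; have [E hE] := momentum_integrand_bound tpsi b0 hv0 w0 beta A ka.
apply: (good_exp (E := E)).
  move=> u v uv; have r k := ccvg_real (uv k); have cc (l : C) := @ccvg_cst R l.
  have g1 : ccvg (fun n => u n 1 +i* y) (v 1 +i* y).
    by apply/ccvgP; split => /=; [exact: uv|exact: cvg_cst].
  have st t s : `|Im (t +i* y - s%:C - beta + w0)| <= v0.
    by rewrite !cImD !cImN /= subr0.
  exact: (kfun_cvg tpsi b0 hv0 beta A ka (fun n => st _ _) (st _ _) (ccvgB (ccvgB g1 (r 5)) (cc beta))
    (cc 0) (cc 0) (cc 0) (r 0) g1 (r 2) (ccvgB (ccvgD (r 0) (r 5)) (r 2))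
    (ccvgB (ccvgD g1 (r 2)) (r 5)) (r 5)).
move=> v; rewrite (le_trans (hE y v sy))// ler_expR lerD2l lerN2.
by rewrite !big_cons big_nil addr0 !addrA.
Qed.

(** Here phi depends on p2 as well and stays outside the wave. As p2' = p2 + p3 - p3' follows p2,
    the direction has entries 1 at both places. *)
Lemma momentum_integrand_wave (y : R) v (t : R) : mi y (upd v 1 t) =
  qdilog b (1 * (t +i* y) + (w0 - (v 5)%:C - beta)) *
  wave psi ka (cpi R * 'i * (((v 5)%:C + beta) * ((v 0)%:C - (v 2)%:C) - (v 5)%:C * A))
    (cpi R * 'i * (A - ((v 0)%:C - (v 2)%:C)))
    (nth 0 [:: (v 0)%:C; 0; (v 2)%:C; (v 0)%:C + (v 5)%:C - (v 2)%:C; (v 2)%:C - (v 5)%:C; (v 5)%:C])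
    (nth 0 [:: 0; 1; 0; 0; 1; 0]) (t +i* y).
Proof.
rewrite /wave pt6_line !(rmorph0, rmorph1, mulr0, mulr1, addr0, add0r).
rewrite /momentum_integrand /upd /= /kfun mul1r addrA.
set p := t +i* y.
rewrite (_ : p - (v 5)%:C - beta + w0 = p + (w0 - (v 5)%:C) - beta); last by ring.
rewrite [ka * _]mulrC !mulrA; congr (_ * cexp _ * psi (pt6 _ _ _ _ _ _)); rewrite ?/kphase; ring.
Qed.

Lemma momentum_integrand_shift (y1 y2 : R) w : in_strip y1 -> in_strip y2 ->
  iint [:: 0; 1; 2; 5]%N (mi y1) w = iint [:: 0; 1; 2; 5]%N (mi y2) w.
Proof.
wlog y12 : y1 y2 / y1 <= y2.
  move=> H s1 s2; have [|/ltW] := leP y1 y2; first by move/H; apply.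
  by move/H => -> //.
move=> s1 s2; apply: (@eq_iint_cint _ 1) => //; try exact: good_momentum_integrand.
move=> v; have [E hE] := momentum_integrand_bound tpsi b0 hv0 w0 beta A ka.
under eq_cint do rewrite momentum_integrand_wave.
under [RHS]eq_cint do rewrite momentum_integrand_wave.
set al := cpi R * 'i * _; set ga := cpi R * 'i * _; set z := nth _ _; set D := nth _ _.
have inb y : y1 <= y <= y2 -> in_strip y.
  move: s1 s2; rewrite /in_strip !ler_norml => /andP[h1 h2] /andP[h3 h4] /andP[h5 h6].
  by apply/andP; split; lra.
apply: (@cint_strip_shift _ (fun p => qdilog b (1 * p + (w0 - (v 5)%:C - beta)) * wave psi ka al ga z D p)
  y1 y2 (expR (E) * 4)) => //.
  apply: C1onM; last exact: C1onS (wave_C1on tpsi _ _ _ _ _).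
  apply: (C1on_comp (C1on_affine _ _ _) (C1on_qdilog b0 hv0)) => -[t y] /inb.
  by rewrite /in_strip mul1r !cImD !cImN /= subr0 [Im w0 - _]addrC addrA.
move=> t y /inb sy; have := hE y (upd v 1 t) sy.
rewrite momentum_integrand_wave => /le_trans; apply.
rewrite -mulrA expRD ler_wpM2l ?expR_ge0// (le_trans _ (expRN_le_pk t))// ler_expR lerN2 /upd /=.
have := normr_ge0 (v 0); have := normr_ge0 (v 2); have := normr_ge0 (v 5); lra.
Qed.

Variable c : R.

(** A continuous replacement for the sign: bounded by 1, with x * damp x >= |x| - 1. The jump of the
    sign itself would destroy the continuity that [good] demands. *)
Definition damp (x : R) : R := x / (1 + `|x|).

Lemma damp_cvg (u : nat -> R) x : u @ \oo --> x -> (fun n => damp (u n)) @ \oo --> damp x.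
Proof.
move=> ux; apply: cvgM => //; apply: cvgV; first by rewrite gt_eqF// ltr_pwDl.
by apply: cvgD; [exact: cvg_cst|exact: cvg_norm].
Qed.

Lemma damp_le1 (x : R) : `|damp x| <= 1.
Proof.
have x1 : 0 < 1 + `|x| by rewrite ltr_pwDl.
by rewrite normrM normfV (gtr0_norm x1) ler_pdivrMr// mul1r lerDr.
Qed.

Lemma mul_damp_ge (x : R) : `|x| - 1 <= x * damp x.
Proof.
have x1 : 0 < 1 + `|x| by rewrite ltr_pwDl.
rewrite /damp mulrA ler_pdivlMr// -expr2 -real_normK ?num_real//.
rewrite [leLHS](_ : _ = `|x| ^+ 2 - 1); last by ring.
by rewrite gerBl.
Qed.

(* The coordinates 0, ..., 5 of [v] are p1, p2, p3, p1', p2', p3'; the coordinates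
   6, ..., 9 are Re x1, x2, Re (x1 - x1'), x2'. *)
Definition full_integrand (M0 M1 : R) v : C :=
  kf (v 8 +i* c) (v 6 +i* c) (v 7)%:C (v 9)%:C
    (v 0 +i* (- (M1 * damp (v 6)))) (v 1 +i* (- (M0 * damp (v 7)))) (v 2)%:C
    (v 3 +i* (- (M0 * damp (v 8)))) (v 4 +i* (M0 * damp (v 9))) (v 5)%:C.

(** Damping of strength M beats growth at rate K with at least one unit to spare; P is instantiated
    by pi. *)
Lemma damping_bound (P M K X x : R) : 1 <= P -> 0 <= M -> K + 1 <= M -> X <= P * K * `|x| ->
  X - P * (M * (x * damp x)) <= P * M - `|x|.
Proof.
move=> P1 M0 KM XK; have P0 : 0 <= P by rewrite (le_trans _ P1).
have dx := mul_damp_ge x.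
have h1 : P * M * (`|x| - 1) <= P * M * (x * damp x) by rewrite ler_wpM2l// mulr_ge0.
have h2 : P * (K + 1) * `|x| <= P * M * `|x| by rewrite ler_wpM2r// ler_wpM2l.
have h3 : 1 * `|x| <= P * `|x| by rewrite ler_wpM2r.
lra.
Qed.

Lemma ccvg_mkcomplex (u w : nat -> R) (x y : R) : u @ \oo --> x -> w @ \oo --> y ->
  ccvg (fun n => u n +i* w n) (x +i* y).
Proof. by move=> ux wy; apply/ccvgP. Qed.

Lemma mcont_full_integrand (M0 M1 : R) : `|c + Im w0| <= v0 ->
  mcont (full_integrand M0 M1).
Proof.
move=> sc u v uv; have r k := ccvg_real (uv k).
have g (k : nat) (w : nat -> R) (y : R) : w @ \oo --> y -> ccvg (fun n => u n k +i* w n) (v k +i* y).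
  by move=> wy; apply: ccvg_mkcomplex.
have dm (M : R) k : (fun n => M * damp (u n k)) @ \oo --> M * damp (v k).
  by apply: cvgM; [exact: cvg_cst|exact: damp_cvg].
have dn (M : R) k : (fun n => - (M * damp (u n k))) @ \oo --> - (M * damp (v k)).
  by apply: cvgN; exact: dm.
have st t : `|Im (t +i* c + w0)| <= v0 by rewrite cImD.
apply: (kfun_cvg tpsi b0 hv0 beta A ka (fun n => st _) (st _) (g 8 _ _ (cvg_cst _)) (g 6 _ _ (cvg_cst _))
  (r 7) (r 9) (g 0 _ _ (dn M1 6)) (g 1 _ _ (dn M0 7)) (r 2) (g 3 _ _ (dn M0 8))
  (g 4 _ _ (dm M0 9)) (r 5)).
Qed.

Lemma good_full_integrand : `|c + Im w0| <= v0 -> exists M : R * R,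
  good [:: 6; 7; 8; 9; 0; 1; 2; 3; 4; 5]%N (full_integrand M.1 M.2).
Proof.
move=> sc; have [B B_ge0 hB] := kfun_bound tpsi b0 hv0 w0 beta A ka.
pose s := c + Im beta.
(* [M0] beats the growth |s| in x2 and x2', and the growth from phi and A in u. The p1' shift
   reappears as x1 times at most [M0], hence the stronger [M1] for p1. *)
pose M0 := `|s| + B + `|Im A| + 1; pose M1 := M0 + 1.
have M0_ge0 : 0 <= M0 by rewrite !addr_ge0.
have M1_ge0 : 0 <= M1 by rewrite !addr_ge0.
have P1 := @pi_ge1 R; have P0 := pi_ge0 R.
(* [M1] is the largest shift, [pi * |c|] comes from the imaginary part of x1 multiplying p3 - p1,
   and 1 is the remaining decay. *)
pose a := M1 + pi * `|c| + 1.
have a0 : 0 <= a by rewrite !addr_ge0// mulr_ge0.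
have [E hE] := hB a a0; exists (M0, M1); rewrite -[(M0, M1).1]/M0 -[(M0, M1).2]/M1.
pose E' := E + pi * M1 + pi * M0 + pi * M0 + pi * M0
  + pi * (`|Re beta| * `|Im A|) + pi * (`|s| * `|Re A|).
apply: (good_exp (E := E')); first exact: mcont_full_integrand.
move=> v.
have Ma : M1 <= a by rewrite /a -addrA lerDl addr_ge0// mulr_ge0.
have dM (M : R) k : 0 <= M -> M <= M1 -> `|M * damp (v k)| <= a.
  move=> Mp MM; rewrite normrM ger0_norm// (le_trans _ Ma)// (le_trans _ MM)//.
  by rewrite ler_piMr// damp_le1.
have M01 : M0 <= M1 by rewrite /M1 lerDl.
apply: (le_trans (hE _ _ _ _ _ _ _ _ _ _ _ _ _ _ _ _ _)).
- by rewrite cImD.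
- by rewrite /= normrN dM.
- by rewrite /= normrN dM.
- by rewrite /= normr0.
- by rewrite /= normrN dM.
- by rewrite /= dM.
- by rewrite /= normr0.
rewrite ler_expR.
have -> : Im (kphase beta A (v 8 +i* c) (v 6 +i* c) (v 7)%:C (v 9)%:C
    (v 0 +i* (- (M1 * damp (v 6)))) (v 1 +i* (- (M0 * damp (v 7)))) (v 2)%:C
    (v 3 +i* (- (M0 * damp (v 8)))) (v 4 +i* (M0 * damp (v 9))) (v 5)%:C) =
   v 7 * s + M0 * (v 7 * damp (v 7)) - v 9 * s + M0 * (v 9 * damp (v 9))
   - v 6 * (M0 * damp (v 8)) + M1 * (v 6 * damp (v 6)) + c * (v 2 - v 0)
   + M0 * (v 8 * damp (v 8)) + (v 8 + Re beta) * Im A + s * Re A.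
  by rewrite /kphase !(cImD, cImN, cImM, cReD, cReN, cReM) /s /=; ring.
rewrite [`|Re _|]/= [`|Re (v 0 +i* _)|]/= [`|Re (v 1 +i* _)|]/=
  [`|Re (v 2)%:C|]/= [`|Re (v 3 +i* _)|]/= [`|Re (v 4 +i* _)|]/=
  [`|Re (v 5)%:C|]/=.
clear hB hE.
have mx (x y : R) : x * y <= `|x| * `|y| by rewrite (le_trans (ler_norm _))// normrM.
have mn (x y : R) : - (x * y) <= `|x| * `|y| by rewrite (le_trans (ler_norm _))// normrN normrM.
have k1 : `|s| + 1 <= M0.
  by rewrite /M0; have := normr_ge0 (Im A); lra.
have d7 : - (pi * (v 7 * s)) - pi * (M0 * (v 7 * damp (v 7))) <= pi * M0 - `|v 7|.
  apply: (damping_bound P1 M0_ge0 k1).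
  by rewrite -mulrN -mulrA ler_wpM2l// [leRHS]mulrC mn.
have d9 : pi * (v 9 * s) - pi * (M0 * (v 9 * damp (v 9))) <= pi * M0 - `|v 9|.
  apply: (damping_bound P1 M0_ge0 k1).
  by rewrite -mulrA ler_wpM2l// [leRHS]mulrC mx.
have d6 : pi * (v 6 * (M0 * damp (v 8))) - pi * (M1 * (v 6 * damp (v 6))) <= pi * M1 - `|v 6|.
  apply: (damping_bound P1 M1_ge0 (lexx (M0 + 1))).
  rewrite -[leRHS]mulrA ler_wpM2l// (le_trans (mx _ _))// [leRHS]mulrC ler_wpM2l//.
  by rewrite normrM ger0_norm// ler_piMr// damp_le1.
have d8 : (B * `|v 8| - pi * (v 8 * Im A)) - pi * (M0 * (v 8 * damp (v 8))) <= pi * M0 - `|v 8|.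
  apply: (damping_bound (K := B + `|Im A|) P1 M0_ge0).
    by rewrite /M0; have := normr_ge0 s; lra.
  rewrite [leRHS](_ : _ = pi * (B * `|v 8|) + pi * (`|v 8| * `|Im A|)); last by ring.
  rewrite lerD//.
    by rewrite ler_peMl// mulr_ge0.
  by rewrite -mulrN ler_wpM2l// mn.
have d0 : - (pi * (c * (v 2 - v 0))) <= pi * `|c| * (`|v 0| + `|v 2|).
  rewrite -mulrN -mulrA ler_wpM2l// (le_trans (mn _ _))// ler_wpM2l//.
  by rewrite [leRHS]addrC ler_normB.
have dA : - (pi * (Re beta * Im A)) <= pi * (`|Re beta| * `|Im A|).
  by rewrite -mulrN ler_wpM2l// mn.
have dB : - (pi * (s * Re A)) <= pi * (`|s| * `|Re A|).
  by rewrite -mulrN ler_wpM2l// mn.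
have a1 : (pi * `|c| + 1) * (`|v 0| + `|v 1| + `|v 2| + `|v 3| + `|v 4| + `|v 5|) <=
    a * (`|v 0| + `|v 1| + `|v 2| + `|v 3| + `|v 4| + `|v 5|).
  by rewrite ler_wpM2r ?addr_ge0// /a -addrA lerDr.
have a2 : pi * `|c| * (`|v 0| + `|v 2|) <=
    pi * `|c| * (`|v 0| + `|v 1| + `|v 2| + `|v 3| + `|v 4| + `|v 5|).
  rewrite ler_wpM2l ?mulr_ge0//.
  have := normr_ge0 (v 1); have := normr_ge0 (v 3); have := normr_ge0 (v 4); have := normr_ge0 (v 5); lra.
rewrite !big_cons big_nil /E'; lra.
Qed.
End AbsoluteConvergence.

(** * Comparison of the two kernels *)

Section Assembly.
Variable R : realType.
Local Notation C := R[i].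

Lemma iintZ (a : C) ks (F : (nat -> R) -> C) v : uniq ks -> good ks F ->
  iint ks (fun v => a * F v) v = a * iint ks F v.
Proof.
elim: ks v => //= k ks IH v /andP[kn uks] gF.
have gk : good (ks ++ [:: k]) F by apply: good_perm gF; rewrite perm_sym perm_catC.
have uk : uniq (ks ++ [:: k]) by rewrite cats1 rcons_uniq kn.
have ge := good_iint uk gk.
have n1 : nice (fun t => iint ks F (upd v k t)) by exact: (good_nice v _ ge).
rewrite -(cintZ a n1); apply: eq_cint => t; apply: IH => //.
exact: (@good_catr _ ks [:: k]).
Qed.

Lemma eq_iint_in ks (F G : (nat -> R) -> C) v :
  (forall w, (forall j, j \notin ks -> w j = v j) -> F w = G w) ->
  iint ks F v = iint ks G v.
Proof.
elim: ks v => [|k ks IH] v FG /=; first exact: FG.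
apply: eq_cint => t; apply: IH => w hw; apply: FG => j.
by rewrite inE negb_or => /andP[jk jn]; rewrite hw// /upd (negbTE jk).
Qed.

(** Brings the variables [ys] innermost and returns the majorant for what remains, so that it can be
    used repeatedly. *)
Lemma iint_split ks xs ys (F : (nat -> R) -> C) : good ks F -> uniq ks ->
  perm_eq ks (xs ++ ys) -> (forall v, iint ks F v = iint xs (iint ys F) v) /\ good xs (iint ys F).
Proof.
move=> gF uk p; split=> [v|]; first by rewrite (iint_perm v uk p gF) iint_cat.
have q : perm_eq ks (ys ++ xs) by rewrite (perm_trans p)// perm_catC.
by apply: good_iint; [rewrite -(perm_uniq q)|exact: good_perm q gF].
Qed.

Variable psi : 'rV[R[i]^o]_6 -> R[i]^o.
Hypothesis tpsi : test_function psi.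
Variables (b l1 l2 l3 xi zeta : C) (b0 : 0 < Re b) (c d : R).

Let beta := xi * (l2 - l3).
Let A := zeta * (l1 - l3) - 2 * 'i * eta b.
Let w0 := 2^-1 * (xi - zeta) * (l2 - l3) + 'i * eta b.

Variables (v0 : R) (hv0 : v0 < Re (eta b)).
Hypothesis sc : `|c + Im w0| <= v0.
Hypothesis sd : `|d - Im beta + Im w0| <= v0.

Local Notation kf := (kfun psi b w0 beta A).
Local Notation fi := (full_integrand psi b w0 beta A 1 c).
Local Notation mi := (momentum_integrand psi b w0 beta A).

(** With the coordinates fixed, only the six momentum contours move; the prescribed x-dependent
    shifts are constants here. *)
Lemma coord_kernel_pointwise (M0 M1 t1 t2 t1' t2' : R) v :
  v 6 = t1 -> v 7 = t2 -> v 8 = t1 - t1' -> v 9 = t2' ->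
  qdilog b (coord_arg b l2 l3 xi zeta (t1 +i* c - t1'%:C)) *
  cexp (cpi R * 'i * (t1 +i* c - t1'%:C + xi * (l2 - l3)) *
     (t2%:C - t2'%:C + zeta * (l1 - l3) - 2 * 'i * eta b)) *
  fourier_test psi
    (pt6 (t1 +i* c) t2%:C (t2'%:C - t1 +i* c) t1'%:C t2'%:C (t2%:C - t1'%:C)) =
  iint [:: 0; 1; 2; 3; 4; 5]%N (fi M0 M1) v.
Proof.
move=> v6 v7 v8 v9.
pose m := nth 0 [:: - (M1 * damp t1); - (M0 * damp t2); 0; - (M0 * damp (t1 - t1')); M0 * damp t2'; 0].
rewrite (fourier_test_shift tpsi _ _ _ _ _ _ m v).
set fr := fourier_freq _ _ _ _ _ _; set a := qdilog _ _ * _.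
have g := good_expwave tpsi fr m.
have u6 : uniq [:: 0; 1; 2; 3; 4; 5]%N by [].
rewrite -(iintZ a v u6 g).
apply: eq_iint_in => x hx.
have x6 : x 6 = t1 by rewrite hx.
have x7 : x 7 = t2 by rewrite hx.
have x8 : x 8 = t1 - t1' by rewrite hx.
have x9 : x 9 = t2' by rewrite hx.
rewrite /full_integrand x6 x7 x8 x9 /kfun /expwave mulrA mul1r /a.
have uE : t1 +i* c - t1'%:C = (t1 - t1') +i* c by rewrite !complexRI rmorphB /=; ring.
rewrite uE -[_ * cexp _ * cexp _]mulrA -cexpD.
have -> : coord_arg b l2 l3 xi zeta ((t1 - t1') +i* c) = (t1 - t1') +i* c + w0.
  by rewrite /coord_arg addrA.
have -> : \sum_(k < 6) fr k * (x k +i* m k) = cpi R * 'i *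
   (- (t1 +i* c) * (x 0 +i* m 0) - t2%:C * (x 1 +i* m 1) - (t2'%:C - t1 +i* c) * (x 2 +i* m 2)
    + t1'%:C * (x 3 +i* m 3) + t2'%:C * (x 4 +i* m 4) + (t2%:C - t1'%:C) * (x 5 +i* m 5)).
  rewrite -(big_mkord xpredT (fun k => fr k * (x k +i* m k))).
  by rewrite !big_nat_recl// big_geq// /fr /fourier_freq ![nth _ [:: - _; _; _; _; _; _] _]/=; ring.
have tE : t1'%:C = t1 +i* c - ((t1 - t1') +i* c) by rewrite -uE; ring.
rewrite -[x 2 +i* m 2]/((x 2)%:C) -[x 5 +i* m 5]/((x 5)%:C).
rewrite -[m 0]/(- (M1 * damp t1)) -[m 1]/(- (M0 * damp t2)) -[m 3]/(- (M0 * damp (t1 - t1'))) -[m 4]/(M0 * damp t2').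
congr (_ * cexp _ * psi _).
  rewrite /kphase tE -mulrA -mulrDr -/beta; congr (_ * _).
  move: (_ +i* _) => P1; rewrite /A.
  ring.
apply/matrixP => i j; rewrite !mxE.
by case: j => -[|[|[|[|[|[|//]]]]]] hj.
Qed.

Lemma coord_side (M0 M1 : R) w : good [:: 6; 7; 8; 9; 0; 1; 2; 3; 4; 5]%N (fi M0 M1) ->
  fourier_gkernel (coord_kernel b l1 l2 l3 xi zeta c) psi =
  rho_x b * iint [:: 6; 7; 8; 9; 0; 1; 2; 3; 4; 5]%N (fi M0 M1) w.
Proof.
move=> gF; rewrite /fourier_gkernel /coord_kernel; apply: (congr1 ( *%R (rho_x b))).
pose ks := [:: 9; 0; 1; 2; 3; 4; 5]%N.
have g8 : good [:: 8]%N (iint ks (fi M0 M1)).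
  apply: good_iint => //; apply: (@good_catr _ _ [:: 6; 7]%N).
  by apply: good_perm gF.
apply: eq_cint => t1; apply: eq_cint => t2.
(* Variable 8 is Re (x1 - x1'), so passing from x1' to it is the reflection t |-> t1 - t. *)
pose f t := iint ks (fi M0 M1) (upd (upd (upd w 6 t1) 7 t2) 8 t).
have nf : nice f by exact: (good_nice _ _ g8).
rewrite -[RHS]/(cint f) -(cint_refl t1 nf).
apply: eq_cint => t1'; rewrite /f -[iint ks _ _]/(cint _); apply: eq_cint => t2'.
exact: coord_kernel_pointwise.
Qed.

Lemma full_integral (M0 M1 : R) w : good [:: 6; 7; 8; 9; 0; 1; 2; 3; 4; 5]%N (fi M0 M1) ->
  iint [:: 6; 7; 8; 9; 0; 1; 2; 3; 4; 5]%N (fi M0 M1) w =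
  iint [:: 0; 1; 2; 5]%N (mi (2 * (2 * (2 * 1))) d) w.
Proof.
move=> gF.
(* The pair x2, p2 gives p2 = u + beta + p3'. *)
have [e1 g1] := @iint_split _ [:: 6; 8; 9; 0; 2; 3; 4; 5]%N [:: 7; 1]%N (fi M0 M1) gF isT isT.
apply: (etrans (e1 w)); clear e1.
have F1E v : iint [:: 7; 1]%N (fi M0 M1) v =
    kf (2 * 1) (v 8 +i* c) (v 6 +i* c) 0 (v 9)%:C
    (v 0 +i* (- (M1 * damp (v 6)))) (v 8 +i* c + beta + (v 5)%:C) (v 2)%:C
    (v 3 +i* (- (M0 * damp (v 8)))) (v 4 +i* (M0 * damp (v 9))) (v 5)%:C.
  exact: (kfun_inversion1 tpsi b w0 beta A 1 (v 8 +i* c) (v 6 +i* c) (v 9)%:C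
    (v 0 +i* (- (M1 * damp (v 6)))) (v 2)%:C
    (v 3 +i* (- (M0 * damp (v 8)))) (v 4 +i* (M0 * damp (v 9))) (v 5)%:C (fun t => - (M0 * damp t))).
move: (iint [:: 7; 1]%N (fi M0 M1)) F1E g1 => F1 F1E g1.
(* The pair x2', p2' gives p2' = u + beta + p3. *)
have [e2 g2] := @iint_split _ [:: 6; 8; 0; 2; 3; 5]%N [:: 9; 4]%N (F1) g1 isT isT.
apply: (etrans (e2 w)); clear e2.
have F2E v : iint [:: 9; 4]%N F1 v =
    kf (2 * (2 * 1)) (v 8 +i* c) (v 6 +i* c) 0 0
    (v 0 +i* (- (M1 * damp (v 6)))) (v 8 +i* c + beta + (v 5)%:C) (v 2)%:C
    (v 3 +i* (- (M0 * damp (v 8)))) (v 8 +i* c + beta + (v 2)%:C) (v 5)%:C.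
  rewrite -(kfun_inversion4 tpsi b w0 beta A (2 * 1) (v 8 +i* c) (v 6 +i* c) 0
    (v 0 +i* (- (M1 * damp (v 6)))) (v 8 +i* c + beta + (v 5)%:C) (v 2)%:C
    (v 3 +i* (- (M0 * damp (v 8)))) (v 5)%:C (fun t => M0 * damp t)).
  by apply: eq_cint => t; apply: eq_cint => p; rewrite F1E.
move: (iint [:: 9; 4]%N F1) F2E g2 => F2 F2E g2.
(* The pair x1, p1 gives p1 = p1' - p3' + p3. *)
have [e3 g3] := @iint_split _ [:: 8; 2; 3; 5]%N [:: 6; 0]%N (F2) g2 isT isT.
apply: (etrans (e3 w)); clear e3.
have F3E v : iint [:: 6; 0]%N F2 v =
    kf (2 * (2 * (2 * 1))) (v 8 +i* c) 0 0 0
    (v 3 +i* (- (M0 * damp (v 8))) - (v 5)%:C + (v 2)%:C) (v 8 +i* c + beta + (v 5)%:C) (v 2)%:C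
    (v 3 +i* (- (M0 * damp (v 8)))) (v 8 +i* c + beta + (v 2)%:C) (v 5)%:C.
  rewrite -(kfun_inversion0 tpsi b w0 beta A (2 * (2 * 1)) (v 8 +i* c) c 0 0
    (v 8 +i* c + beta + (v 5)%:C) (v 2)%:C
    (v 3 +i* (- (M0 * damp (v 8)))) (v 8 +i* c + beta + (v 2)%:C) (v 5)%:C (fun t => - (M1 * damp t))).
  by apply: eq_cint => t; apply: eq_cint => p; rewrite F2E.
move: (iint [:: 6; 0]%N F2) F3E g3 => F3 F3E g3.
(* The shift of p1' has done its work; it is removed, and p1 becomes the variable. *)
have [e4 g4] := @iint_split _ [:: 8; 5; 2]%N [:: 3]%N (F3) g3 isT isT.
apply: (etrans (e4 w)); clear e4.
have F4E v : iint [:: 3]%N F3 v = cint (fun p : R =>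
    kf (2 * (2 * (2 * 1))) (v 8 +i* c) 0 0 0 p%:C (v 8 +i* c + beta + (v 5)%:C) (v 2)%:C
    (p%:C + (v 5)%:C - (v 2)%:C) (v 8 +i* c + beta + (v 2)%:C) (v 5)%:C).
  rewrite -(kfun_translate03 tpsi b w0 beta A (2 * (2 * (2 * 1))) (v 8 +i* c)
    (v 8 +i* c + beta + (v 5)%:C) (v 8 +i* c + beta + (v 2)%:C) (- (M0 * damp (v 8))) (v 2) (v 5)).
  by apply: eq_cint => p; rewrite F3E.
move: (iint [:: 3]%N F3) F4E g4 => F4 F4E g4.
have [e5 g5] := @iint_split _ [:: 5; 2]%N [:: 8]%N (F4) g4 isT isT.
apply: (etrans (e5 w)); clear e5.
(* The height of p2 = u + beta + p3' when u has height c; translating Re u turns the u integral into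
   the p2 integral. *)
pose s := c + Im beta.
have ss : `|s - Im beta + Im w0| <= v0 by rewrite /s addrK.
have F5E v : iint [:: 8]%N F4 v = iint [:: 1; 0]%N (mi (2 * (2 * (2 * 1))) s) v.
  have n8 : nice (fun t => F4 (upd v 8 t)) by exact: (good_nice v _ g4).
  rewrite -[LHS]/(cint _) -(cint_shift (- v 5 - Re beta) n8).
  apply: eq_cint => t; rewrite F4E; apply: eq_cint => p.
  rewrite /momentum_integrand /upd /=.
  have e1 : (t + (- v 5 - Re beta)) +i* c = t +i* s - (v 5)%:C - beta.
    by apply: complexP; rewrite !(cReD, cReN, cImD, cImN) /s /=; ring.
  set q := t +i* s in e1 *.
  have e2 : q - (v 5)%:C - beta + beta + (v 5)%:C = q by ring.
  have e3 : q - (v 5)%:C - beta + beta + (v 2)%:C = q + (v 2)%:C - (v 5)%:C by ring.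
  by rewrite e1 e2 e3.
rewrite (eq_iint _ _ F5E) -iint_cat.
have gs := good_momentum_integrand tpsi b0 hv0 A (2 * (2 * (2 * 1))) ss.
rewrite -(momentum_integrand_shift tpsi b0 hv0 A (2 * (2 * (2 * 1))) w ss sd).
apply/esym; exact: (@iint_perm _ [:: 0; 1; 2; 5]%N ([:: 5; 2] ++ [:: 1; 0])%N _ w isT isT gs).
Qed.

Lemma momentum_side w :
  mom_kernel b l1 l2 l3 xi zeta d psi =
  rho_x b * iint [:: 0; 1; 2; 5]%N (mi (2 * (2 * (2 * 1))) d) w.
Proof.
(* At x1 = x2 = x2' = 0 the phase is u (p3 - p1 + A) + beta A. This is the exponential of its
   constant part, which [rho_p] carries. *)
pose E := cexp (cpi R * 'i * xi * (l2 - l3) * (zeta * (l1 - l3) - 2 * 'i * eta b)).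
have gd := good_momentum_integrand tpsi b0 hv0 A E^-1 sd.
have u4 : uniq [:: 0; 1; 2; 5]%N by [].
(* Taking [ka] = [E^-1] cancels the constant part inside the integrand; 8 is the product of the
   three factors 2. *)
rewrite (@eq_iint _ _ _ (fun v => 8 * E * mi E^-1 d v)); last first.
  move=> v; rewrite /momentum_integrand /kfun !mulrA mulfK ?cexp_neq0//.
  by congr (_ * _ * _ * _); ring.
rewrite (iintZ _ _ u4 gd) mulrA /mom_kernel /rho_p -/E [rho_x b * _]mulrCA -[8 * rho_x b * E]mulrA.
apply: (congr1 ( *%R (8 * (rho_x b * E)))).
apply: eq_cint => t1; apply: eq_cint => t2; apply: eq_cint => t3; apply: eq_cint => t3'.
rewrite /momentum_integrand /upd /= /kfun.
set q := t2 +i* d.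
have -> : mom_arg b l2 l3 xi zeta (q - t3'%:C) = q - t3'%:C - beta + w0.
  by rewrite /mom_arg /beta /w0; field.
have -> : t1%:C + q - (q + t3%:C - t3'%:C) = t1%:C + t3'%:C - t3%:C by ring.
rewrite /E -cexpN [cexp _ * qdilog _ _]mulrC -[_ * cexp _ * cexp _]mulrA -cexpD.
by congr (_ * cexp _ * _); rewrite /kphase /beta /A; ring.
Qed.
End Assembly.

Theorem proposition7p4 (R : realType) (b l1 l2 l3 xi zeta : R[i])
    (hb : 0 < complex.Re b) (c d : R)
    (hc : qdilog_strip b (coord_arg b l2 l3 xi zeta (0 +i* c)))
    (hd : qdilog_strip b (mom_arg b l2 l3 xi zeta (0 +i* d)))
    (psi : 'rV[R[i]^o]_6 -> R[i]^o) (hpsi : test_function psi) :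
  fourier_gkernel (coord_kernel b l1 l2 l3 xi zeta c) psi =
  mom_kernel b l1 l2 l3 xi zeta d psi.
Proof.
pose beta := xi * (l2 - l3); pose w0 := 2^-1 * (xi - zeta) * (l2 - l3) + 'i * eta b.
(* One closed strip that contains both contours and still lies inside the open strip where phi is
   analytic. *)
pose v0 := Num.max `|c + Im w0| `|d - Im beta + Im w0|.
have hc' : `|c + Im w0| < Re (eta b).
  have := hc; rewrite /qdilog_strip /coord_arg -addrA.
  by rewrite -/w0 cImD.
have hd' : `|d - Im beta + Im w0| < Re (eta b).
  have := hd; rewrite /qdilog_strip.
  have -> : mom_arg b l2 l3 xi zeta (0 +i* d) = 0 +i* d - beta + w0.
    by rewrite /mom_arg /beta /w0; field.
  by rewrite !cImD cImN.
have hv0 : v0 < Re (eta b) by rewrite gt_max hc' hd'.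
have sc : `|c + Im w0| <= v0 by rewrite le_max lexx.
have sd : `|d - Im beta + Im w0| <= v0 by rewrite le_max lexx orbT.
have [[M0 M1] gF] := good_full_integrand hpsi hb hv0 beta (zeta * (l1 - l3) - 2 * 'i * eta b) 1 sc.
rewrite (coord_side hpsi (fun=> 0) gF) (full_integral hpsi hb hv0 sc sd (fun=> 0) gF).
by rewrite (@momentum_side _ _ hpsi b l1 l2 l3 xi zeta hb d _ hv0 sd (fun=> 0)).
Qed.
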